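(* Let $s'\in(0,\tfrac12)$ and $s\in(s'+\tfrac12,1)$. Let $u_0\in L^2(0,1)\setminus\dot H^{s'}(0,1)$ and $f\in\dot H^s(0,1)$. Let $q,\tilde q\in\mathcal{A}\cap\dot H^s(0,1)$ and $T,\tilde T>0$, and let $u=u(q)$, $\tilde u=u(\tilde q)$ be the solutions of problem (Q) with potentials $q,\tilde q$ respectively (same $u_0,f,a_0,a_1$). If $u(T)=\tilde u(\tilde T)$ in $(0,1)$, then $T=\tilde T$.
   Context: Let $\Omega=(0,1)$, $\alpha\in(0,1)$, $c_0>0$, and $\mathcal{A}=\{q\in L^\infty(0,1):0\le q\le c_0\}$. Let $a_0,a_1>0$ be constants and $u_0,f$ given time-independent functions. Problem (Q): $\partial_t^\alpha u-\partial_{xx}u+qu=f$ in $(0,1)\times(0,\infty)$, $u(0,t)=a_0$, $u(1,t)=a_1$, $u(\cdot,0)=u_0$, where $\partial_t^\alpha u(t)=\frac1{\Gamma(1-\alpha)}\int_0^t(t-s)^{-\alpha}u'(s)\,ds$ is the Caputo derivative. For $q\in\mathcal{A}$, $A_q=-\partial_{xx}+q$ with zero Dirichlet conditions on $L^2(0,1)$ has eigenpairs $(\lambda_n(q),\varphi_n(q))$ with $\{\varphi_n(q)\}$ orthonormal; $F_q(t)v=\sum_nE_{\alpha,1}(-\lambda_n(q)t^\alpha)(v,\varphi_n(q))\varphi_n(q)$ with $E_{\alpha,\beta}(z)=\sum_{k\ge0}z^k/\Gamma(k\alpha+\beta)$; $\phi_q$ solves $-\phi''+q\phi=0$ on $(0,1)$,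 $\phi(0)=a_0,\phi(1)=a_1$. The solution of (Q) is $u(t)=F_q(t)u_0+(I-F_q(t))\phi_q+(I-F_q(t))A_q^{-1}f$. For $s\in[0,1]$, $\dot H^s(0,1)=\{v\in L^2(0,1):\sum_n(n\pi)^{2s}(v,\sqrt2\sin(n\pi x))^2<\infty\}$ (the norm is equivalent to $(\sum_n\lambda_n(q)^s(v,\varphi_n(q))^2)^{1/2}$ for any $q\in\mathcal{A}$). *)

(* Defs.v *)
From HB Require Import structures.
From mathcomp Require Import all_boot all_order all_algebra.
From mathcomp Require Import all_classical all_reals all_analysis.
Set Implicit Arguments. Unset Strict Implicit. Unset Printing Implicit Defensive.
Import Order.TTheory GRing.Theory Num.Theory.
Import numFieldNormedType.Exports.
Local Open Scope classical_set_scope.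
Local Open Scope ring_scope.

Section Defs.
Variable R : realType.
Notation mu := (@lebesgue_measure R).

Definition Omega : set R := `]0, 1[.

Definition L2 (v : R -> R) : Prop :=
  measurable_fun Omega v /\ (\int[mu]_(x in Omega) ((v x) ^+ 2)%:E < +oo)%E.

Definition inner (v w : R -> R) : R := Rintegral mu Omega (fun x => v x * w x).

Definition eq_L2 (v w : R -> R) : Prop := v = w %[ae mu in Omega].

Definition psum (a : nat -> R -> R) (N : nat) (x : R) : R := \sum_(n < N) a n x.

Definition L2_series (a : nat -> R -> R) (g : R -> R) : Prop :=
  L2 g /\
  (fun N : nat => (\int[mu]_(x in Omega) ((psum a N x - g x) ^+ 2)%:E)%E)
    @ \oo --> 0%E.

Definition Gamma (x : R) : R :=
  Rintegral mu `]0, +oo[ (fun t => powR t (x - 1) * expR (- t)).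

Definition mittag_leffler (a b z : R) : R :=
  limn (fun N : nat => \sum_(k < N) z ^+ k / Gamma (k%:R * a + b)).

(** The admissible set A = {q in L^inf(0,1) : 0 <= q <= c0}
    (stated on a representative). *)
Definition admissible (c0 : R) (q : R -> R) : Prop :=
  measurable_fun Omega q /\ (forall x, Omega x -> 0 <= q x <= c0).

Definition sine_coef (v : R -> R) (n : nat) : R :=
  inner v (fun x => Num.sqrt 2 * sin (n%:R * pi * x)).

Definition Hdot (s : R) (v : R -> R) : Prop :=
  L2 v /\
  (\sum_(1 <= n <oo) ((powR (n%:R * pi) (2 * s) * (sine_coef v n) ^+ 2)%:E)
     < +oo)%E.

(** [p] is an H^2(0,1) (strong) solution of p'' = c p on (0,1):
    p and its derivative dp are absolutely continuous on [0,1] with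
    p' = dp and dp' = c p a.e. *)
Definition strong_sol (c p : R -> R) : Prop :=
  exists dp : R -> R,
    mu.-integrable `[0, 1] (EFin \o dp) /\
    mu.-integrable `[0, 1] (EFin \o (fun x => c x * p x)) /\
    forall x, 0 <= x <= 1 ->
      p x = p 0 + Rintegral mu `[0, x] dp /\
      dp x = dp 0 + Rintegral mu `[0, x] (fun y => c y * p y).

Definition dirichlet_eigenpair (q : R -> R) (lam : R) (phi : R -> R) : Prop :=
  phi 0 = 0 /\ phi 1 = 0 /\ strong_sol (fun x => q x - lam) phi.

Definition eigensystem (q : R -> R) (lam : nat -> R) (phi : nat -> R -> R) : Prop :=
  (forall n, dirichlet_eigenpair q (lam n) (phi n)) /\
  (forall n m, inner (phi n) (phi m) = (n == m)%:R) /\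
  (forall v, L2 v -> (forall n, inner v (phi n) = 0) -> eq_L2 v (fun=> 0)).

Definition phi_q_sol (q : R -> R) (a0 a1 : R) (ph : R -> R) : Prop :=
  ph 0 = a0 /\ ph 1 = a1 /\ strong_sol q ph.

Definition Fq (alpha : R) (lam : nat -> R) (phi : nat -> R -> R)
    (t : R) (v w : R -> R) : Prop :=
  L2_series (fun n x => mittag_leffler alpha 1 (- lam n * powR t alpha)
                         * inner v (phi n) * phi n x) w.

Definition Aq_inv (lam : nat -> R) (phi : nat -> R -> R) (v w : R -> R) : Prop :=
  L2_series (fun n x => (lam n)^-1 * inner v (phi n) * phi n x) w.

(** w = u(t) = F_q(t) u0 + (I - F_q(t)) phi_q + (I - F_q(t)) A_q^{-1} f,
    the solution of problem (Q) at time t. *)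
Definition sol_at (alpha : R) (lam : nat -> R) (phi : nat -> R -> R)
    (phiq u0 f : R -> R) (t : R) (w : R -> R) : Prop :=
  exists w1 w2 g w3 : R -> R,
    Fq alpha lam phi t u0 w1 /\ Fq alpha lam phi t phiq w2 /\
    Aq_inv lam phi f g /\ Fq alpha lam phi t g w3 /\
    eq_L2 w (fun x => w1 x + (phiq x - w2 x) + (g x - w3 x)).

End Defs.

(* Main.v *)
Require Import Defs.
From HB Require Import structures.
From mathcomp Require Import all_boot all_order all_algebra.
From mathcomp Require Import all_classical all_reals all_analysis.
From mathcomp Require Import measurable_realfun ring lra zify.
Set Implicit Arguments. Unset Strict Implicit. Unset Printing Implicit Defensive.
Import Order.TTheory GRing.Theory Num.Theory.
Import numFieldNormedType.Exports.
Local Open Scope classical_set_scope.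
Local Open Scope ring_scope.

(** The Mittag-Leffler function is the limit of the coefficients of
    [(1 - z)^-1 / (1 + x n^(-a) (1 - z)^(-a))]. Positivity and monotonicity of these
    coefficients, together with Gauss's limit for the Gamma function, give
    [x E_{a,1}(-x) = 1 / Gamma(1 - a) + O(x^(-1/2))].
    Hence, up to a remainder gaining one derivative, [A_q F_q(T)] acts as multiplication by
    [c_T = 1 / (Gamma(1 - a) T^a)]. Testing [A_q u(T)] against the sines [e_k], the boundary
    terms and [f] are the same for both potentials, so that
    [(c_T - c_Tt) (u0, e_k)] equals [((q - qt) u, e_k)] plus a sequence lying in the weighted
    [l^2] space that describes [Hdot s']. Since [s > s' + 1/2], the sine series of [q - qt]
    converges absolutely with weight [j^s'], while the cosine coefficients of [u] are
    [O(1/m)]; hence [((q - qt) u, e_k)] is in that space as well.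
    If [c_T <> c_Tt] this would put [u0] in [Hdot s']. *)

(** * The Mittag-Leffler function *)

(** The generating function is the discrete counterpart of the Laplace transform
    [p^(a-1) / (p^a + x)] of [t -> E_{a,1}(-x t^a)], with [p] replaced by [n (1 - z)], so that the
    coefficient of index [n] sits at time 1. In this form positivity and monotonicity follow from
    the signs of binomial coefficients by induction, and a monotone Tauberian argument gives the
    rate [x^(-1/2)]. At [x = lambda T^a] this is a factor [lambda^(-1/2)], that is, one derivative.
    On the side of the equation, the obstacle is that the two potentials have unrelated eigenbases
    while [u0] is merely square integrable. The sines are common to both problems and lie in the
    domain of both operators; all identities are therefore proved coefficient by coefficient against
    [e_k], and remainders appear as sequences rather than functions. The restriction [s' < 1/2]
    makes the nonzero boundary values harmless: they leave sine coefficients of order [1/k], which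
    the weight still tolerates. *)

Section BinomialCoefficients.
Variable R : realType.
Implicit Types (s a b e : R) (n k : nat) (f g : nat -> R).

(* [cf s n] is the coefficient of [z^n] in [(1 - z)^(-s)]. *)
Definition cf s n : R := \prod_(j < n) ((s + j%:R) / j.+1%:R).

Lemma cf0 s : cf s 0 = 1. Proof. by rewrite /cf big_ord0. Qed.

Lemma cfS s n : cf s n.+1 = cf s n * ((s + n%:R) / n.+1%:R).
Proof. by rewrite /cf big_ord_recr. Qed.

Lemma cf_shift s n : cf s n.+1 = s / n.+1%:R * cf (s + 1) n.
Proof.
elim: n => [|n IH]; first by rewrite cfS !cf0 addr0 mul1r mulr1.
rewrite cfS IH (cfS (s + 1)) -!natr1.
by field; rewrite !natr1 !pnatr_eq0.
Qed.

Lemma cf_addS s n : cf (s + 1) n.+1 = cf (s + 1) n + cf s n.+1.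
Proof.
rewrite cfS cf_shift -!natr1.
by field; rewrite natr1 pnatr_eq0.
Qed.

Lemma cf1 n : cf 1 n = 1.
Proof.
elim: n => [|n IH]; first exact: cf0.
by rewrite cfS IH mul1r addrC natr1 divff// pnatr_eq0.
Qed.

Lemma cf_gt0 s n : 0 < s -> 0 < cf s n.
Proof.
move=> s0; apply: prodr_gt0 => j _.
by rewrite divr_gt0// ltr_wpDr.
Qed.

Lemma cf_ge0 s n : 0 <= s -> 0 <= cf s n.
Proof.
by move=> s0; apply: prodr_ge0 => j _; rewrite divr_ge0// addr_ge0.
Qed.

Lemma cf_decr s n : 0 <= s <= 1 -> cf s n.+1 <= cf s n.
Proof.
move=> /andP[s0 s1]; rewrite cfS ler_piMr ?cf_ge0//.
by rewrite ler_pdivrMr// mul1r -natr1 addrC lerD2l.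
Qed.

Lemma cf_decrW s n m : 0 <= s <= 1 -> (n <= m)%N -> cf s m <= cf s n.
Proof.
by move=> s01 /subnKC <-; elim: (m - n)%N => [|k IH]; rewrite ?addn0// addnS;
  exact: le_trans (cf_decr _ s01) IH.
Qed.

(** [cf_shift] pulls out the factor [- s] and leaves a coefficient with parameter [1 - s > 0]. These
    signs, of the coefficients of [(1 - z)^s], drive the inductions on [ycoef]. *)
Lemma cf_neg_le0 s n : 0 < s < 1 -> cf (- s) n.+1 <= 0.
Proof.
move=> /andP[s0 s1]; rewrite cf_shift.
have : 0 <= cf (- s + 1) n by rewrite cf_ge0// addrC subr_ge0 ltW.
have : 0 < n.+1%:R :> R by [].
by move=> *; rewrite mulr_le0_ge0// mulr_le0_ge0 ?invr_ge0 ?ltW// oppr_lt0.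
Qed.

(** Multiplication by [(1 - z)^(-1)] takes partial sums and raises the parameter by one. *)
Lemma sum_cf s n : \sum_(j < n.+1) cf s j = cf (s + 1) n.
Proof.
elim: n => [|n IH]; first by rewrite big_ord1 !cf0.
by rewrite big_ord_recr/= IH cf_addS.
Qed.

(* [cf (1 - a) n * cf (1 + a) n = prod_(1 <= j <= n) (1 - (a / j)^2)]; for [j >= 2] the factors are
   at least [1 - 1 / j^2], whose product telescopes. *)
Lemma cf_mul_ge a n : 0 < a < 1 ->
  (1 - a ^+ 2) / 2 <= cf (1 - a) n * cf (1 + a) n.
Proof.
move=> /andP[a0 a1].
have h : 0 <= 1 - a ^+ 2 by rewrite subr_ge0 expr_le1 ?ltW.
suff H : forall m, (1 - a ^+ 2) / 2 * ((m%:R + 2) / m.+1%:R) <=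
    cf (1 - a) m.+1 * cf (1 + a) m.+1.
  case: n => [|n]; first by rewrite !cf0; nra.
  apply: le_trans (_ : _ <= (1 - a ^+ 2) / 2 * ((n%:R + 2) / n.+1%:R)) _.
    by rewrite ler_peMr ?divr_ge0// ler_pdivlMr// mul1r -natr1; lra.
  exact: H.
elim=> [|m IH].
  by rewrite !cfS !cf0 !divr1 !mul1r !addr0 add0r; nra.
rewrite cfS (cfS (1 + a)) [leRHS]mulrACA.
have H : 0 <= (1 - a + m.+1%:R) / m.+2%:R * ((1 + a + m.+1%:R) / m.+2%:R).
  by rewrite mulr_ge0// divr_ge0// addr_ge0//; lra.
apply: le_trans (ler_wpM2r H IH).
rewrite -[leRHS]mulrA ler_wpM2l ?divr_ge0//.
rewrite [X in _ <= _ * X]mulrACA -invfM -[m.+2%:R]natr1 -[m.+1%:R]natr1.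
have m0 : 0 <= m%:R :> R by [].
move: (m%:R : R) m0 => x x0.
have -> : (x + 2) / (x + 1) * ((1 - a + (x + 1)) * (1 + a + (x + 1)) / ((x + 1 + 1) * (x + 1 + 1)))
   = ((x + 2) ^+ 2 - a ^+ 2) / ((x + 1) * (x + 2)).
  by field; apply/andP; split; lra.
rewrite ler_pdivlMr; last nra.
have -> : (x + 1 + 2) / (x + 1 + 1) * ((x + 1) * (x + 2)) = (x + 3) * (x + 1).
  by field; lra.
nra.
Qed.

Definition conv f g n : R := \sum_(j < n.+1) f j * g (n - j)%N.

Lemma convC f g n : conv f g n = conv g f n.
Proof.
rewrite /conv (reindex_inj rev_ord_inj)/=; apply: eq_bigr => j _.
by rewrite subSS subKn 1?mulrC// -ltnS.
Qed.

(* Vandermonde: [(1 - z)^(-a) (1 - z)^(-b) = (1 - z)^(-a-b)] *)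
Lemma conv_cf a b n : conv (cf a) (cf b) n = cf (a + b) n.
Proof.
elim: n => [|n IH]; first by rewrite /conv big_ord1 !cf0 mulr1.
have n1 : n.+1%:R != 0 :> R by rewrite pnatr_eq0.
rewrite cfS -IH; apply: (mulfI n1).
(* Splitting [n + 1] as [j + (n + 1 - j)] is the product rule for the derivative of the generating
   function; each half is then reduced by [cfS]. *)
have -> : n.+1%:R * conv (cf a) (cf b) n.+1 =
   \sum_(j < n.+2) (j%:R * cf a j) * cf b (n.+1 - j)%N +
   \sum_(j < n.+2) cf a j * ((n.+1 - j)%N%:R * cf b (n.+1 - j)%N).
  rewrite /conv mulr_sumr -big_split/=; apply: eq_bigr => j _.
  have jn : (j <= n.+1)%N by rewrite -ltnS.
  have -> : n.+1%:R = j%:R + (n.+1 - j)%:R :> R by rewrite -natrD subnKC.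
  ring.
rewrite big_ord_recl/= mulr0n !mul0r add0r.
rewrite [X in _ + X]big_ord_recr/= subnn mulr0n mul0r mulr0 addr0.
rewrite -big_split/= mulrC !mulrA mulrVK ?unitfE//.
rewrite mulr_suml; apply: eq_bigr => j _.
have jn : (j <= n)%N by rewrite -ltnS.
have e1 : (n.+1 - j = (n - j).+1)%N by rewrite subSn.
rewrite /bump/= add1n subSS e1 (cfS a) (cfS b).
have h1 : j.+1%:R != 0 :> R by rewrite pnatr_eq0.
have h2 : (n - j).+1%:R != 0 :> R by rewrite pnatr_eq0.
have -> : n%:R = j%:R + (n - j)%:R :> R by rewrite -natrD subnKC.
by field; rewrite ![1 + _]addrC !natr1 h1 h2.
Qed.

End BinomialCoefficients.

(** * Series with a geometric majorant *)

Section DominatedSeries.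
Variable R : realType.
Implicit Types (u v : nat -> R) (C rho : R).

Lemma dominated_series_cvg u C rho : 0 <= rho < 1 ->
  (forall k, `|u k| <= C * rho ^+ k) -> cvgn (series u).
Proof.
move=> /andP[r0 r1] h; apply: normed_cvg.
apply: (@series_le_cvg _ _ (geometric C rho)) => //=.
- by move=> n; exact: le_trans (h n).
- by apply: is_cvg_geometric_series; rewrite ger0_norm.
Qed.

Lemma sum_geometric_le C rho m n : 0 <= C -> 0 <= rho < 1 ->
  \sum_(m <= k < n) C * rho ^+ k <= C * rho ^+ m / (1 - rho).
Proof.
move=> C0 /andP[r0 r1].
have r1' : 0 < 1 - rho by rewrite subr_gt0.
have [nm|mn] := leqP n m.
  by rewrite big_geq// divr_ge0 ?(ltW r1')// mulr_ge0// exprn_ge0.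
rewrite ler_pdivlMr// -(subnKC (ltnW mn)).
suff -> : forall l, (\sum_(m <= k < m + l) C * rho ^+ k) * (1 - rho) =
   C * rho ^+ m - C * rho ^+ (m + l).
  by rewrite lerBlDr lerDl mulr_ge0// exprn_ge0.
elim=> [|l IH]; first by rewrite addn0 big_geq// mul0r subrr.
rewrite addnS big_nat_recr/= ?leq_addr// mulrDl IH exprS; ring.
Qed.

Lemma dominated_series_tail u C rho m : 0 <= rho < 1 ->
  (forall k, `|u k| <= C * rho ^+ k) ->
  `|limn (series u) - series u m| <= C * rho ^+ m / (1 - rho).
Proof.
move=> r01 h.
have C0 : 0 <= C by have := h 0; rewrite expr0 mulr1; exact: le_trans.
have cu := dominated_series_cvg r01 h.
have c : `|series u n - series u m| @[n --> \oo] --> `|limn (series u) - series u m|.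
  by apply: cvg_norm; apply: cvgB => //; exact: cvg_cst.
apply: (cvgr_to_le c); near=> n.
have mn : (m <= n)%N by near: n; exact: nbhs_infty_ge.
rewrite sub_series_geq// (le_trans (ler_norm_sum _ _ _))//.
apply: le_trans (sum_geometric_le m n C0 r01).
exact: ler_sum.
Unshelve. all: by end_near. Qed.

(** The heads up to [M] converge termwise and the tails are uniformly small. The majorant is asked
    for only at large [n], because [x n^(-a)] is small only there. *)
Lemma tannery (u : nat -> nat -> R) v C rho : 0 <= rho < 1 ->
  (\forall n \near \oo, forall k, `|u n k| <= C * rho ^+ k) ->
  (forall k, u n k @[n --> \oo] --> v k) ->
  limn (series (u n)) @[n --> \oo] --> limn (series v).
Proof.
move=> r01 h uv; have /andP[r0 r1] := r01.
have hv k : `|v k| <= C * rho ^+ k.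
  have /cvg_norm c := uv k.
  by apply: (cvgr_to_le c); apply: filterS h => n; exact.
have C0 : 0 <= C by have := hv 0; rewrite expr0 mulr1; exact: le_trans.
apply/cvgrPdist_le => /= e e0.
have r1' : 0 < 1 - rho by rewrite subr_gt0.
have [M hM] : exists M, C * rho ^+ M / (1 - rho) <= e / 3.
  have : C * rho ^+ n / (1 - rho) @[n --> \oo] --> C * 0 / (1 - rho).
    apply: cvgMl; apply: cvgMr; apply: cvg_expr; by rewrite ger0_norm.
  rewrite mulr0 mul0r => /cvgrPdist_le /(_ (e / 3)).
  rewrite divr_gt0// => /(_ isT)[M _ /(_ M (leqnn M))].
  rewrite sub0r normrN ger0_norm; first by exists M.
  by rewrite divr_ge0 ?(ltW r1')// mulr_ge0// exprn_ge0.
have cM : series (u n) M @[n --> \oo] --> series v M.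
  rewrite /series/=.
  exact: (@cvg_big _ _ _ _ _ add_continuous).
move/cvgrPdist_le : cM => /(_ (e / 3)); rewrite divr_gt0// => /(_ isT) cM.
near=> n.
have h1 := dominated_series_tail M r01 hv.
have h2 : `|limn (series (u n)) - series (u n) M| <= C * rho ^+ M / (1 - rho).
  by apply: dominated_series_tail r01 _; near: n.
have h3 : `|series v M - series (u n) M| <= e / 3 by near: n.
have -> : limn (series v) - limn (series (u n)) =
  (limn (series v) - series v M) - (limn (series (u n)) - series (u n) M) +
  (series v M - series (u n) M) by ring.
apply: le_trans (ler_normD _ _) _.
have := ler_normB (limn (series v) - series v M) (limn (series (u n)) - series (u n) M).
lra.
Unshelve. all: by end_near. Qed.

End DominatedSeries.

(** * The discrete relaxation sequence: positivity, monotonicity, two-sided bounds *)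

Section DiscreteRelaxation.
Variables (R : realType) (a e : R).
Hypotheses (a01 : 0 < a < 1) (e0 : 0 < e) (e1 : e * expR 2 <= 1).
Implicit Types (b g : R) (n k m : nat).

Let a0 : 0 < a. Proof. by case/andP: a01. Qed.
Let a1 : a < 1. Proof. by case/andP: a01. Qed.

(** The [k]-th term of the geometric expansion of [1 / (1 + e (1 - z)^(-a))], read off at [z^n]
    after multiplication by [(1 - z)^(-b)]. *)
Definition yterm b n k : R := (- e) ^+ k * cf (k%:R * a + b) n.

(* coefficient of [z^n] in [(1 - z)^(-b) / (1 + e (1 - z)^(-a))] *)
Definition ycoef b n : R := limn (series (yterm b n)).

(** This is [1 + y <= exp y] at [y = (1 + k) / n], raised to the power [n]. A factor [exp k] thus
    absorbs the growth in [k] of [cf (k a + b) n], and the hypothesis [e1] leaves the ratio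
    [exp (-1)]. *)
Lemma exp_le_geometric n k : (1 + k%:R) ^+ n <= n%:R ^+ n * expR (1 + k%:R) :> R.
Proof.
case: n => [|n]; first by rewrite !expr0 mul1r (le_trans _ (expR_ge1Dx _))// lerDl.
rewrite -[X in expR X](@divfK _ n.+1%:R) ?pnatr_eq0//.
rewrite expRM_natr -exprMn lerXn2r ?nnegrE ?addr_ge0// ?mulr_ge0 ?expR_ge0//.
apply: le_trans (_ : n.+1%:R * (1 + (1 + k%:R) / n.+1%:R) <= _).
  by rewrite mulrDr mulr1 mulrC divfK ?pnatr_eq0// lerDr.
by rewrite ler_wpM2l// expR_ge1Dx.
Qed.

Lemma yterm_dominated b n : exists C, forall k,
  `|yterm b n k| <= C * expR (-1) ^+ k.
Proof.
exists ((`|b| + 1) ^+ n * n%:R ^+ n * expR 1) => k.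
rewrite normrM normrX normrN (gtr0_norm e0).
have h : `|cf (k%:R * a + b) n| <= ((`|b| + 1) * (1 + k%:R)) ^+ n.
  rewrite normr_prod -[X in _ <= _ ^+ X]card_ord -prodr_const.
  apply: ler_prod => j _; rewrite normr_ge0/= normrM normfV.
  have j0 : 0 < j.+1%:R :> R by [].
  rewrite (gtr0_norm j0) ler_pdivrMr//.
  have n1 := ler_normD (k%:R * a + b) j%:R.
  have n2 := ler_normD (k%:R * a) b.
  have n3 : `|k%:R * a| <= k%:R by rewrite ger0_norm ?mulr_ge0 ?(ltW a0)// ler_piMr ?(ltW a1).
  have n4 : `|j%:R| = j%:R :> R by rewrite ger0_norm.
  rewrite -natr1.
  have jn : 0 <= j%:R :> R by []. have kn : 0 <= k%:R :> R by [].
  have bn := normr_ge0 b.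
  rewrite n4 in n1.
  move: (j%:R) (k%:R) `|b| jn kn bn n1 n2 n3 => x y z x0 y0 z0 n1 n2 n3.
  have := mulr_ge0 z0 y0. have := mulr_ge0 z0 x0. have := mulr_ge0 y0 x0.
  have := mulr_ge0 (mulr_ge0 z0 y0) x0. nra.
rewrite exprMn in h.
have e' : e ^+ k * expR k%:R <= expR (-1) ^+ k.
  have -> : expR k%:R = expR 1 ^+ k :> R by rewrite -expRM_natl mulr1.
  rewrite -exprMn lerXn2r ?nnegrE ?expR_ge0//; first by rewrite mulr_ge0 ?expR_ge0 ?(ltW e0).
  rewrite -[expR (-1)]mul1r -ler_pdivrMr ?expR_gt0// -expRN opprK.
  by rewrite -mulrA -expRD (_ : 1 + 1 = 2 :> R).
have hp := exp_le_geometric n k; rewrite expRD in hp.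
have b0 : 0 <= (`|b| + 1) ^+ n by rewrite exprn_ge0// addr_ge0.
apply: le_trans (ler_wpM2l _ h) _; first by rewrite exprn_ge0// ltW.
apply: le_trans (ler_wpM2l _ (ler_wpM2l b0 hp)) _; first by rewrite exprn_ge0// ltW.
rewrite [leLHS](_ : _ = (`|b| + 1) ^+ n * n%:R ^+ n * expR 1 * (e ^+ k * expR k%:R)); last by ring.
by rewrite ler_wpM2l// mulr_ge0 ?expR_ge0// mulr_ge0// exprn_ge0.
Qed.

Lemma expRN1_itv : 0 <= expR (-1 : R) < 1.
Proof. by rewrite expR_ge0 expR_lt1 oppr_lt0/=. Qed.

Lemma ycoef_cvg b n : series (yterm b n) @ \oo --> ycoef b n.
Proof.
have [C hC] := yterm_dominated b n.
exact: dominated_series_cvg expRN1_itv hC.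
Qed.

Lemma conv_ycoef g b n : conv (cf g) (ycoef b) n = ycoef (g + b) n.
Proof.
apply: (@cvg_unique _ _ (series (yterm (g + b) n) @ \oo)) => //; last exact: ycoef_cvg.
have -> : series (yterm (g + b) n) = fun M => conv (cf g) (fun j => series (yterm b j) M) n.
  apply/funext => M; rewrite /series/= /conv.
  under [RHS]eq_bigr do rewrite mulr_sumr.
  rewrite exchange_big/=; apply: eq_bigr => k _.
  rewrite /yterm (_ : k%:R * a + (g + b) = g + (k%:R * a + b)); last by ring.
  by rewrite -conv_cf /conv mulr_sumr; apply: eq_bigr => j _; ring.
rewrite /conv.
apply: (@cvg_big _ _ _ _ _ add_continuous) => j _.
by apply: cvgMr; exact: ycoef_cvg.
Qed.

(** With [w = e (1 - z)^(-a)], this is [1 / (1 + w) = 1 - w / (1 + w)]. *)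
Lemma ycoefE b n : ycoef b n = cf b n - e * ycoef (b + a) n.
Proof.
apply: (@cvg_unique _ _ ((fun M => series (yterm b n) M.+1) @ \oo)) => //=.
  by rewrite (cvg_shiftS (series (yterm b n))); exact: ycoef_cvg.
have -> : (fun M => series (yterm b n) M.+1) = fun M => cf b n - e * series (yterm (b + a) n) M.
  apply/funext => M /=; rewrite /series/= big_nat_recl// big_mkord.
  rewrite {1}/yterm mul0r add0r expr0 mul1r big_mkord mulr_sumr -sumrN; congr (_ + _).
  apply: eq_bigr => k _; rewrite /yterm exprS -natr1.
  by rewrite (_ : (k%:R + 1) * a + b = k%:R * a + (b + a)); ring.
by apply: cvgB; [exact: cvg_cst|apply: cvgMr; exact: ycoef_cvg].
Qed.

Let Y := ycoef 1.

(** Multiplying the generating function by [(1 - z)^a + e] leaves [(1 - z)^(a - g)]. The result is a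
    renewal equation, the discrete form of the fractional relaxation equation; the term [j = 0] of
    [(1 - z)^a] has been joined to [e]. *)
Lemma conv_neg n g : (1 + e) * ycoef g n + \sum_(j < n) cf (- a) j.+1 * ycoef g (n - j.+1)%N
  = cf (g - a) n.
Proof.
have := conv_ycoef (- a) g n; rewrite ycoefE addrAC addNr add0r /conv.
rewrite big_ord_recl/= cf0 mul1r subn0 => /eqP; rewrite eq_sym subr_eq => /eqP.
rewrite addrC [g - a]addrC => ->.
by rewrite mulrDl mul1r addrAC addrC addrA.
Qed.

(** Strong induction on the renewal equation: its right-hand side is nonnegative and its memory
    coefficients are nonpositive. *)
Lemma ycoef_ge0 n : 0 <= Y n.
Proof.
have [m] := ubnP n; elim: m n => // m IH n; rewrite ltnS => nm.
have e1p : 0 < 1 + e by rewrite addr_gt0.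
rewrite -(pmulr_rge0 _ e1p).
have /eqP := conv_neg n 1; rewrite eq_sym -subr_eq => /eqP <-.
rewrite -sumrN addr_ge0//; first by rewrite cf_ge0// subr_ge0 ltW.
apply: sumr_ge0 => j _; rewrite -mulNr mulr_ge0 ?oppr_ge0 ?cf_neg_le0//.
by apply: IH; have := ltn_ord j; lia.
Qed.

(** Here the generating function is [1 - z] times that of [Y], so these are the increments of [Y].
    In the renewal equation the last memory term combines with the right-hand side into
    [cf (- a) n.+1 * (1 - ycoef 0 0)], whose sign is known since [ycoef 0 0 = 1 / (1 + e)]. *)
Lemma ycoef0_le0 n : ycoef 0 n.+1 <= 0.
Proof.
have e1p : 0 < 1 + e by rewrite addr_gt0.
have Y0 : (1 + e) * ycoef 0 0 = 1.
  by have := conv_neg 0 0; rewrite big_ord0 addr0 cf0.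
have Y01 : ycoef 0 0 <= 1.
  by rewrite -(ler_pM2l e1p) Y0 mulr1 lerDl ltW.
have [m] := ubnP n; elim: m n => // m IH n; rewrite ltnS => nm.
rewrite -(pmulr_rle0 _ e1p).
have /eqP := conv_neg n.+1 0; rewrite eq_sym -subr_eq => /eqP <-.
rewrite big_ord_recr/= subnn sub0r; set S := \sum_(j < n) _.
rewrite (_ : _ - _ = - (- cf (- a) n.+1 * (1 - ycoef 0 0) + S)); last by ring.
rewrite oppr_le0 addr_ge0//.
  by rewrite mulr_ge0 ?oppr_ge0 ?cf_neg_le0// subr_ge0.
apply: sumr_ge0 => j _.
rewrite (_ : (n.+1 - j.+1 = (n - j.+1).+1)%N); last by have := ltn_ord j; lia.
rewrite -mulrNN mulr_ge0// oppr_ge0 ?cf_neg_le0//.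
by apply: IH; have := ltn_ord j; lia.
Qed.

Lemma ycoef_decr n : Y n.+1 <= Y n.
Proof.
suff -> : Y n.+1 = Y n + ycoef 0 n.+1 by rewrite gerDl ycoef0_le0.
apply: (@cvg_unique _ _ (series (yterm 1 n.+1) @ \oo)) => //; first exact: ycoef_cvg.
have -> : series (yterm 1 n.+1) = fun M => series (yterm 1 n) M + series (yterm 0 n.+1) M.
  apply/funext => M; rewrite /series/= -big_split/=; apply: eq_bigr => k _.
  by rewrite /yterm cf_addS addr0; ring.
by apply: cvgD; exact: ycoef_cvg.
Qed.

Lemma ycoef_decrW n m : (n <= m)%N -> Y m <= Y n.
Proof.
by move=> /subnKC <-; elim: (m - n)%N => [|k IH]; rewrite ?addn0// addnS;
  exact: le_trans (ycoef_decr _) IH.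
Qed.

Lemma ycoef_le1 n : Y n <= 1.
Proof.
apply: le_trans (ycoef_decrW (leq0n n)) _.
have := conv_neg 0 1; rewrite big_ord0 addr0 cf0 => h.
rewrite -/Y in h; have := mulr_ge0 (ltW e0) (ycoef_ge0 0); rewrite mulrDl mul1r in h; lra.
Qed.

(** In [Y = 1 - e * conv (cf a) Y], monotonicity bounds the convolution from below by [Y n] times
    the sum of the [cf a j], which is [cf (1 + a) n]; what remains is nonnegativity of [Y]. *)
Lemma ycoef_ub n : e * Y n * cf (1 + a) n <= 1.
Proof.
have h : Y n = 1 - e * conv (cf a) Y n.
  by rewrite /Y conv_ycoef [in LHS]ycoefE cf1 addrC [a + 1]addrC [RHS]addrC.
have : Y n * cf (a + 1) n <= conv (cf a) Y n.
  rewrite -sum_cf mulr_sumr /conv; apply: ler_sum => j _.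
  rewrite mulrC; apply: ler_wpM2l; first by rewrite cf_ge0 ?(ltW a0).
  by apply: ycoef_decrW; exact: leq_subr.
move=> /(ler_wpM2l (ltW e0)); rewrite [1 + a]addrC -mulrA.
have := ycoef_ge0 n; rewrite -/Y; lra.
Qed.

Let K := 2 / (1 - a ^+ 2).

(** By [ycoef_ub] and [cf_mul_ge], the latter being the origin of [K],
    [Y i <= K / e * cf (1 - a) i]. Convolution with [cf (1 - a)] gives the bound on what [eS] treats
    as the error term. *)
Lemma ycoef_tail n : 0 <= ycoef (2 - a) n <= K / e * cf (2 - 2 * a) n.
Proof.
have -> : 2 - a = (1 - a) + 1 :> R by ring.
rewrite -conv_ycoef -/Y /conv; apply/andP; split.
  apply: sumr_ge0 => j _; rewrite mulr_ge0 ?ycoef_ge0// cf_ge0// subr_ge0 ltW//.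
have -> : 2 - 2 * a = (1 - a) + (1 - a) by ring.
rewrite -conv_cf /conv mulr_sumr; apply: ler_sum => j _.
rewrite mulrCA ler_wpM2l ?cf_ge0 ?subr_ge0 ?(ltW a1)//.
set i := (n - j)%N.
have c0 : 0 < cf (1 + a) i by rewrite cf_gt0// addr_gt0.
have a2 : 0 < 1 - a ^+ 2 by rewrite subr_gt0 expr_lt1// ltW.
have h1 := cf_mul_ge i a01; have h2 := ycoef_ub i.
rewrite mulrAC ler_pdivlMr//.
have K0 : 0 <= K by rewrite /K divr_ge0// ltW.
rewrite -(ler_pM2r c0).
have -> : Y i * e * cf (1 + a) i = e * Y i * cf (1 + a) i by ring.
apply: le_trans h2 _; rewrite -mulrA.
have {1}-> : 1 = K * ((1 - a ^+ 2) / 2) by rewrite /K; field; rewrite gt_eqF.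
by rewrite ler_wpM2l.
Qed.

Lemma ycoef_sum n : ycoef 2 n = \sum_(j < n.+1) Y j.
Proof.
rewrite (_ : 2 = 1 + 1 :> R)// -conv_ycoef convC /conv.
by apply: eq_bigr => j _; rewrite cf1 mulr1.
Qed.

(** Since [ycoef 2] is the sequence of partial sums of [Y], this splits them into an explicit main
    term and the remainder controlled by [ycoef_tail]. *)
Lemma eS n : e * ycoef 2 n = cf (2 - a) n - ycoef (2 - a) n.
Proof. by rewrite (ycoefE (2 - a)) subrK; ring. Qed.

Lemma sum_window (f : nat -> R) n m :
  \sum_(j < (n + m).+1) f j = \sum_(j < n.+1) f j + \sum_(j < m) f (n + j.+1)%N.
Proof.
elim: m => [|m IH]; first by rewrite addn0 big_ord0 addr0.
by rewrite addnS big_ord_recr/= IH [X in _ = _ + X]big_ord_recr/= addnS addrA.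
Qed.

(** Tauberian argument on a window of length [m]: by monotonicity [m * Y (n + m)] is at most the
    increment of the partial sums of [Y]. The main term in [eS] grows by at most [m * cf (1 - a) n]
    there, and dividing the remainder by [m] gives the second summand. *)
Lemma ycoef_upper n m : (0 < m)%N ->
  e * Y (n + m)%N <= cf (1 - a) n + K / (e * m%:R) * cf (2 - 2 * a) n.
Proof.
move=> m0; have m0' : 0 < m%:R :> R by rewrite ltr0n.
have S1 : m%:R * Y (n + m)%N <= ycoef 2 (n + m)%N - ycoef 2 n.
  rewrite !ycoef_sum sum_window addrC addKr mulr_natl -[X in _ *+ X]card_ord -sumr_const.
  by apply: ler_sum => j _; apply: ycoef_decrW; have := ltn_ord j; lia.
have C1 : cf (2 - a) (n + m)%N - cf (2 - a) n <= m%:R * cf (1 - a) n.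
  rewrite (_ : 2 - a = 1 - a + 1); last by ring.
  rewrite -!sum_cf sum_window addrC addKr mulr_natl -[X in _ <= _ *+ X]card_ord -sumr_const.
  apply: ler_sum => j _; apply: cf_decrW; last exact: leq_addr.
  by rewrite subr_ge0 (ltW a1) lerBlDr lerDl ltW.
have E1 := eS (n + m)%N; have E2 := eS n.
have /andP[T0 _] := ycoef_tail (n + m)%N; have /andP[_ T1] := ycoef_tail n.
rewrite -(ler_pM2l m0').
have -> : m%:R * (cf (1 - a) n + K / (e * m%:R) * cf (2 - 2 * a) n) =
   m%:R * cf (1 - a) n + K / e * cf (2 - 2 * a) n by field; rewrite !gt_eqF.
have : e * (m%:R * Y (n + m)%N) <= e * (ycoef 2 (n + m)%N - ycoef 2 n) by rewrite ler_pM2l.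
rewrite mulrBr mulrCA; lra.
Qed.

Lemma ycoef_lower n m : (0 < m)%N ->
  cf (1 - a) (n + m)%N - K / (e * m%:R) * cf (2 - 2 * a) (n + m)%N <= e * Y n.
Proof.
move=> m0; have m0' : 0 < m%:R :> R by rewrite ltr0n.
have S1 : ycoef 2 (n + m)%N - ycoef 2 n <= m%:R * Y n.
  rewrite !ycoef_sum sum_window addrC addKr mulr_natl -[X in _ <= _ *+ X]card_ord -sumr_const.
  by apply: ler_sum => j _; apply: ycoef_decrW; have := ltn_ord j; lia.
have C1 : m%:R * cf (1 - a) (n + m)%N <= cf (2 - a) (n + m)%N - cf (2 - a) n.
  rewrite (_ : 2 - a = 1 - a + 1); last by ring.
  rewrite -!sum_cf sum_window [leRHS]addrC addKr mulr_natl -[X in _ *+ X]card_ord -sumr_const.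
  apply: ler_sum => j _; apply: cf_decrW; last by have := ltn_ord j; lia.
  by rewrite subr_ge0 (ltW a1) lerBlDr lerDl ltW.
have E1 := eS (n + m)%N; have E2 := eS n.
have /andP[T0 _] := ycoef_tail n; have /andP[_ T1] := ycoef_tail (n + m)%N.
rewrite -(ler_pM2l m0').
have -> : m%:R * (cf (1 - a) (n + m)%N - K / (e * m%:R) * cf (2 - 2 * a) (n + m)%N) =
   m%:R * cf (1 - a) (n + m)%N - K / e * cf (2 - 2 * a) (n + m)%N by field; rewrite !gt_eqF.
have : e * (ycoef 2 (n + m)%N - ycoef 2 n) <= e * (m%:R * Y n) by rewrite ler_pM2l.
rewrite mulrBr mulrCA; lra.
Qed.

End DiscreteRelaxation.

(** * The Gamma function on arguments at least 1, and Gauss's limit *)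

Section GammaFunction.
Variable R : realType.
Notation mu := (@lebesgue_measure R).
Implicit Types (x y s t : R) (n k : nat).

Let gam x t : R := powR t (x - 1) * expR (- t).

(** The inequality [u <= exp u] at [u = t / (2 y)], raised to the power [y]; hence the constant
    [(2 y)^y]. *)
Lemma powR_le_expR y : 0 <= y -> exists2 C : R, 0 < C &
  forall t, 0 <= t -> powR t y * expR (- t) <= C * expR (- (t / 2)).
Proof.
rewrite le_eqVlt => /predU1P[<-|y0].
  exists 1 => // t t0; rewrite powRr0 !mul1r ler_expR lerN2.
  by rewrite ler_pdivrMr// ler_peMr// ler1n.
exists (powR (2 * y) y); first by apply: powR_gt0; rewrite mulr_gt0.
move=> t t0.
have -> : expR (- (t / 2)) = expR (t / 2) * expR (- t) by rewrite -expRD; congr expR; field.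
rewrite mulrA ler_wpM2r ?expR_ge0//.
have -> : t = (2 * y) * (t / (2 * y)) by field; rewrite gt_eqF.
have h : 0 <= t / (2 * y) by rewrite divr_ge0// mulr_ge0 ?ltW.
rewrite powRM//; last by rewrite mulr_ge0// ltW.
have -> : expR (2 * y * (t / (2 * y)) / 2) = powR (expR (t / (2 * y))) y.
  by rewrite -expRM; congr expR; field; rewrite gt_eqF.
rewrite ler_wpM2l ?powR_ge0// ge0_ler_powR ?nnegrE ?(ltW y0) ?expR_ge0//.
by apply: le_trans (expR_ge1Dx _); rewrite lerDr.
Qed.

Lemma expR_half_cvg : expR (- (t / 2)) @[t --> +oo] --> (0 : R).
Proof.
apply: (@cvg_comp _ _ _ (fun t : R => t / 2) (fun t => expR (- t)) _ +oo); last exact: cvgr_expR.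
apply/cvgryPge => A; near=> t.
by rewrite ler_pdivlMr//; near: t; exact: nbhs_pinfty_ge.
Unshelve. all: by end_near. Qed.

Lemma is_derive_mull (k t : R) : is_derive t 1 (fun u : R => k * u) k.
Proof.
have := @is_deriveZ _ _ _ (@id R) k t 1 1 (is_derive_id t 1).
by rewrite /GRing.scale/= mulr1.
Qed.

Lemma is_derive_expRM (k t : R) :
  is_derive t 1 (fun u : R => expR (k * u)) (k * expR (k * t)).
Proof.
rewrite mulrC; apply: (@is_derive1_comp _ expR (fun u : R => k * u)).
exact: is_derive_mull.
Qed.

Lemma is_derive_expRN (t : R) : is_derive t 1 (fun u : R => expR (- u)) (- expR (- t)).
Proof.
have := is_derive_expRM (-1) t; rewrite !mulN1r.
by under eq_fun do rewrite mulN1r.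
Qed.

Lemma is_derive_expRN_half (c t : R) :
  is_derive t 1 (fun u : R => - (2 * c) * expR (- (u / 2))) (c * expR (- (t / 2))).
Proof.
have -> : c * expR (- (t / 2)) = - (2 * c) * ((- (1 / 2)) * expR (- (1/2) * t)).
  by rewrite (_ : - (1 / 2) * t = - (t / 2)); field.
rewrite (_ : (fun u : R => _) = (fun u : R => - (2 * c) *: expR (- (1/2) * u))); last first.
  by apply/funext => u; rewrite /GRing.scale/= (_ : - (1 / 2) * u = - (u / 2)); [|field].
by apply: is_deriveZ; exact: is_derive_expRM.
Qed.

Lemma continuous_exp_half (c t : R) : {for t, continuous (fun t : R => c * expR (- (t / 2)))}.
Proof.
apply: cvgMr; apply: (@continuous_comp _ _ _ (fun t : R => - (t / 2)) expR).
  by apply: cvgN; apply: cvgMl; exact: cvg_id.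
exact: continuous_expR.
Qed.

Lemma continuous_expRN (t : R) : {for t, continuous (fun t : R => expR (- t))}.
Proof.
apply: (@continuous_comp _ _ _ (fun t : R => - t) expR); last exact: continuous_expR.
by apply: cvgN; exact: cvg_id.
Qed.

Lemma integrable_exp_half (c : R) : 0 <= c ->
  mu.-integrable `[0, +oo[ (fun t : R => (c * expR (- (t / 2)))%:E) /\
  Rintegral mu `[0, +oo[ (fun t => c * expR (- (t / 2))) = 2 * c.
Proof.
move=> c0.
have D t := is_derive_expRN_half c t.
have cf t := @continuous_exp_half c t.
have h := @ge0_continuous_FTC2y R (fun t => c * expR (- (t / 2)))
  (fun t => - (2 * c) * expR (- (t / 2))) 0 0.
have {}h : (\int[mu]_(t in `[0%R, +oo[) (c * expR (- (t / 2)))%:E = (2 * c)%:E)%E.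
  rewrite h; first by rewrite mul0r oppr0 expR0 mulr1 -EFinB sub0r opprK.
  - by move=> t _; rewrite mulr_ge0// expR_ge0.
  - by apply: continuous_subspaceT => t; exact: cf.
  - by rewrite -[0](mulr0 (- (2 * c))); apply: cvgMr; exact: expR_half_cvg.
  - by move=> t _; have [] := D t.
  - by apply: cvg_at_right_filter; exact: continuous_exp_half.
  - by move=> t _; rewrite derive1E; have [_ ->] := D t.
split; last by rewrite /Rintegral h.
apply/integrableP; split.
  apply/measurable_EFinP; apply: measurable_funTS; apply: continuous_measurable_fun => t; exact: cf.
rewrite [ltLHS](_ : _ = (2 * c)%:E) ?ltry// -h; apply: eq_integral => t _.
by rewrite gee0_abs// lee_fin mulr_ge0// expR_ge0.
Qed.

Lemma measurable_gam x : measurable_fun setT (gam x).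
Proof.
apply: measurable_funM; first exact: measurable_powR.
apply: measurableT_comp; first exact: measurable_expR.
exact: measurable_funN.
Qed.

Lemma gam_integrable x : 1 <= x -> mu.-integrable `[0, +oo[ (EFin \o gam x).
Proof.
move=> x1; have [|C C0 hC] := @powR_le_expR (x - 1); first by rewrite subr_ge0.
have [hi _] := integrable_exp_half (ltW C0).
apply: le_integrable hi => //.
  by apply/measurable_EFinP; apply: measurable_funTS; exact: measurable_gam.
move=> t /=; rewrite in_itv/= andbT => t0.
rewrite lee_fin !ger0_norm ?mulr_ge0 ?powR_ge0 ?expR_ge0 ?(ltW C0)//.
exact: hC.
Qed.

Lemma GammaE x : 1 <= x -> Gamma x = Rintegral mu `[0, +oo[ (gam x).
Proof.
move=> x1; rewrite /Gamma Rintegral_itv_obnd_cbnd//.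
apply: integrableS (gam_integrable x1) => //.
by move=> t /=; rewrite !in_itv/= !andbT => /ltW.
Qed.

Lemma powR_continuous y t : 0 < t -> {for t, continuous (fun u : R => powR u y)}.
Proof.
move=> t0; apply: differentiable_continuous; apply/derivable1_diffP.
by apply: derivable_powR; rewrite in_itv/= t0.
Qed.

Lemma GammaS x : 1 <= x -> Gamma (x + 1) = x * Gamma x.
Proof.
move=> x1.
have x0 : 0 < x by apply: lt_le_trans x1.
have xx : 0 <= x - 1 by rewrite subr_ge0.
have [C1 C10 hC1] := powR_le_expR xx.
have [C2 C20 hC2] := powR_le_expR (ltW x0).
pose C := x * C1.
have C0 : 0 <= C by rewrite /C mulr_ge0 ?ltW.
have [hi hI] := integrable_exp_half C0.
have x11 : 1 <= x + 1 by rewrite lerDr ltW.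
have i1 := gam_integrable x1.
have i2 := gam_integrable x11.
rewrite !GammaE//.
(* The fundamental theorem on a half-line is applied to a nonnegative integrand. The derivative of
   [- t^x exp (- t)] changes sign, so a multiple of [exp (- t / 2)] dominating its negative part is
   added; its integral [2 * C] is known. *)
pose g t := gam (x + 1) t - x * gam x t + C * expR (- (t / 2)).
pose F (t : R) := - (powR t x * expR (- t)) + - (2 * C) * expR (- (t / 2)).
have i1' : mu.-integrable `[0, +oo[ (EFin \o (fun t => x * gam x t)).
  rewrite (_ : EFin \o _ = (fun t => (x%:E * (EFin \o gam x) t)%E)); last first.
    by apply/funext => t /=; rewrite EFinM.
  exact: integrableZl.
have ig : Rintegral mu `[0, +oo[ g = Rintegral mu `[0, +oo[ (gam (x+1)) - x * Rintegral mu `[0, +oo[ (gam x) + 2 * C.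
  rewrite /g RintegralD//; last first.
    rewrite (_ : EFin \o _ = ((EFin \o gam (x + 1)%R) \- (EFin \o (fun t => (x * gam x t)%R)))%E).
      exact: integrableB.
    by apply/funext => t /=; rewrite EFinB.
  by rewrite hI RintegralB// RintegralZl.
suff : Rintegral mu `[0, +oo[ g = 2 * C by rewrite ig; lra.
have dF t : 0 < t -> is_derive t 1 F (g t).
  move=> t0; have h2 := is_derive_expRN_half C t.
  have h1 : is_derive t 1 (fun t : R => - (powR t x * expR (- t))) (gam (x + 1) t - x * gam x t).
    have -> : gam (x + 1) t - x * gam x t = - (powR t x *: (- expR (- t)) + expR (- t) *: (x * powR t (x - 1))).
      by rewrite /gam addrK /GRing.scale/=; ring.
    have p1 := is_derive1_powR x t0.
    have p2 := is_derive_expRN t.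
    exact: is_deriveN (is_deriveM p1 p2).
  exact: is_deriveD h1 h2.
have cpow0 y : 0 <= y -> powR t y @[t --> 0^'+] --> powR (0 : R) y.
  rewrite le_eqVlt => /predU1P[<-|y0].
    by under eq_cvg do rewrite powRr0; rewrite powRr0; exact: cvg_cst.
  by rewrite powR0 ?gt_eqF//; exact: powR_cvg0.
have cgam y (t : R) : 0 < t -> {for t, continuous (gam y)}.
  by move=> t0; apply: cvgM; [exact: powR_continuous|exact: continuous_expRN].
have cgam0 y : 1 <= y -> gam y t @[t --> 0^'+] --> gam y (0 : R).
  move=> y1; apply: cvgM; first by apply: cpow0; rewrite subr_ge0.
  by apply: cvg_at_right_filter; exact: continuous_expRN.
rewrite (@Rintegral_ge0_continuous_FTC2y _ g F 0 0).
- by rewrite /F powR0 ?gt_eqF// mul0r mul0r oppr0 expR0; ring.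
- move=> t t0; rewrite /g.
  have h1 := hC1 t t0; have h2 : 0 <= gam (x + 1) t by rewrite mulr_ge0 ?powR_ge0 ?expR_ge0.
  have : x * gam x t <= C * expR (- (t / 2)) by rewrite /C -mulrA ler_pM2l.
  lra.
- apply/continuous_within_itvcyP; split.
    move=> t; rewrite in_itv/= andbT => t0; apply: cvgD; last exact: continuous_exp_half.
    by apply: cvgB; [exact: cgam|apply: cvgMr; exact: cgam].
  apply: cvgD; last by apply: cvg_at_right_filter; exact: continuous_exp_half.
  by apply: cvgB; [exact: cgam0|apply: cvgMr; exact: cgam0].
- rewrite -[0]addr0; apply: cvgD; last first.
    by rewrite -[0](mulr0 (- (2 * C))); apply: cvgMr; exact: expR_half_cvg.
  rewrite -[0]oppr0; apply: cvgN.
  apply: (@squeeze_cvgr _ _ _ _ (fun=> 0) (fun t => C2 * expR (- (t / 2)))).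
  + near=> t; have t0 : 0 <= t by near: t; exact: nbhs_pinfty_ge.
    by rewrite mulr_ge0 ?powR_ge0 ?expR_ge0// hC2.
  + exact: cvg_cst.
  + by rewrite -[0](mulr0 C2); apply: cvgMr; exact: expR_half_cvg.
- by move=> t t0; have [] := dF t t0.
- apply: cvgD; last by apply: cvg_at_right_filter; exact: continuous_exp_half.
  apply: cvgN; apply: cvgM; first by apply: cpow0; exact: ltW.
  by apply: cvg_at_right_filter; exact: continuous_expRN.
- by move=> t; rewrite in_itv/= andbT => t0; rewrite derive1E; have [_ ->] := dF t t0.
Unshelve. all: by end_near. Qed.

Lemma Gamma1 : Gamma (1 : R) = 1.
Proof.
rewrite GammaE//.
have -> : gam 1 = (fun t => expR (- t)) by apply/funext => t; rewrite /gam subrr powRr0 mul1r.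
have D (t : R) : is_derive t 1 (fun u : R => - expR (- u)) (expR (- t)).
  rewrite -[X in is_derive _ _ _ X]opprK; apply: is_deriveN.
  exact: is_derive_expRN.
rewrite (@Rintegral_ge0_continuous_FTC2y _ _ (fun u => - expR (- u)) 0 0).
- by rewrite oppr0 expR0 sub0r opprK.
- by move=> t _; exact: expR_ge0.
- apply: continuous_subspaceT => t.
  exact: continuous_expRN.
- by rewrite -[0]oppr0; apply: cvgN; exact: cvgr_expR.
- by move=> t _; have [] := D t.
- by apply: cvg_at_right_filter; apply: cvgN; exact: continuous_expRN.
- by move=> t _; rewrite derive1E; have [_ ->] := D t.
Qed.

(** Tangent line at [1 / N] of the convex function [w -> w^(-s)], with [w = 1 / t]. Multiplied by a
    Gamma integrand, both sides become combinations of Gamma integrands with shifted arguments. *)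
Lemma powR_tangent s t N : 0 <= s -> 0 < t -> 0 < N ->
  powR N s * (1 + s * (1 - N / t)) <= powR t s.
Proof.
move=> s0 t0 N0.
have h : ln N - ln t <= N / t - 1.
  rewrite -ln_div ?posrE//; have := @le_ln1Dx R (N / t - 1).
  rewrite (_ : 1 + (N / t - 1) = N / t); last by ring.
  by apply; rewrite ltrBrDr addNr divr_gt0.
rewrite /powR !gt_eqF//.
have -> : expR (s * ln t) = expR (s * ln N) * expR (s * (ln t - ln N)).
  by rewrite -expRD; congr expR; ring.
rewrite ler_wpM2l ?expR_ge0//; apply: le_trans (expR_ge1Dx _).
by rewrite lerD2l ler_wpM2l//; lra.
Qed.

Let gam_ge0 x t : 0 <= gam x t.
Proof. by rewrite mulr_ge0 ?powR_ge0 ?expR_ge0. Qed.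

Let gam0 x : 1 < x -> gam x 0 = 0.
Proof. by move=> x1; rewrite /gam powR0 ?mul0r// gt_eqF// subr_gt0. Qed.

Let gamD x s t : 0 < t -> gam (x + s) t = powR t s * gam x t.
Proof.
move=> t0; rewrite /gam mulrA -powRD; first by congr (powR _ _ * _); ring.
by rewrite (gt_eqF t0) implybT.
Qed.

Lemma Gamma_combination_le x y z (b c k : R) : 1 <= x -> 1 <= y -> 1 <= z ->
  (forall t, 0 <= t -> b * gam x t - c * gam y t <= k * gam z t) ->
  b * Gamma x - c * Gamma y <= k * Gamma z.
Proof.
move=> x1 y1 z1 h.
have iM w d : 1 <= w -> mu.-integrable `[0, +oo[ (EFin \o (fun t => d * gam w t)).
  move=> w1; rewrite (_ : EFin \o _ = (fun t => (d%:E * (EFin \o gam w) t)%E)); last first.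
    by apply/funext => t /=; rewrite EFinM.
  by apply: integrableZl => //; exact: gam_integrable.
rewrite !GammaE// -!RintegralZl//; try exact: gam_integrable.
rewrite -RintegralB//; try exact: iM.
apply: le_Rintegral => //; last by move=> t /=; rewrite in_itv/= andbT; exact: h.
  rewrite (_ : EFin \o _ = ((EFin \o (fun t => (b * gam x t)%R)) \- (EFin \o (fun t => (c * gam y t)%R)))%E).
    by apply: integrableB => //; exact: iM.
  by apply/funext => t /=; rewrite EFinB.
exact: iM.
Qed.

(** The tangent inequality at [N = n], integrated against [gam (n + 1)]. This choice of [N] makes
    the terms in [s] cancel through [Gamma (n + 1) = n * Gamma n]. *)
Lemma Gamma_ge_powR n s : (0 < n)%N -> 0 <= s ->
  powR n%:R s * Gamma (n%:R + 1) <= Gamma (n%:R + s + 1).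
Proof.
move=> n0 s0; have n1 : 1 <= n%:R :> R by rewrite ler1n.
have n0' : 0 < n%:R :> R by rewrite ltr0n.
have := @Gamma_combination_le (n%:R + 1) n%:R (n%:R + s + 1)
  (powR n%:R s * (1 + s)) (powR n%:R s * s * n%:R) 1.
rewrite mul1r GammaS// => h; apply: le_trans (h _ _ _ _).
- by rewrite le_eqVlt; apply/orP; left; apply/eqP; ring.
- by rewrite lerDr ltW.
- by [].
- by rewrite lerDr addr_ge0// ltW.
- move=> t; rewrite mul1r le_eqVlt => /predU1P[<-|t0].
    rewrite (gam0 (x := n%:R + 1)); last by rewrite ltrDr.
    rewrite mulr0 sub0r; apply: le_trans (gam_ge0 _ _).
    by rewrite oppr_le0 mulr_ge0// mulr_ge0// mulr_ge0// powR_ge0.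
  have -> : gam n%:R t = t^-1 * gam (n%:R + 1) t.
    by rewrite -powR_inv1 ?(ltW t0)// -gamD// addrK.
  have -> : n%:R + s + 1 = n%:R + 1 + s by ring.
  rewrite (gamD (n%:R + 1) s t0).
  have := ler_wpM2r (gam_ge0 (n%:R + 1) t) (powR_tangent s0 t0 n0').
  by apply: le_trans; rewrite le_eqVlt; apply/orP; left; apply/eqP; ring.
Qed.

(** The tangent inequality with the two points exchanged and [N = n + s + 1], so that
    [Gamma (N + 1) = N * Gamma N] cancels the terms in [s]. *)
Lemma Gamma_le_powR n s : (0 < n)%N -> 0 <= s ->
  Gamma (n%:R + s + 1) <= powR (n%:R + s + 1) s * Gamma (n%:R + 1).
Proof.
move=> n0 s0; have n1 : 1 <= n%:R :> R by rewrite ler1n.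
have n0' : 0 < n%:R :> R by rewrite ltr0n.
set N := n%:R + s + 1.
have N0 : 0 < N by rewrite /N; lra.
have := @Gamma_combination_le N (N + 1) (n%:R + 1) (1 + s) (s / N) (powR N s).
have N1 : 1 <= N by rewrite /N; lra.
rewrite (GammaS N1) => h; apply: le_trans (h _ _ _ _).
- by rewrite le_eqVlt; apply/orP; left; apply/eqP; field; rewrite gt_eqF.
- by rewrite /N; lra.
- by rewrite /N; lra.
- by rewrite lerDr ltW.
- move=> t; rewrite le_eqVlt => /predU1P[<-|t0].
    rewrite !gam0 ?mulr0 ?subr0//; rewrite /N; lra.
  rewrite (_ : N = n%:R + 1 + s); last by rewrite /N; ring.
  rewrite -[X in _ - _ * gam X _]addrA [s + 1]addrC addrA.
  have -> : gam (n%:R + 1 + 1 + s) t = t * gam (n%:R + 1 + s) t.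
    by rewrite -{2}(powRr1 (ltW t0)) -gamD// addrAC.
  rewrite (gamD (n%:R + 1) s t0).
  have N0' : 0 < n%:R + 1 + s by lra.
  have := ler_wpM2r (gam_ge0 (n%:R + 1) t) (powR_tangent s0 N0' t0).
  by apply: le_trans; rewrite le_eqVlt; apply/orP; left; apply/eqP; field; rewrite gt_eqF.
Qed.

Lemma Gamma_cf n s : 0 <= s ->
  Gamma (n%:R + s + 1) = Gamma (s + 1) * n`!%:R * cf (s + 1) n.
Proof.
move=> s0; elim: n => [|n IH]; first by rewrite add0r cf0 !mulr1.
rewrite -natr1 (_ : n%:R + 1 + s + 1 = (n%:R + s + 1) + 1); last by ring.
rewrite (GammaS (x := n%:R + s + 1)); last by rewrite lerDr addr_ge0.
rewrite IH cfS factS natrM -natr1; field.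
by rewrite natr1 pnatr_eq0.
Qed.

Lemma Gamma_fact n : Gamma (n%:R + 1) = n`!%:R :> R.
Proof.
have := Gamma_cf n (lexx 0); rewrite addr0 => ->.
by rewrite add0r Gamma1 mul1r cf1 mulr1.
Qed.

Lemma Gamma_gt0 s : 0 <= s -> 0 < Gamma (s + 1).
Proof.
move=> s0; have := @Gamma_ge_powR 1 s isT s0.
rewrite powR1 mul1r (Gamma_fact 1) (_ : 1%:R + s + 1 = s + 1 + 1); last by ring.
rewrite GammaS; last by rewrite lerDr.
move=> h'; have : 0 < (s + 1) * Gamma (s + 1) by apply: lt_le_trans h'.
by rewrite pmulr_rgt0// addrC ltr_wpDr.
Qed.

(* Gauss's limit formula *)
Lemma cf_powR_cvg s : 0 <= s ->
  cf (s + 1) n / powR n%:R s @[n --> \oo] --> (Gamma (s + 1))^-1.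
Proof.
move=> s0; have G0 := Gamma_gt0 s0.
apply: (@squeeze_cvgr _ _ _ _ (fun=> (Gamma (s + 1))^-1)
   (fun n => powR (1 + (s + 1) / n%:R) s * (Gamma (s + 1))^-1)).
- near=> n; have n0 : (0 < n)%N by near: n; exact: nbhs_infty_gt.
  have n0' : 0 < n%:R :> R by rewrite ltr0n.
  have p0 : 0 < powR n%:R s by rewrite powR_gt0.
  have f0 : 0 < n`!%:R :> R by rewrite ltr0n fact_gt0.
  have := Gamma_ge_powR n0 s0; have := Gamma_le_powR n0 s0.
  rewrite Gamma_cf// Gamma_fact => h1 h2.
  have {}h1 : Gamma (s + 1) * cf (s + 1) n <= powR (n%:R + s + 1) s.
    by rewrite -(ler_pM2r f0) mulrAC.
  have {}h2 : powR n%:R s <= Gamma (s + 1) * cf (s + 1) n.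
    by rewrite -(ler_pM2r f0) [leRHS]mulrAC.
  apply/andP; split.
    by rewrite ler_pdivlMr// -(ler_pM2l G0) mulrA divff ?gt_eqF// mul1r.
  rewrite ler_pdivrMr// mulrAC ler_pdivlMr// -powRM//; last first.
    by rewrite addr_ge0// divr_ge0// addr_ge0.
  by rewrite mulrDl mul1r divfK ?gt_eqF// addrA mulrC.
- exact: cvg_cst.
- rewrite -[X in _ --> X]mul1r; apply: cvgMl.
  have c1 : powR u s @[u --> (1 : R)] --> (1 : R).
    have e : powR 1 s = 1 :> R by rewrite powR1.
    by rewrite -[X in _ --> X]e; exact: powR_continuous.
  have c2 : 1 + (s + 1) / n%:R @[n --> \oo] --> (1 : R).
    rewrite -[X in _ --> X]addr0; apply: cvgD; first exact: cvg_cst.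
    rewrite -[X in _ --> X](mulr0 (s + 1)); apply: cvgMr.
    apply/gtr0_cvgV0; last exact: cvgr_idn.
    by near=> n; rewrite ltr0n; near: n; exact: nbhs_infty_gt.
  exact: cvg_comp c2 c1.
Unshelve. all: by end_near. Qed.

(** One step is [powR_tangent] at consecutive integers. The monotonicity bounds all terms with large
    [n] by the one at a fixed index, which is the majorant needed in [ycoef_cvg_mittag_leffler]. *)
Lemma cf_powR_decr s n m : 0 <= s -> (0 < n)%N -> (n <= m)%N ->
  cf (s + 1) m / powR m%:R s <= cf (s + 1) n / powR n%:R s.
Proof.
move=> s0 n0 /subnKC <-; elim: (m - n)%N => [|k IH]; rewrite ?addn0// addnS.
apply: le_trans IH; set p := (n + k)%N.
have p0 : (0 < p)%N by rewrite /p; lia.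
have p0' : 0 < p%:R :> R by rewrite ltr0n.
have p1 : 0 < p.+1%:R :> R by rewrite ltr0n.
rewrite ler_pdivrMr ?powR_gt0// mulrAC ler_pdivlMr ?powR_gt0//.
rewrite cfS -mulrA ler_wpM2l ?cf_ge0 ?addr_ge0//.
apply: le_trans (powR_tangent s0 p1 p0').
rewrite mulrC le_eqVlt; apply/orP; left; apply/eqP; congr (_ * _).
by rewrite -natr1; field; rewrite natr1 gt_eqF.
Qed.

End GammaFunction.

(** The bounds carry a relative error [1 / m] in the main term and a remainder of order [m / x].
    Taking [m] comparable to [S = sqrt x] balances them, which is where the rate [x^(-1/2)] comes
    from. *)
Lemma sandwich_bound (R : realType) (A c D S x : R) (m : nat) :
  0 < c -> 0 <= D -> 1 <= S -> x = S * S -> S <= m%:R -> m%:R <= 2 * S -> (0 < m)%N ->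
  A <= m.+1%:R / m%:R * c + D * ((m.+1%:R / m%:R) ^+ 2 * (m%:R / x)) ->
  m%:R / m.+1%:R * c - D * (m.+1%:R / x) <= A ->
  `|A - c| <= (1 + c + 8 * D) / S.
Proof.
move=> c0 D0 S1 xs m1 m2 m0 U L.
have S0 : 0 < S by lra.
have x0 : 0 < x by rewrite xs mulr_gt0.
have m0' : 0 < m%:R :> R by rewrite ltr0n.
have Si : 0 < S^-1 by rewrite invr_gt0.
have mi : m%:R^-1 <= S^-1 by rewrite lef_pV2 ?posrE.
have mi0 : 0 < m%:R^-1 :> R by rewrite invr_gt0.
have Si1 : S^-1 <= 1 by rewrite invf_le1.
have m1' : m.+1%:R / m%:R = 1 + m%:R^-1 :> R by rewrite -natr1; field; rewrite gt_eqF.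
have m2' : 1 - m%:R^-1 <= m%:R / m.+1%:R :> R.
  rewrite ler_pdivlMr// -natr1.
  have -> : (1 - m%:R^-1) * (m%:R + 1) = m%:R - m%:R^-1 :> R by field; rewrite gt_eqF.
  by rewrite gerBl ltW.
have mx : m%:R / x <= 2 * S^-1.
  by rewrite ler_pdivrMr// xs mulrA [2 / S * S]divfK// gt_eqF.
have m1x : m.+1%:R / x <= 3 * S^-1.
  rewrite ler_pdivrMr// xs mulrA [3 / S * S]divfK ?gt_eqF// -natr1; lra.
have mx0 : 0 <= m%:R / x by rewrite divr_ge0// ltW.
have U1 : D * ((m.+1%:R / m%:R) ^+ 2 * (m%:R / x)) <= D * (8 * S^-1).
  rewrite ler_wpM2l// m1'; apply: le_trans (_ : 4 * (m%:R / x) <= _); last lra.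
  rewrite ler_wpM2r// (_ : 4 = 2 ^+ 2 :> R); last by ring.
  by rewrite lerXn2r ?nnegrE//; lra.
have L1 : D * (m.+1%:R / x) <= D * (3 * S^-1) by rewrite ler_wpM2l.
have U2 : m.+1%:R / m%:R * c <= c + S^-1 * c by rewrite m1' mulrDl mul1r lerD2l ler_wpM2r// ltW.
have L2 : c - S^-1 * c <= m%:R / m.+1%:R * c.
  apply: le_trans (_ : (1 - m%:R^-1) * c <= _); last by rewrite ler_wpM2r// ltW.
  by rewrite mulrBl mul1r lerD2l lerN2 ler_wpM2r// ltW.
have DS : 0 <= D * S^-1 by rewrite mulr_ge0// ltW.
have L3 := le_trans (lerB L2 L1) L; have U3 := le_trans U (lerD U2 U1).
rewrite ler_norml.
have -> : (1 + c + 8 * D) / S = S^-1 + S^-1 * c + 8 * (D * S^-1) by ring.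
rewrite [D * (8 * _)]mulrCA in U3; rewrite [D * (3 * _)]mulrCA in L3.
clear -Si DS U3 L3; move: (D / S) DS U3 L3 => d; move: (S^-1 * c) => e DS U3 L3.
apply/andP; split; lra.
Qed.

(** * From the relaxation sequence to the Mittag-Leffler asymptotics *)

Section MittagLeffler.
Variables (R : realType) (a : R).
Hypothesis (a01 : 0 < a < 1).
Implicit Types (x : R) (n k m r : nat).

Let a0 : 0 < a. Proof. by case/andP: a01. Qed.
Let a1 : a < 1. Proof. by case/andP: a01. Qed.

Let eps x n : R := x / powR n%:R a.

Let powRn_gt0 n (b : R) : (0 < n)%N -> 0 < powR n%:R b.
Proof. by move=> n0; rewrite powR_gt0// ltr0n. Qed.

Lemma eps_small x : 0 < x -> exists2 N : nat, (0 < N)%N &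
  forall n, (N <= n)%N -> eps x n * expR 2 <= 1.
Proof.
move=> x0; pose z := powR (x * expR 2) a^-1.
exists (Num.bound z).+1 => // n Nn.
have n0 : (0 < n)%N by lia.
have zn : z <= n%:R.
  apply: le_trans (_ : (Num.bound z)%:R <= _); last by rewrite ler_nat; lia.
  by apply/ltW/archi_boundP; exact: powR_ge0.
rewrite /eps mulrAC ler_pdivrMr ?powRn_gt0// mul1r.
have := @ge0_ler_powR R a (ltW a0) z n%:R.
rewrite !nnegrE powR_ge0 ler0n => /(_ isT isT zn); apply: le_trans.
rewrite /z -powRrM mulVf ?gt_eqF// powRr1//.
by rewrite mulr_ge0 ?expR_ge0// ltW.
Qed.

Let yterm_eps x n k : (0 < n)%N ->
  yterm a (eps x n) 1 n k = (- x) ^+ k * (cf (k%:R * a + 1) n / powR n%:R (k%:R * a)).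
Proof.
move=> n0; rewrite /yterm /eps [k%:R * a]mulrC powRrM powR_mulrn ?powR_ge0//.
rewrite -mulNr expr_div_n; ring.
Qed.

(** Termwise this is Gauss's limit, since [powR n%:R (k%:R * a)] is exactly the normalisation of
    [cf (k a + 1) n]. The limit is exchanged with the sum by [tannery], with the series at the fixed
    index [N] as majorant. *)
Lemma ycoef_cvg_mittag_leffler x : 0 < x ->
  ycoef a (x / powR n%:R a) 1 n @[n --> \oo] --> mittag_leffler a 1 (- x).
Proof.
move=> x0; have [N N0 hN] := eps_small x0.
have eN0 : 0 < eps x N by rewrite /eps divr_gt0 ?powRn_gt0.
have [C hC] := yterm_dominated a01 eN0 (hN _ (leqnn N)) 1 N.
have -> : mittag_leffler a 1 (- x) =
    limn (series (fun k => (- x) ^+ k / Gamma (k%:R * a + 1))).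
  rewrite /mittag_leffler; congr (lim (_ @ \oo)); apply/funext => M.
  by rewrite /series/= big_mkord.
apply: (@tannery _ (fun n => yterm a (x / powR n%:R a) 1 n) _ C (expR (-1))).
- exact: expRN1_itv.
- near=> n => k.
  have Nn : (N <= n)%N by near: n; exact: nbhs_infty_ge.
  have n0 : (0 < n)%N by lia.
  apply: le_trans (hC k).
  have ka : 0 <= k%:R * a by rewrite mulr_ge0// ltW.
  rewrite (yterm_eps _ _ n0) (yterm_eps _ _ N0) !normrM ler_wpM2l ?normr_ge0//.
  rewrite -!normrM !ger0_norm; last 2 first.
    by rewrite divr_ge0 ?powR_ge0// cf_ge0// addr_ge0.
    by rewrite divr_ge0 ?powR_ge0// cf_ge0// addr_ge0.
  exact: cf_powR_decr.
- move=> k.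
  have ka : 0 <= k%:R * a by rewrite mulr_ge0// ltW.
  have c : (- x) ^+ k * (cf (k%:R * a + 1) n / powR n%:R (k%:R * a)) @[n --> \oo]
      --> (- x) ^+ k / Gamma (k%:R * a + 1).
    by apply: cvgMr; exact: cf_powR_cvg.
  apply: cvg_trans c; apply: near_eq_cvg; near=> n.
  rewrite yterm_eps//; near: n; exact: nbhs_infty_gt.
Unshelve. all: by end_near. Qed.

Lemma mittag_leffler_itv x : 0 < x -> 0 <= mittag_leffler a 1 (- x) <= 1.
Proof.
move=> x0; have c := ycoef_cvg_mittag_leffler x0.
have [N N0 hN] := eps_small x0.
have h n : (N <= n)%N -> 0 <= ycoef a (x / powR n%:R a) 1 n <= 1.
  move=> Nn; have e0 : 0 < eps x n by rewrite /eps divr_gt0// powRn_gt0//; lia.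
  have e1 := hN n Nn.
  by rewrite (ycoef_ge0 a01 e0 e1) (ycoef_le1 a01 e0 e1).
apply/andP; split.
  by apply: (cvgr_to_ge c); exists N => // n /h /andP[].
by apply: (cvgr_to_le c); exists N => // n /h /andP[].
Qed.

(** Gauss's limit with its parameter lowered by one; [s / Gamma (s + 1)] stands for [1 / Gamma s],
    which keeps the argument of [Gamma] above 1. *)
Lemma cf_power_asymptotics (s : R) : 0 < s ->
  cf s n * powR n%:R (1 - s) @[n --> \oo] --> s / Gamma (s + 1).
Proof.
move=> s0.
have c1 : s * (1 + s / n%:R)^-1 * (cf (s + 1) n / powR n%:R s) @[n --> \oo] --> s * (1 + 0)^-1 * (Gamma (s + 1))^-1.
  apply: cvgM; last by apply: cf_powR_cvg; exact: ltW.
  apply: cvgMr; apply: cvgV; first by rewrite addr0 oner_eq0.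
  apply: cvgD; first exact: cvg_cst.
  rewrite -[X in _ --> X](mulr0 s); apply: cvgMr.
  apply/gtr0_cvgV0; last exact: cvgr_idn.
  by near=> n; rewrite ltr0n; near: n; exact: nbhs_infty_gt.
rewrite addr0 invr1 mulr1 in c1.
apply: cvg_trans c1; apply: near_eq_cvg; near=> n.
have n0 : (0 < n)%N by near: n; exact: nbhs_infty_gt.
have n0' : 0 < n%:R :> R by rewrite ltr0n.
have h : cf (s + 1) n = (s + n%:R) / s * cf s n.
  have := cfS s n; rewrite cf_shift => h.
  apply: (mulfI (_ : s / n.+1%:R != 0)); first by rewrite mulf_neq0 ?invr_eq0 ?gt_eqF.
  by rewrite h; field; rewrite gt_eqF//= addrC natr1.
rewrite h powRB; last by rewrite (gt_eqF n0') implybT.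
rewrite powRr1 ?(ltW n0')//.
by field; rewrite !gt_eqF ?powRn_gt0// addr_gt0.
Unshelve. all: by end_near. Qed.

(** The number [1 / Gamma (1 - a)], rewritten by the functional equation. *)
Let c : R := (1 - a) / Gamma (1 - a + 1).

Lemma mittag_leffler_const_gt0 : 0 < c.
Proof. by rewrite divr_gt0 ?subr_gt0// Gamma_gt0// subr_ge0 ltW. Qed.

Let F1 n := cf (1 - a) n * powR n%:R a.
Let F2 n := cf (2 - 2 * a) n * powR n%:R (2 * a - 1).
Let c2 : R := (2 - 2 * a) / Gamma (2 - 2 * a + 1).
Let K := 2 / (1 - a ^+ 2).

Let F1c : F1 n @[n --> \oo] --> c.
Proof.
have s0 : 0 < 1 - a by rewrite subr_gt0.
have := cf_power_asymptotics s0.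
by rewrite (_ : 1 - (1 - a) = a); last by ring.
Qed.

Let F2c : F2 n @[n --> \oo] --> c2.
Proof.
have s0 : 0 < 2 - 2 * a by have := a1; lra.
have := cf_power_asymptotics s0.
by rewrite (_ : 1 - (2 - 2 * a) = 2 * a - 1); last by ring.
Qed.

Let cvg_mul (u : nat -> R) (l : R) r : (0 < r)%N -> u n @[n --> \oo] --> l ->
  u (r * n)%N @[n --> \oo] --> l.
Proof.
move=> r0 ul; apply: (@cvg_comp _ _ _ (fun n => r * n)%N u _ \oo) => //.
apply/cvgnyPge => A; near=> n.
have : (A <= n)%N by near: n; exact: nbhs_infty_ge.
nia.
Unshelve. all: by end_near. Qed.

Let K0 : 0 <= K.
Proof. by rewrite divr_ge0// subr_ge0 expr_le1 ?ltW. Qed.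

Let F2_ge0 n : 0 <= F2 n.
Proof. by rewrite mulr_ge0 ?powR_ge0// cf_ge0//; have := a1; lra. Qed.
Let ratio_powR r n : (0 < r)%N -> (0 < n)%N ->
  powR ((r.+1 * n)%N%:R) a <= (r.+1%:R / r%:R) * powR ((r * n)%N%:R : R) a.
Proof.
move=> r0 n0.
have r0' : 0 < r%:R :> R by rewrite ltr0n.
have -> : (r.+1 * n)%N%:R = (r.+1%:R / r%:R) * (r * n)%N%:R :> R.
  by rewrite !natrM; field; rewrite gt_eqF.
rewrite powRM ?divr_ge0// ler_wpM2r ?powR_ge0//.
rewrite -[leRHS]powRr1 ?divr_ge0// ler_powR ?(ltW a1)//.
by rewrite ler_pdivlMr// mul1r ler_nat.
Qed.

Let sq_powR n : powR (n%:R : R) a * powR n%:R a = n%:R * powR n%:R (2 * a - 1).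
Proof.
have [->|n0] := posnP n; first by rewrite mul0r powR0 ?gt_eqF// mul0r.
have n0' : 0 < n%:R :> R by rewrite ltr0n.
rewrite -{3}(powRr1 (ltW n0')) -!powRD ?(gt_eqF n0') ?implybT//.
by congr powR; ring.
Qed.

(** [ycoef_upper] on the window from [r n] to [(r + 1) n], with [r] fixed and [n] tending to
    infinity. Comparing the powers at the two ends costs factors [(r + 1) / r]. *)
Lemma mittag_leffler_upper x r : 0 < x -> (0 < r)%N ->
  x * mittag_leffler a 1 (- x) <= (r.+1%:R / r%:R) * c + K * (r.+1%:R / r%:R) ^+ 2 * r%:R / x * c2.
Proof.
move=> x0 r0; have [N N0 hN] := eps_small x0.
have c1 : x * ycoef a (x / powR (r.+1 * n)%N%:R a) 1 (r.+1 * n)%N @[n --> \oo] --> x * mittag_leffler a 1 (- x).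
  apply: cvgMr; apply: (@cvg_mul (fun n => ycoef a (x / powR n%:R a) 1 n)) => //.
  exact: ycoef_cvg_mittag_leffler.
have cR : (r.+1%:R / r%:R) * F1 (r * n)%N + K * (r.+1%:R / r%:R) ^+ 2 * r%:R / x * F2 (r * n)%N @[n --> \oo]
  --> (r.+1%:R / r%:R) * c + K * (r.+1%:R / r%:R) ^+ 2 * r%:R / x * c2.
  by apply: cvgD; apply: cvgMr; [exact: (cvg_mul r0 F1c)|exact: (cvg_mul r0 F2c)].
apply: (ler_cvg_to c1 cR); near=> n.
have n0 : (0 < n)%N by near: n; exact: nbhs_infty_gt.
have Nn : (N <= n)%N by near: n; exact: nbhs_infty_ge.
set p := (r.+1 * n)%N; set q := (r * n)%N.
have p0 : (0 < p)%N by rewrite /p; nia.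
have q0 : (0 < q)%N by rewrite /q; nia.
have e0 : 0 < eps x p by rewrite /eps divr_gt0// powRn_gt0.
have e1 : eps x p * expR 2 <= 1 by apply: hN; rewrite /p; nia.
have := ycoef_upper a01 e0 e1 q n0.
rewrite (_ : (q + n)%N = p) -/(eps x p); last by rewrite /p/q; lia.
have Pp := powRn_gt0 a p0; have Pq := powRn_gt0 a q0.
have n0' : 0 < n%:R :> R by rewrite ltr0n.
have r0' : 0 < r%:R :> R by rewrite ltr0n.
rewrite -(ler_pM2l Pp) mulrA {1}/eps (mulrC (powR p%:R a)) divfK ?gt_eqF// => h.
apply: le_trans h _.
have hr := ratio_powR r0 n0; rewrite -/p -/q in hr.
have cf0 := @cf_ge0 R (1 - a) q; have cf2 := @cf_ge0 R (2 - 2 * a) q.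
have {}cf0 : 0 <= cf (1 - a) q by apply: cf0; rewrite subr_ge0 ltW.
have {}cf2 : 0 <= cf (2 - 2 * a) q by apply: cf2; have := a1; lra.
rewrite mulrDr lerD//.
  by rewrite /F1 (mulrC (cf _ _)) mulrA ler_wpM2r.
have -> : powR p%:R a * (2 / (1 - a ^+ 2) / (eps x p * n%:R) * cf (2 - 2 * a) q) =
   (K / (x * n%:R) * cf (2 - 2 * a) q) * (powR p%:R a * powR p%:R a).
  have h1 : 1 - a ^+ 2 != 0.
    by rewrite gt_eqF// subr_gt0 expr_lt1// ltW.
  by rewrite /eps /K; field; rewrite h1 !gt_eqF.
have -> : K * (r.+1%:R / r%:R) ^+ 2 * r%:R / x * F2 q =
   (K / (x * n%:R) * cf (2 - 2 * a) q) * ((r.+1%:R / r%:R * powR q%:R a) * (r.+1%:R / r%:R * powR q%:R a)).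
  rewrite [X in _ = _ * X](_ : _ = (r.+1%:R / r%:R) ^+ 2 * (powR q%:R a * powR q%:R a)); last by ring.
  rewrite sq_powR /F2 /q natrM.
  by field; rewrite !gt_eqF.
rewrite ler_wpM2l//.
  by rewrite mulr_ge0// divr_ge0// mulr_ge0// ltW.
by rewrite ler_pM ?powR_ge0.
Unshelve. all: by end_near. Qed.

Lemma mittag_leffler_lower x r : 0 < x -> (0 < r)%N ->
  (r%:R / r.+1%:R) * c - K * r.+1%:R / x * c2 <= x * mittag_leffler a 1 (- x).
Proof.
move=> x0 r0; have [N N0 hN] := eps_small x0.
have c1 : x * ycoef a (x / powR (r * n)%N%:R a) 1 (r * n)%N @[n --> \oo] --> x * mittag_leffler a 1 (- x).
  apply: cvgMr; apply: (@cvg_mul (fun n => ycoef a (x / powR n%:R a) 1 n)) => //.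
  exact: ycoef_cvg_mittag_leffler.
have cR : (r%:R / r.+1%:R) * F1 (r.+1 * n)%N - K * r.+1%:R / x * F2 (r.+1 * n)%N @[n --> \oo]
  --> (r%:R / r.+1%:R) * c - K * r.+1%:R / x * c2.
  by apply: cvgB; apply: cvgMr; [exact: (cvg_mul (ltn0Sn r) F1c)|exact: (cvg_mul (ltn0Sn r) F2c)].
apply: (ler_cvg_to cR c1); near=> n.
have n0 : (0 < n)%N by near: n; exact: nbhs_infty_gt.
have Nn : (N <= n)%N by near: n; exact: nbhs_infty_ge.
set p := (r.+1 * n)%N; set q := (r * n)%N.
have p0 : (0 < p)%N by rewrite /p; nia.
have q0 : (0 < q)%N by rewrite /q; nia.
have e0 : 0 < eps x q by rewrite /eps divr_gt0// powRn_gt0.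
have e1 : eps x q * expR 2 <= 1 by apply: hN; rewrite /q; nia.
have := ycoef_lower a01 e0 e1 q n0.
rewrite (_ : (q + n)%N = p) -/(eps x q); last by rewrite /p/q; lia.
have Pp := powRn_gt0 a p0; have Pq := powRn_gt0 a q0.
have n0' : 0 < n%:R :> R by rewrite ltr0n.
have r0' : 0 < r%:R :> R by rewrite ltr0n.
rewrite -(ler_pM2l Pq) [leRHS]mulrA {2}/eps (mulrC (powR q%:R a) (x / _)) divfK ?gt_eqF// => h.
apply: le_trans h.
have hr := ratio_powR r0 n0; rewrite -/p -/q in hr.
have cf0 : 0 <= cf (1 - a) p by apply: cf_ge0; rewrite subr_ge0 ltW.
have cf2 : 0 <= cf (2 - 2 * a) p by apply: cf_ge0; have := a1; lra.
have qp : powR q%:R a <= powR p%:R a.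
  by apply: ge0_ler_powR; rewrite ?nnegrE ?(ltW a0)// ler_nat leq_mul2r leqnSn orbT.
rewrite mulrBr lerB//.
  rewrite /F1 (mulrC (cf _ _)) mulrA ler_wpM2r//.
  by rewrite -ler_pdivlMl ?divr_gt0// invf_div.
have -> : powR q%:R a * (2 / (1 - a ^+ 2) / (eps x q * n%:R) * cf (2 - 2 * a) p) =
   (K / (x * n%:R) * cf (2 - 2 * a) p) * (powR q%:R a * powR q%:R a).
  have h1 : 1 - a ^+ 2 != 0.
    by rewrite gt_eqF// subr_gt0 expr_lt1// ltW.
  by rewrite /eps /K; field; rewrite h1 !gt_eqF.
have -> : K * r.+1%:R / x * F2 p =
   (K / (x * n%:R) * cf (2 - 2 * a) p) * (powR p%:R a * powR p%:R a).
  rewrite sq_powR /F2 /p natrM.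
  by field; rewrite !gt_eqF.
rewrite ler_wpM2l//.
  by rewrite mulr_ge0// divr_ge0// mulr_ge0// ltW.
by rewrite ler_pM ?powR_ge0.
Unshelve. all: by end_near. Qed.

Lemma mittag_leffler_asymptotics : exists2 C : R, 0 <= C &
  forall x, 0 < x -> `|x * mittag_leffler a 1 (- x) - c| <= C / Num.sqrt x.
Proof.
have c0 := mittag_leffler_const_gt0.
have c20 : 0 <= c2.
  by apply: (cvgr_to_ge F2c); near=> n; exact: F2_ge0.
have Kc : 0 <= K * c2 by rewrite mulr_ge0.
exists (1 + c + 8 * (K * c2)); first by lra.
move=> x x0; have sx : 0 < Num.sqrt x by rewrite sqrtr_gt0.
rewrite ler_pdivlMr//.
have /andP[E0 E1] := mittag_leffler_itv x0.
(* For [x <= 1] the bounds [0 <= E <= 1] suffice, because the claimed bound is then at least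
   [1 + c]. *)
have [x1|x1] := leP x 1.
  have s1 : Num.sqrt x <= 1 by rewrite -sqrtr1 ler_sqrt.
  have : `|x * mittag_leffler a 1 (- x) - c| <= 1 + c.
    have : x * mittag_leffler a 1 (- x) <= 1 by rewrite mulr_ile1// ltW.
    have : 0 <= x * mittag_leffler a 1 (- x) by rewrite mulr_ge0// ltW.
    by rewrite ler_norml => *; apply/andP; split; lra.
  move=> h; apply: le_trans (_ : (1 + c) * 1 <= _); last by lra.
  by rewrite ler_pM// ltW.
have sx1 : 1 <= Num.sqrt x by rewrite -[X in X <= _]sqrtr1 ler_sqrt// ltW.
have [m [m0 m1 m2]] : exists m : nat, [/\ (0 < m)%N, Num.sqrt x <= m%:R & m%:R <= 2 * Num.sqrt x].
  exists (Num.truncn (Num.sqrt x)).+1; split => //.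
    by apply/ltW; exact: truncnS_gt.
  by have := truncn_le (Num.sqrt x); rewrite (ltW sx) -natr1; lra.
have U := mittag_leffler_upper x0 m0.
have L := mittag_leffler_lower x0 m0.
have m0' : 0 < m%:R :> R by rewrite ltr0n.
have xs : x = Num.sqrt x * Num.sqrt x by rewrite -expr2 sqr_sqrtr// ltW.
rewrite -ler_pdivlMr//; apply: (sandwich_bound c0 Kc sx1 xs m1 m2 m0).
  by move: U; congr (_ <= _ + _); ring.
by move: L; congr (_ - _ <= _); ring.
Unshelve. all: by end_near. Qed.

End MittagLeffler.

(** * Square-integrable and absolutely continuous functions on (0, 1) *)

Section Integrals.
Variable R : realType.
Notation mu := (@lebesgue_measure R).
Notation Om := (@Omega R).
Implicit Types (f g v w h : R -> R) (c : R).

Definition intg f := mu.-integrable Om (EFin \o f).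
Definition Int f := Rintegral mu Om f.

Lemma measurable_Omega : measurable Om.
Proof. exact: measurable_itv. Qed.
Local Hint Resolve measurable_Omega : core.

Lemma mu_Omega : mu Om = 1%E.
Proof. by rewrite /Omega lebesgue_measure_itv/= lte_fin ltr01 -EFinB subr0. Qed.

Lemma mu_Omega_lty : (mu Om < +oo)%E.
Proof. by rewrite mu_Omega ltry. Qed.

Lemma intg_measurable f : intg f -> measurable_fun Om f.
Proof. by move=> /integrableP[/measurable_EFinP]. Qed.

Lemma intgD f g : intg f -> intg g -> intg (fun x => f x + g x).
Proof.
move=> hf hg; rewrite /intg (_ : EFin \o _ = ((EFin \o f) \+ (EFin \o g))%E).
  exact: integrableD.
by apply/funext => x /=; rewrite EFinD.
Qed.

Lemma intgZ c f : intg f -> intg (fun x => c * f x).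
Proof.
move=> hf; rewrite /intg (_ : EFin \o _ = (fun x => (c%:E * (EFin \o f) x)%E)).
  exact: integrableZl.
by apply/funext => x /=; rewrite EFinM.
Qed.

Lemma intgB f g : intg f -> intg g -> intg (fun x => f x - g x).
Proof.
move=> hf hg; have := intgD hf (intgZ (-1) hg).
by congr (intg _); apply/funext => x; rewrite mulN1r.
Qed.

Lemma intg_sum (I : Type) (r : seq I) (F : I -> R -> R) :
  (forall i, intg (F i)) -> intg (fun x => \sum_(i <- r) F i x).
Proof.
move=> h; elim: r => [|i r IH].
  rewrite (_ : (fun x => _) = fun=> 0); last by apply/funext => x; rewrite big_nil.
  exact: integrable0.
rewrite (_ : (fun x => _) = fun x => F i x + \sum_(j <- r) F j x); last first.
  by apply/funext => x; rewrite big_cons.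
exact: intgD.
Qed.

Lemma intg_abs f : intg f -> intg (fun x => `|f x|).
Proof. by move=> hf; have := integrable_abse hf. Qed.

Lemma intg_le f g : measurable_fun Om f -> intg g ->
  (forall x, Om x -> `|f x| <= g x) -> intg f.
Proof.
move=> mf ig h; apply: le_integrable ig => //; first exact/measurable_EFinP.
by move=> x Dx /=; rewrite lee_fin; apply: le_trans (h x Dx) (ler_norm _).
Qed.

Lemma intg_cst c : intg (fun=> c).
Proof.
apply: (@measurable_bounded_integrable _ _ _ mu) => //; first exact: mu_Omega_lty.
by exists `|c|; split; rewrite ?num_real// => M cM x _ /=; exact: ltW.
Qed.

Lemma Int_cst c : Int (fun=> c) = c.
Proof. by rewrite -[RHS]mulr1 -[X in _ = _ * X]/(fine 1%E) -mu_Omega; exact: Rintegral_cst. Qed.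

Lemma eq_Int f g : (forall x, Om x -> f x = g x) -> Int f = Int g.
Proof. by move=> h; apply: eq_Rintegral => x; rewrite inE; exact: h. Qed.

Lemma eq_intg f g : (forall x, Om x -> f x = g x) -> intg f -> intg g.
Proof.
by move=> h; apply: eq_integrable => // x; rewrite inE => /h /= ->.
Qed.

Lemma IntD f g : intg f -> intg g -> Int (fun x => f x + g x) = Int f + Int g.
Proof. exact: RintegralD. Qed.

Lemma IntB f g : intg f -> intg g -> Int (fun x => f x - g x) = Int f - Int g.
Proof. exact: RintegralB. Qed.

Lemma IntZ c f : intg f -> Int (fun x => c * f x) = c * Int f.
Proof. exact: RintegralZl. Qed.

Lemma Int_sum (I : Type) (r : seq I) (F : I -> R -> R) :
  (forall i, intg (F i)) -> Int (fun x => \sum_(i <- r) F i x) = \sum_(i <- r) Int (F i).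
Proof.
move=> h; elim: r => [|i r IH].
  by rewrite big_nil -[RHS](Int_cst 0); apply: eq_Int => x _; rewrite big_nil.
rewrite big_cons -IH -IntD//; last exact: intg_sum.
by apply: eq_Int => x _; rewrite big_cons.
Qed.

Lemma Int_ge0 f : (forall x, Om x -> 0 <= f x) -> 0 <= Int f.
Proof. by move=> h; apply: fine_ge0; apply: integral_ge0 => x Dx; rewrite lee_fin h. Qed.

Lemma le_Int f g : intg f -> intg g -> (forall x, Om x -> f x <= g x) -> Int f <= Int g.
Proof. by move=> hf hg h; apply: le_Rintegral. Qed.

Lemma le_abs_Int f : intg f -> `|Int f| <= Int (fun x => `|f x|).
Proof. by move=> hf; apply: le_normr_Rintegral. Qed.

Lemma eq_ae_Int f g : measurable_fun Om f -> measurable_fun Om g -> eq_L2 f g -> Int f = Int g.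
Proof.
move=> mf mg fg; rewrite /Int /Rintegral; congr fine.
apply: ae_eq_integral => //; try exact/measurable_EFinP.
move: fg; apply: filterS; first exact: (ae_filter_ringOfSetsType mu).
by move=> x /= h Dx; rewrite h.
Qed.

Lemma L2_measurable f : L2 f -> measurable_fun Om f. Proof. by case. Qed.

Lemma L2P f : L2 f <-> measurable_fun Om f /\ intg (fun x => f x ^+ 2).
Proof.
split=> [[mf hf]|[mf /integrableP[_ hf]]]; split=> //.
  apply/integrableP; split; first exact/measurable_EFinP/measurable_funX.
  apply: le_lt_trans hf; rewrite le_eqVlt; apply/orP; left; apply/eqP.
  by apply: eq_integral => x _ /=; rewrite ger0_norm// sqr_ge0.
apply: le_lt_trans hf; rewrite le_eqVlt; apply/orP; left; apply/eqP.
by apply: eq_integral => x _ /=; rewrite ger0_norm// sqr_ge0.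
Qed.

Lemma L2_intg_mul f g : L2 f -> L2 g -> intg (fun x => f x * g x).
Proof.
move=> /L2P[mf hf] /L2P[mg hg]; apply: (intg_le _ (intgD hf hg)).
  exact: measurable_funM.
move=> x _; rewrite normrM.
rewrite -[f x ^+ 2]real_normK ?num_real// -[g x ^+ 2]real_normK ?num_real//.
have := sqr_ge0 (`|f x| - `|g x|); have := mulr_ge0 (normr_ge0 (f x)) (normr_ge0 (g x)).
rewrite sqrrB; lra.
Qed.

Lemma bounded_L2 f c : measurable_fun Om f -> (forall x, Om x -> `|f x| <= c) -> L2 f.
Proof.
move=> mf h; apply/L2P; split => //; apply: (intg_le _ (intg_cst (c ^+ 2))).
  exact: measurable_funX.
move=> x /h hx; rewrite normrX lerXn2r ?nnegrE//.
exact: le_trans hx.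
Qed.

Lemma L2_cst c : L2 (fun=> c).
Proof. exact: (@bounded_L2 _ `|c|). Qed.

Lemma L2_intg f : L2 f -> intg f.
Proof.
move=> hf; have := L2_intg_mul hf (L2_cst 1).
by apply: eq_intg => x _; rewrite mulr1.
Qed.

Lemma L2D f g : L2 f -> L2 g -> L2 (fun x => f x + g x).
Proof.
move=> hf hg; apply/L2P; split; first by apply: measurable_funD; exact: L2_measurable.
have /L2P[_ f2] := hf; have /L2P[_ g2] := hg.
apply: eq_intg (intgD (intgD f2 g2) (intgZ 2 (L2_intg_mul hf hg))) => x _.
ring.
Qed.

Lemma L2_bounded_mul f g c : L2 f -> measurable_fun Om g ->
  (forall x, Om x -> `|g x| <= c) -> L2 (fun x => g x * f x).
Proof.
move=> /L2P[mf f2] mg h; apply/L2P; split; first exact: measurable_funM.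
apply: (intg_le _ (intgZ (c ^+ 2) f2)).
  by apply: measurable_funX; exact: measurable_funM.
move=> x /h hx; rewrite exprMn normrM ler_pM//.
  by rewrite normrX lerXn2r ?nnegrE//; exact: le_trans hx.
by rewrite ger0_norm// sqr_ge0.
Qed.

Lemma L2Z c f : L2 f -> L2 (fun x => c * f x).
Proof. by move=> hf; apply: (@L2_bounded_mul _ (fun=> c) `|c|). Qed.

Lemma L2B f g : L2 f -> L2 g -> L2 (fun x => f x - g x).
Proof.
move=> hf hg; have := L2D hf (L2Z (-1) hg).
by congr L2; apply/funext => x; rewrite mulN1r.
Qed.

Lemma L2_sum (I : Type) (r : seq I) (F : I -> R -> R) :
  (forall i, L2 (F i)) -> L2 (fun x => \sum_(i <- r) F i x).
Proof.
move=> h; elim: r => [|i r IH].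
  rewrite (_ : (fun x => _) = fun=> 0); last by apply/funext => x; rewrite big_nil.
  exact: L2_cst.
rewrite (_ : (fun x => _) = fun x => F i x + \sum_(j <- r) F j x); last first.
  by apply/funext => x; rewrite big_cons.
exact: L2D.
Qed.

Lemma innerC v w : inner v w = inner w v.
Proof. by apply: eq_Int => x _; rewrite mulrC. Qed.

Lemma innerDl f g h : L2 f -> L2 g -> L2 h ->
  inner (fun x => f x + g x) h = inner f h + inner g h.
Proof.
move=> *; rewrite /inner -[RHS]IntD; try exact: L2_intg_mul.
by apply: eq_Int => x _; rewrite mulrDl.
Qed.

Lemma innerBl f g h : L2 f -> L2 g -> L2 h ->
  inner (fun x => f x - g x) h = inner f h - inner g h.
Proof.
move=> *; rewrite /inner -[RHS]IntB; try exact: L2_intg_mul.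
by apply: eq_Int => x _; rewrite mulrBl.
Qed.

Lemma innerZl c f h : L2 f -> L2 h -> inner (fun x => c * f x) h = c * inner f h.
Proof.
move=> *; rewrite /inner -[RHS]IntZ; last exact: L2_intg_mul.
by apply: eq_Int => x _; rewrite mulrA.
Qed.

Lemma inner_suml (I : Type) (r : seq I) (F : I -> R -> R) h :
  (forall i, L2 (F i)) -> L2 h ->
  inner (fun x => \sum_(i <- r) F i x) h = \sum_(i <- r) inner (F i) h.
Proof.
move=> hF hh; rewrite -[RHS]Int_sum; last by move=> i; exact: L2_intg_mul.
by apply: eq_Int => x _; rewrite mulr_suml.
Qed.

Lemma inner_ge0 f : 0 <= inner f f.
Proof. by apply: Int_ge0 => x _; rewrite -expr2 sqr_ge0. Qed.

Lemma cauchy_schwarz f g : L2 f -> L2 g -> inner f g ^+ 2 <= inner f f * inner g g.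
Proof.
move=> hf hg.
have key t : 0 <= inner f f - 2 * t * inner f g + t ^+ 2 * inner g g.
  have h := inner_ge0 (fun x => f x - t * g x).
  have tg := L2Z t hg; have d := L2B hf tg.
  have e1 : inner f (fun x => t * g x) = t * inner f g by rewrite innerC innerZl// innerC.
  have e2 : inner (fun x => t * g x) (fun x => t * g x) = t ^+ 2 * inner g g.
    by rewrite innerZl// innerC innerZl// mulrA -expr2.
  have e3 : inner (fun x => t * g x) f = t * inner f g by rewrite innerC.
  rewrite innerBl// innerC innerBl// (innerC _ (fun x => f x - _)) innerBl// e1 e2 e3 in h.
  by move: h; congr (_ <= _); ring.
have := inner_ge0 g; rewrite le_eqVlt => /predU1P[g0|g0].
  (* When [inner g g = 0] the quadratic is affine in [t], and this [t] gives it the value [-1]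
     unless [inner f g = 0]. *)
  have h1 := key ((inner f f + 1) / (2 * inner f g)).
  rewrite -g0 !mulr0 addr0 in h1 *.
  have [->|n0] := eqVneq (inner f g) 0; first by rewrite expr0n.
  have : 2 * ((inner f f + 1) / (2 * inner f g)) * inner f g = inner f f + 1 by field.
  lra.
have h1 := key (inner f g / inner g g).
rewrite -ler_pdivrMr//.
have e : 2 * (inner f g / inner g g) * inner f g = 2 * (inner f g ^+ 2 / inner g g) by field; rewrite gt_eqF.
have e' : (inner f g / inner g g) ^+ 2 * inner g g = inner f g ^+ 2 / inner g g by field; rewrite gt_eqF.
rewrite e e' in h1; lra.
Qed.

Lemma inner_ae v w h : L2 v -> L2 w -> L2 h -> eq_L2 v w -> inner v h = inner w h.
Proof.
move=> hv hw hh vw; apply: eq_ae_Int.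
- by apply: measurable_funM; exact: L2_measurable.
- by apply: measurable_funM; exact: L2_measurable.
- move: vw; apply: filterS; first exact: (ae_filter_ringOfSetsType mu).
  by move=> x /= e Dx; rewrite e.
Qed.

Lemma L2_psum (F : nat -> R -> R) N : (forall n, L2 (F n)) -> L2 (psum F N).
Proof.
move=> h; rewrite (_ : psum F N = fun x => \sum_(i <- index_enum 'I_N) F i x)//.
exact: L2_sum.
Qed.

Lemma inner_psum (F : nat -> R -> R) N h : (forall n, L2 (F n)) -> L2 h ->
  inner (psum F N) h = \sum_(n < N) inner (F n) h.
Proof.
move=> hF hh; rewrite -(@inner_suml _ (index_enum 'I_N) (fun i : 'I_N => F i))//.
Qed.

(** By Cauchy-Schwarz. The norm convergence of the spectral series enters the proof through these
    limits of inner products. *)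
Lemma L2_series_inner (F : nat -> R -> R) g h : (forall n, L2 (F n)) -> L2 h ->
  L2_series F g -> \sum_(n < N) inner (F n) h @[N --> \oo] --> inner g h.
Proof.
move=> hF hh [hg hc].
have d N := L2B (L2_psum N hF) hg.
have c2 : inner (fun x => psum F N x - g x) (fun x => psum F N x - g x) @[N --> \oo] --> 0.
  have c := fine_cvg hc; exact: c.
have c3 : inner (fun x => psum F N x - g x) (fun x => psum F N x - g x) * inner h h @[N --> \oo] --> 0.
  by rewrite -[X in _ --> X](mul0r (inner h h)); exact: cvgMl.
apply/cvgrPdist_le => e e0.
have e2 : 0 < e ^+ 2 by rewrite exprn_gt0.
move/cvgrPdist_le : c3 => /(_ _ e2) c3.
near=> N.
have hN : `|0 - inner (fun x => psum F N x - g x) (fun x => psum F N x - g x) * inner h h| <= e ^+ 2.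
  by near: N.
rewrite -inner_psum// distrC -innerBl//; last exact: L2_psum.
rewrite -(@ler_pXn2r _ 2) ?nnegrE ?(ltW e0)// -normrX ger0_norm ?sqr_ge0//.
apply: le_trans (cauchy_schwarz (d N) hh) _.
apply: le_trans hN; rewrite sub0r normrN; exact: ler_norm.
Unshelve. all: by end_near. Qed.

End Integrals.

(** * Absolutely continuous functions and integration by parts *)

Section AbsolutelyContinuous.
Variable R : realType.
Notation mu := (@lebesgue_measure R).
Notation Om := (@Omega R).
Implicit Types (f g F G : R -> R) (c k x : R).

Local Hint Resolve measurable_Omega : core.

(** Absolute continuity stated as the fundamental theorem of calculus; the derivative is carried
    along as explicit data, determined only almost everywhere. *)
Definition AC F f := mu.-integrable `[0, 1] (EFin \o f) /\
  forall x, 0 <= x <= 1 -> F x = F 0 + Rintegral mu `[0, x] f.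

Lemma subset_Omega : Om `<=` `[0 : R, 1 : R].
Proof. by move=> x; rewrite /Omega /= !in_itv/= => /andP[/ltW -> /ltW ->]. Qed.

Lemma intg_cc f : mu.-integrable `[0, 1] (EFin \o f) <-> intg f.
Proof.
split=> h; first (rewrite /intg; have := @integrableS _ _ R mu `[0, 1] Om (EFin \o f) (measurable_itv _) (measurable_itv _) (@subset_Omega) h; exact).
have mf : measurable_fun `[0 : R, 1 : R] f.
  apply/measurable_fun_itv_bndo_bndcP/measurable_fun_itv_obnd_cbndP.
  exact: intg_measurable h.
apply/integrableP; split; first exact/measurable_EFinP.
have /integrableP[_] := h; apply: le_lt_trans.
rewrite -[leLHS]integral_itv_bndo_bndc; last first.
  apply: measurableT_comp => //; apply/measurable_EFinP.
  by apply: measurable_funS mf => // x /=; rewrite !in_itv/= => /andP[-> /ltW].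
rewrite -[leLHS]integral_itv_obnd_cbnd//.
apply: measurableT_comp => //; apply/measurable_EFinP.
exact: intg_measurable h.
Qed.

Lemma Int_cc f : intg f -> Rintegral mu `[0, 1] f = Int f.
Proof.
move=> h; rewrite /Int -Rintegral_itv_bndo_bndc; last first.
  move/intg_cc : h; apply: integrableS => // x /=.
  by rewrite !in_itv/= => /andP[-> /ltW].
by rewrite -Rintegral_itv_obnd_cbnd.
Qed.

Lemma AC_intg F f : AC F f -> intg f.
Proof. by case=> /intg_cc. Qed.

Lemma AC_prim c f : intg f -> AC (fun x => c + Rintegral mu `[0, x] f) f.
Proof.
move=> /intg_cc h; split => // x x01.
by rewrite set_itv1 Rintegral_set1 addr0.
Qed.

Lemma integrable_cx f x : 0 <= x <= 1 -> intg f -> mu.-integrable `[0, x] (EFin \o f).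
Proof.
move=> /andP[x0 x1] /intg_cc; apply: integrableS => // y /=.
by rewrite !in_itv/= => /andP[-> /le_trans]; apply.
Qed.

Lemma ACD F f G g : AC F f -> AC G g -> AC (fun x => F x + G x) (fun x => f x + g x).
Proof.
move=> hF hG; split; first by apply/intg_cc/intgD; apply: AC_intg; eassumption.
move=> x x01; rewrite RintegralD//; try by apply: integrable_cx => //; apply: AC_intg; eassumption.
by rewrite (hF.2 x x01) (hG.2 x x01) addrACA.
Qed.

Lemma ACZ k F f : AC F f -> AC (fun x => k * F x) (fun x => k * f x).
Proof.
move=> hF; split; first by apply/intg_cc/intgZ; apply: AC_intg; eassumption.
move=> x x01; rewrite RintegralZl//; last by apply: integrable_cx => //; apply: AC_intg; eassumption.
by rewrite (hF.2 x x01) mulrDr.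
Qed.

Lemma AC_cst c : AC (fun=> c) (fun=> 0).
Proof.
split; first by apply/intg_cc; exact: intg_cst.
by move=> x x01; rewrite Rintegral_cst// mul0r addr0.
Qed.

Lemma AC_sum (I : Type) (r : seq I) (F f : I -> R -> R) :
  (forall i, AC (F i) (f i)) ->
  AC (fun x => \sum_(i <- r) F i x) (fun x => \sum_(i <- r) f i x).
Proof.
move=> h; elim: r => [|i r IH].
  rewrite (_ : (fun x => _) = fun=> 0); last by apply/funext => x; rewrite big_nil.
  rewrite (_ : (fun x => \sum_(i <- [::]) f i x) = fun=> 0); last by apply/funext => x; rewrite big_nil.
  exact: AC_cst.
rewrite (_ : (fun x => _) = fun x => F i x + \sum_(j <- r) F j x); last first.
  by apply/funext => x; rewrite big_cons.
rewrite (_ : (fun x => \sum_(i <- (i :: r)) f i x) = fun x => f i x + \sum_(j <- r) f j x); last first.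
  by apply/funext => x; rewrite big_cons.
exact: ACD.
Qed.

Lemma AC_bound F f : AC F f -> forall x, 0 <= x <= 1 -> `|F x - F 0| <= Int (fun y => `|f y|).
Proof.
move=> hF x x01; rewrite (hF.2 x x01) addrC addKr.
have hf := AC_intg hF.
apply: le_trans (le_normr_Rintegral _ (integrable_cx x01 hf)) _ => //.
rewrite -Int_cc; last exact: intg_abs.
rewrite -subr_ge0 (@Rintegral_itvB _ _ (BLeft 0) (BRight 1)); last 3 first.
- by apply/intg_cc; exact: intg_abs.
- by rewrite bnd_simp; case/andP: x01.
- by rewrite bnd_simp; case/andP: x01.
by apply: fine_ge0; apply: integral_ge0 => y _; rewrite lee_fin.
Qed.

Lemma AC_continuous F f : AC F f -> {within `[0, 1], continuous F}.
Proof.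
move=> hF; have hc := @parameterized_integral_continuous R 0 1 f ler01 hF.1.
have : {within `[0, 1], continuous (fun x => F 0 + parameterized_integral mu 0 x f)}.
  by move=> x; apply: cvgD; [exact: cvg_cst|exact: hc].
apply: subspace_eq_continuous => x; rewrite inE/= in_itv/= => x01.
by have := esym (hF.2 x x01).
Qed.

Lemma AC_measurable F f : AC F f -> measurable_fun Om F.
Proof.
move=> /AC_continuous h.
have : measurable_fun `[0 : R, 1 : R] F by apply: subspace_continuous_measurable_fun.
by apply: measurable_funS => //; exact: subset_Omega.
Qed.

Lemma AC_bounded F f : AC F f -> exists M, forall x, 0 <= x <= 1 -> `|F x| <= M.
Proof.
move=> hF; exists (`|F 0| + Int (fun y => `|f y|)) => x x01.
rewrite -[F x](subrK (F 0)) addrC; apply: le_trans (ler_normD _ _) _.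
by rewrite lerD2l; exact: AC_bound.
Qed.

Lemma Omega_itv x : Om x -> 0 <= x <= 1.
Proof. by move=> /subset_Omega /=; rewrite in_itv. Qed.

Lemma AC_L2 F f : AC F f -> L2 F.
Proof.
move=> hF; have [M hM] := AC_bounded hF.
apply: (@bounded_L2 _ _ M); first exact: AC_measurable hF.
by move=> x /Omega_itv; exact: hM.
Qed.

Lemma within_continuous_intg f : {within `[0, 1], continuous f} -> intg f.
Proof.
move=> h; apply/intg_cc; apply: continuous_compact_integrable => //.
exact: segment_compact.
Qed.

Lemma prim_derivable c f : {within `[0, 1], continuous f} ->
  let F x := c + Rintegral mu `[0, x] f in
  derivable_oo_LRcontinuous F 0 1 /\ {in `]0, 1[, F^`()%classic =1 f}.
Proof.
move=> hc F; have hf := within_continuous_intg hc.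
have hF := AC_prim c hf.
have D x : x \in `]0, 1[ -> is_derive x 1 F (f x).
  move=> x01; have := x01; rewrite in_itv/= => /andP[x0 x1].
  have cfx : {for x, continuous f}.
    by have /(continuous_within_itvP _ ltr01)[h _ _] := hc; exact: h.
  have [d e] := @continuous_FTC1_closed R f 0 x 1 x1 (proj2 (intg_cc _) hf) x0 cfx.
  have := @is_deriveD _ _ _ (fun=> c) _ x 1 0 (f x) (is_derive_cst _ _ _) (DeriveDef d _).
  by rewrite add0r; apply; rewrite -derive1E.
split; last by move=> x x01; rewrite derive1E; have [_ ->] := D x x01.
have /(continuous_within_itvP _ ltr01)[_ h0 h1] := AC_continuous hF.
by split => // x x01; have [] := D x x01.
Qed.

Lemma bounded_intg_mul f G M : intg f -> measurable_fun Om G ->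
  (forall x, 0 <= x <= 1 -> `|G x| <= M) -> intg (fun x => f x * G x).
Proof.
move=> hf mG h; apply: (intg_le _ (intgZ M (intg_abs hf))).
  by apply: measurable_funM => //; exact: intg_measurable.
move=> x /Omega_itv x01; rewrite normrM mulrC ler_wpM2r//; exact: h.
Qed.

Lemma AC_intg_mul f G g : intg f -> AC G g -> intg (fun x => f x * G x).
Proof.
move=> hf hG; have [M hM] := AC_bounded hG.
by apply: bounded_intg_mul hf (AC_measurable hG) hM.
Qed.

Lemma integration_by_parts_C1 F f G g :
  {within `[0, 1], continuous f} -> {within `[0, 1], continuous g} ->
  AC F f -> AC G g ->
  Int (fun x => F x * g x) = F 1 * G 1 - F 0 * G 0 - Int (fun x => f x * G x).
Proof.
move=> cf cg hF hG.
pose F' x := F 0 + Rintegral mu `[0, x] f; pose G' x := G 0 + Rintegral mu `[0, x] g.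
have FE x : 0 <= x <= 1 -> F x = F' x by exact: hF.2.
have GE x : 0 <= x <= 1 -> G x = G' x by exact: hG.2.
have [dF eF] := prim_derivable (F 0) cf.
have [dG eG] := prim_derivable (G 0) cg.
have := @Rintegration_by_parts R F' G' f g 0 1 ltr01 cf dF eF cg dG eG.
rewrite !Int_cc; last 2 first.
- apply: eq_intg (AC_intg_mul (within_continuous_intg cf) hG) => x /Omega_itv x01.
  by rewrite GE.
- apply: eq_intg (AC_intg_mul (within_continuous_intg cg) hF) => x /Omega_itv x01.
  by rewrite FE// mulrC.
rewrite -!FE ?lexx ?ler01// -!GE ?lexx ?ler01// => h.
transitivity (Int (fun x => F' x * g x)); first by apply: eq_Int => x /Omega_itv x01; rewrite FE.
rewrite h; congr (_ - _); apply: eq_Int => x /Omega_itv x01; by rewrite GE.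
Qed.

(** Density argument: continuous functions approximate [f] in [L^1], and their primitives then
    converge uniformly to [F]. Only [f] is approximated, as [g] will be a derivative of a sine, a
    cosine or an eigenfunction, hence continuous. *)
Lemma ibp F f G g : {within `[0, 1], continuous g} -> AC F f -> AC G g ->
  Int (fun x => F x * g x) = F 1 * G 1 - F 0 * G 0 - Int (fun x => f x * G x).
Proof.
move=> cg hF hG.
have hf := AC_intg hF; have hg := AC_intg hG.
have /integrableP[mf _] := hf.
have [fn [cn _ fnc]] := @approximation_continuous_integrable R Om f (@measurable_Omega R) (mu_Omega_lty R) hf.
have cfn n : {within `[0, 1], continuous (fn n)} by apply: continuous_subspaceT; exact: cn.
have ifn n := within_continuous_intg (cfn n).
pose d n := Int (fun x => `|f x - fn n x|).
have dc : d n @[n --> \oo] --> 0.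
  by have c := fine_cvg fnc; exact: c.
pose Fn n x := F 0 + Rintegral mu `[0, x] (fn n).
have hFn n : AC (Fn n) (fn n) := AC_prim (F 0) (ifn n).
have Fn0 n : Fn n 0 = F 0 by rewrite /Fn set_itv1 Rintegral_set1 addr0.
have dF n : AC (fun x => F x + (-1) * Fn n x) (fun x => f x + (-1) * fn n x) := ACD hF (ACZ (-1) (hFn n)).
have dE n : Int (fun y => `|f y + -1 * fn n y|) = d n by apply: eq_Int => y _; rewrite mulN1r.
have bF n x : 0 <= x <= 1 -> `|F x - Fn n x| <= d n.
  by move=> x01; have := AC_bound (dF n) x01; rewrite dE Fn0 !mulN1r subrr subr0.
have [M hM] := AC_bounded hG.
pose K := Int (fun x => `|g x|) + M + `|G 1|.
(* The defect of the formula; it does not depend on [n], and is at most [K * d n] because the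
   formula is exact for [Fn n]. *)
pose D := Int (fun x => F x * g x) - (F 1 * G 1 - F 0 * G 0 - Int (fun x => f x * G x)).
have iFg : intg (fun x => F x * g x).
  by apply: eq_intg (AC_intg_mul hg hF) => x _; rewrite mulrC.
have iFng n : intg (fun x => Fn n x * g x).
  by apply: eq_intg (AC_intg_mul hg (hFn n)) => x _; rewrite mulrC.
have ifG := AC_intg_mul hf hG.
have ifnG n := AC_intg_mul (ifn n) hG.
have i01 : (0 : R) <= (1 : R) <= (1 : R) by rewrite ler01 lexx.
have key n : `|D| <= K * d n.
  have e := integration_by_parts_C1 (cfn n) cg (hFn n) hG.
  rewrite Fn0 in e.
  have -> : D = Int (fun x => F x * g x - Fn n x * g x) + Int (fun x => f x * G x - fn n x * G x)
     - (F 1 - Fn n 1) * G 1.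
    by rewrite /D !IntB// e; ring.
  have b1 : `|Int (fun x => F x * g x - Fn n x * g x)| <= Int (fun x => `|g x|) * d n.
    apply: le_trans (le_abs_Int (intgB iFg (iFng n))) _.
    rewrite mulrC -IntZ; last exact: intg_abs.
    apply: le_Int; [exact/intg_abs/intgB|exact/intgZ/intg_abs|].
    by move=> x /Omega_itv x01; rewrite -mulrBl normrM ler_wpM2r// bF.
  have b2 : `|Int (fun x => f x * G x - fn n x * G x)| <= M * d n.
    apply: le_trans (le_abs_Int (intgB ifG (ifnG n))) _.
    rewrite -IntZ; last exact/intg_abs/intgB.
    apply: le_Int; [exact/intg_abs/intgB|exact/intgZ/intg_abs/intgB|].
    by move=> x /Omega_itv x01; rewrite -mulrBl normrM mulrC ler_wpM2r// hM.
  have b3 : `|(F 1 - Fn n 1) * G 1| <= `|G 1| * d n.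
    rewrite normrM [leLHS]mulrC; apply: ler_wpM2l => //; exact: bF.
  apply: le_trans (ler_normB _ _) _.
  rewrite /K [leRHS]mulrDl [X in _ <= X + _]mulrDl; apply: lerD b3.
  exact: le_trans (ler_normD _ _) (lerD b1 b2).
have : `|D| <= K * 0 by apply: (cvgr_to_ge (cvgMr dc)); exact: nearW.
by rewrite mulr0 normr_le0 subr_eq0 => /eqP.
Qed.

Lemma AC_of_derive F f : (forall x : R, is_derive x 1 F (f x)) -> continuous f -> AC F f.
Proof.
move=> dF cf; split.
  by apply/intg_cc; apply: within_continuous_intg; exact: continuous_subspaceT.
move=> x /andP[x0 x1].
have cF : continuous F.
  by move=> y; apply: differentiable_continuous; apply/derivable1_diffP; have [] := dF y.
have := x0; rewrite le_eqVlt => /predU1P[<-|x0'].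
  by rewrite set_itv1 Rintegral_set1 addr0.
rewrite /Rintegral (@continuous_FTC2 R f F 0 x)//=.
- by rewrite subrKC.
- exact: continuous_subspaceT.
- split; first by move=> y _; have [] := dF y.
  + by apply: cvg_at_right_filter; exact: cF.
  + by apply: cvg_at_left_filter; exact: cF.
- by move=> y _; rewrite derive1E; have [_ ->] := dF y.
Qed.

Lemma AC_sin k : AC (fun x => sin (k * x)) (fun x => k * cos (k * x)).
Proof.
apply: AC_of_derive.
  move=> x; rewrite mulrC; apply: (@is_derive1_comp _ sin (fun u => k * u)).
  by have := @is_deriveZ _ _ _ (@id R) k x 1 1 (is_derive_id x 1); rewrite /GRing.scale/= mulr1.
move=> x; apply: cvgMr; apply: (@continuous_comp _ _ _ (fun u => k * u) cos); last exact: continuous_cos.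
by apply: cvgMr; exact: cvg_id.
Qed.

Lemma AC_cos k : AC (fun x => cos (k * x)) (fun x => - (k * sin (k * x))).
Proof.
apply: AC_of_derive.
  move=> x; rewrite -mulrN mulrC; apply: (@is_derive1_comp _ cos (fun u => k * u)).
  by have := @is_deriveZ _ _ _ (@id R) k x 1 1 (is_derive_id x 1); rewrite /GRing.scale/= mulr1.
move=> x; apply: cvgN; apply: cvgMr; apply: (@continuous_comp _ _ _ (fun u => k * u) sin); last exact: continuous_sin.
by apply: cvgMr; exact: cvg_id.
Qed.

(** One-dimensional Sobolev embedding, by Cauchy-Schwarz on an interval of length 1. It serves both
    for the lower bound on the eigenvalues and for uniform convergence of eigenfunction
    expansions. *)
Lemma AC_sqr_bound F f : AC F f -> F 0 = 0 -> L2 f ->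
  forall x, 0 <= x <= 1 -> F x ^+ 2 <= inner f f.
Proof.
move=> hF F0 hf x x01; have := AC_bound hF x01; rewrite F0 subr0 => h.
have af : L2 (fun y => `|f y|).
  have /L2P[mf f2] := hf; apply/L2P; split; first exact: measurableT_comp.
  by apply: eq_intg f2 => y _; rewrite real_normK// num_real.
have cs := cauchy_schwarz af (L2_cst 1).
have e1 : inner (fun y => `|f y|) (fun=> 1) = Int (fun y => `|f y|).
  by apply: eq_Int => y _; rewrite mulr1.
have e2 : inner (fun=> 1) (fun=> 1) = 1 :> R.
  by rewrite -[RHS](Int_cst 1); apply: eq_Int => y _; rewrite mulr1.
have e3 : inner (fun y => `|f y|) (fun y => `|f y|) = inner f f.
  by apply: eq_Int => y _; rewrite -!expr2 real_normK// num_real.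
rewrite e1 e2 e3 mulr1 in cs; apply: le_trans cs.
rewrite -[F x ^+ 2]real_normK ?num_real// lerXn2r ?nnegrE//.
exact: le_trans h.
Qed.

End AbsolutelyContinuous.

(** * Sine coefficients and the spectral resolution *)

Section TrigonometricSystem.
Variable R : realType.
Implicit Types (k m n : nat) (c : R).

Definition freq k : R := k%:R * pi.

Lemma sin_freq k : sin (freq k) = 0.
Proof.
rewrite /freq; elim: k => [|k IH]; first by rewrite mul0r sin0.
by rewrite -natr1 mulrDl mul1r sinD IH sinpi mul0r mulr0 addr0.
Qed.

Lemma freq_gt0 k : (0 < k)%N -> 0 < freq k.
Proof. by move=> k0; rewrite mulr_gt0 ?pi_gt0// ltr0n. Qed.

Lemma freq_ge_nat k : k%:R <= freq k.
Proof. by rewrite ler_peMr// (le_trans _ (pi_ge2 R))// ler1n. Qed.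

Lemma L2_sin c : L2 (fun x => sin (c * x)).
Proof. exact: AC_L2 (AC_sin c). Qed.

Lemma L2_cos c : L2 (fun x => cos (c * x)).
Proof. exact: AC_L2 (AC_cos c). Qed.

Lemma Int_cos c : c != 0 -> sin c = 0 -> Int (fun x => cos (c * x)) = 0.
Proof.
move=> c0 sc; have h := AC_sin c; have := h.2 1; rewrite ler01 lexx => /(_ isT).
rewrite mulr1 mulr0 sin0 sc add0r Int_cc; last exact: AC_intg h.
rewrite IntZ; last by apply: L2_intg; exact: L2_cos.
by move=> /esym/eqP; rewrite mulf_eq0 (negPf c0)/= => /eqP.
Qed.

Lemma sqrt2_sqr : Num.sqrt 2 * Num.sqrt 2 = 2 :> R.
Proof. by rewrite -expr2 sqr_sqrtr. Qed.

Definition cosk k x : R := Num.sqrt 2 * cos (freq k * x).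
(** The [e_k] of the overview, convertible to the function inside [sine_coef]. Since [sink 0]
    vanishes and [cosk 0] is not normalised, both systems are used at indices [k.+1]. *)
Definition sink k x : R := Num.sqrt 2 * sin (freq k * x).

Lemma L2_cosk k : L2 (cosk k). Proof. by apply: L2Z; exact: L2_cos. Qed.
Lemma L2_sink k : L2 (sink k). Proof. by apply: L2Z; exact: L2_sin. Qed.

Lemma cosk_orthonormal k m : inner (cosk k.+1) (cosk m.+1) = (k == m)%:R.
Proof.
have -> : inner (cosk k.+1) (cosk m.+1) =
    Int (fun x => cos ((freq k.+1 - freq m.+1) * x)) + Int (fun x => cos ((freq k.+1 + freq m.+1) * x)).
  rewrite -IntD; try by apply: L2_intg; exact: L2_cos.
  apply: eq_Int => x _; rewrite /cosk mulrBl mulrDl cosB cosD mulrACA sqrt2_sqr; ring.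
rewrite [X in _ + X]Int_cos ?addr0; last first.
- by rewrite sinD !sin_freq mul0r mulr0 addr0.
- by rewrite gt_eqF// addr_gt0// freq_gt0.
have [->|km] := eqVneq k m.
  by rewrite subrr -[RHS](Int_cst 1); apply: eq_Int => x _; rewrite mul0r cos0.
rewrite Int_cos//.
  rewrite /freq -mulrBl; apply: mulf_neq0; last by rewrite gt_eqF// pi_gt0.
  by rewrite subr_eq0 eqr_nat eqSS.
by rewrite sinB !sin_freq mul0r mulr0 subr0.
Qed.

End TrigonometricSystem.

(** * Bessel's inequality *)

Section Bessel.
Variable R : realType.
Implicit Types (v h : R -> R) (e : nat -> R -> R).

Lemma bessel e v N : (forall n, L2 (e n)) -> (forall n m, inner (e n) (e m) = (n == m)%:R) ->
  L2 v -> \sum_(n < N) inner v (e n) ^+ 2 <= inner v v.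
Proof.
move=> he ho hv.
pose p x := \sum_(n < N) inner v (e n) * e n x.
have Lp : L2 p by rewrite /p; apply: (@L2_sum _ _ _ (fun (n : 'I_N) x => inner v (e n) * e n x)) => n; exact: L2Z.
set S := \sum_(n < N) _.
have vp : inner p v = S.
  rewrite /p (@inner_suml _ _ _ (fun (n : 'I_N) x => inner v (e n) * e n x))//; last by move=> n; exact: L2Z.
  by apply: eq_bigr => n _; rewrite innerZl// innerC expr2.
have pe n : (n < N)%N -> inner p (e n) = inner v (e n).
  move=> nN; rewrite /p (@inner_suml _ _ _ (fun (n : 'I_N) x => inner v (e n) * e n x))//; last by move=> i; exact: L2Z.
  rewrite (bigD1 (Ordinal nN))//= innerZl// ho eqxx mulr1 big1 ?addr0// => i ni.
  rewrite innerZl// ho (_ : _ == _ = false) ?mulr0//.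
  by apply/negbTE; apply: contraNneq ni => ni; apply/eqP/val_inj.
have pp : inner p p = S.
  rewrite {1}/p (@inner_suml _ _ _ (fun (n : 'I_N) x => inner v (e n) * e n x))//; last by move=> n; exact: L2Z.
  apply: eq_bigr => n _; rewrite innerZl// (innerC (e n) p) pe// expr2//.
have := inner_ge0 (fun x => v x - p x).
rewrite innerBl//; last exact: L2B.
rewrite !(innerC _ (fun x => v x - p x)) !innerBl// vp pp (innerC v p) vp; lra.
Qed.

End Bessel.

(** * Uniform limits tested against square-integrable functions *)

Section UniformLimits.
Variable R : realType.
Notation Om := (@Omega R).

Lemma uniform_limit (p : nat -> R -> R) (tau : nat -> R) :
  (forall N, L2 (p N)) -> tau n @[n --> \oo] --> 0 ->
  (forall M N x, (M <= N)%N -> Om x -> `|p N x - p M x| <= tau M) ->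
  exists2 P : R -> R, L2 P &
    forall g, L2 g -> inner (p N) g @[N --> \oo] --> inner P g.
Proof.
move=> Lp tau0 h.
have cp x : Om x -> cvgn (fun N => p N x).
  move=> Ox; apply: cauchy_cvg; apply: cauchy_exP => e e0.
  have /cvgrPdist_lt/(_ _ e0)[M _ hM] := tau0.
  exists (p M x); exists M => // N /= MN; rewrite /ball/= distrC.
  apply: le_lt_trans (h M N x MN Ox) _.
  by have := hM M (leqnn M); rewrite /= sub0r normrN; apply: le_lt_trans; exact: ler_norm.
pose P x := limn (fun N => p N x).
have hP M x : Om x -> `|P x - p M x| <= tau M.
  move=> Ox; have c : `|p N x - p M x| @[N --> \oo] --> `|P x - p M x|.
    by apply: cvg_norm; apply: cvgB; [exact: cp|exact: cvg_cst].
  by apply: (cvgr_to_le c); exists M => // N /= MN; exact: h.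
have mP : measurable_fun Om P.
  apply: (@measurable_fun_cvg _ _ _ _ p).
    by move=> m; exact: L2_measurable.
  by move=> x Ox; exact: cp.
have LP : L2 P.
  have d : L2 (fun x => P x - p 0%N x).
    apply: (@bounded_L2 _ _ (tau 0%N)); last by move=> x; exact: hP.
    by apply: measurable_funB => //; exact: L2_measurable.
  by have := L2D d (Lp 0%N); congr L2; apply/funext => x; rewrite subrK.
exists P => // g Lg.
have ig := intg_abs (L2_intg Lg).
have key N : `|inner P g - inner (p N) g| <= tau N * Int (fun x => `|g x|).
  rewrite -innerBl//; apply: le_trans (le_abs_Int (L2_intg_mul (L2B LP (Lp N)) Lg)) _.
  rewrite -IntZ//; apply: le_Int; [|exact: intgZ|].
    by apply: intg_abs; apply: L2_intg_mul => //; exact: L2B.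
  by move=> x Ox; rewrite normrM ler_wpM2r// hP.
have c0 : tau N * Int (fun x => `|g x|) @[N --> \oo] --> 0.
  by rewrite -[X in _ --> X](mul0r (Int (fun x => `|g x|))); exact: cvgMl.
apply/cvgrPdist_le => e e0; have /cvgrPdist_le/(_ _ e0) := c0; apply: filterS => N hN.
apply: le_trans (key N) _; apply: le_trans hN; rewrite sub0r normrN; exact: ler_norm.
Qed.

Lemma bounded_sum_tail (h : nat -> R) B : (forall n, 0 <= h n) ->
  (forall N, \sum_(0 <= n < N) h n <= B) ->
  exists2 t : nat -> R, t n @[n --> \oo] --> 0 &
    forall M N, (M <= N)%N -> \sum_(M <= n < N) h n <= t M.
Proof.
move=> h0 hB; pose T N := \sum_(0 <= n < N) h n.
have nd : nondecreasing_seq T.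
  apply/nondecreasing_seqP => n; rewrite /T big_nat_recr//= lerDl; exact: h0.
have cT : cvgn T.
  apply: nondecreasing_is_cvgn => //; exists B => _ [n _ <-]; exact: hB.
exists (fun M => limn T - T M).
  by rewrite -[X in _ --> X](subrr (limn T)); apply: cvgB => //; exact: cvg_cst.
move=> M N MN.
have -> : \sum_(M <= n < N) h n = T N - T M.
  by rewrite /T (@big_cat_nat _ _ _ M 0 N)//= [RHS]addrC addKr.
by rewrite lerB// nondecreasing_cvgn_le.
Qed.

End UniformLimits.

(** * Trigonometric coefficients of strong solutions *)

Section StrongSolutions.
Variable R : realType.
Implicit Types (c p : R -> R) (k : nat).

Lemma strong_solP c p : strong_sol c p -> exists2 dp, AC p dp & AC dp (fun x => c x * p x).
Proof.
move=> [dp [i1 [i2 h]]]; exists dp; split => // x x01; by have [] := h x x01.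
Qed.

Lemma cts_cos (k : R) : {within `[0, 1], continuous (fun x => k * cos (k * x))}.
Proof.
apply: continuous_subspaceT => x; apply: cvgMr.
apply: (@continuous_comp _ _ _ (fun u => k * u) cos); last exact: continuous_cos.
by apply: cvgMr; exact: cvg_id.
Qed.

Lemma cts_sin (k : R) : {within `[0, 1], continuous (fun x => - (k * sin (k * x)))}.
Proof.
apply: continuous_subspaceT => x; apply: cvgN; apply: cvgMr.
apply: (@continuous_comp _ _ _ (fun u => k * u) sin); last exact: continuous_sin.
by apply: cvgMr; exact: cvg_id.
Qed.

Lemma AC_cos_coef p dp k : AC p dp ->
  freq R k * Int (fun x => p x * cos (freq R k * x)) = - Int (fun x => dp x * sin (freq R k * x)).
Proof.
move=> hp; have := ibp (@cts_cos (freq R k)) hp (AC_sin (freq R k)).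
rewrite mulr1 mulr0 sin0 sin_freq !mulr0 subrr sub0r => <-.
rewrite -IntZ; first by apply: eq_Int => x _; rewrite mulrCA.
by apply: L2_intg_mul; [exact: AC_L2 hp|exact: L2_cos].
Qed.

Lemma AC_sin_coef p dp k : AC p dp ->
  freq R k * Int (fun x => p x * sin (freq R k * x)) =
  Int (fun x => dp x * cos (freq R k * x)) - (p 1 * cos (freq R k) - p 0).
Proof.
move=> hp; have := ibp (@cts_sin (freq R k)) hp (AC_cos (freq R k)).
rewrite mulr1 mulr0 cos0 mulr1 => e.
have -> : freq R k * Int (fun x => p x * sin (freq R k * x)) =
   - Int (fun x => p x * - (freq R k * sin (freq R k * x))).
  have i : intg (fun x => p x * sin (freq R k * x)).
    by apply: L2_intg_mul; [exact: AC_L2 hp|exact: L2_sin].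
  rewrite -IntZ// -mulN1r -IntZ.
    by apply: eq_Int => x _; ring.
  by apply: eq_intg (intgZ (- freq R k) i) => x _; ring.
by rewrite e opprB.
Qed.

(** Two integrations by parts; the sine kills the boundary terms of the second one. The right-hand
    side depends on [p] through its boundary values alone, hence coincides for the two functions
    [phi_q]. *)
Lemma strong_sol_sin_coef c p k : strong_sol c p ->
  freq R k ^+ 2 * Int (fun x => p x * sin (freq R k * x)) +
  Int (fun x => c x * p x * sin (freq R k * x)) =
  freq R k * (p 0 - p 1 * cos (freq R k)).
Proof.
move=> /strong_solP[dp h1 h2].
have e1 := AC_sin_coef k h1; have e2 := AC_cos_coef k h2.
by rewrite expr2 -mulrA e1 mulrBr e2; ring.
Qed.

End StrongSolutions.

(** * Eigenfunction expansions for a single potential *)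

Section Spectral.
Variables (R : realType) (c0 : R) (q : R -> R) (lam : nat -> R) (phi : nat -> R -> R).
Hypotheses (adm : admissible c0 q) (es : eigensystem q lam phi).
Notation Om := (@Omega R).
Implicit Types (v w h : R -> R) (c rho : nat -> R) (n m N k : nat).

Let mq : measurable_fun Om q. Proof. by case: adm. Qed.
Let q0 x : Om x -> 0 <= q x. Proof. by case: adm => _ h /h /andP[]. Qed.
Let qb x : Om x -> `|q x| <= c0.
Proof. by case: adm => _ h /h /andP[a b]; rewrite ger0_norm. Qed.

Let ho n m : inner (phi n) (phi m) = (n == m)%:R. Proof. by case: es => _ []. Qed.

Lemma eigenfunctions_C1 : exists dphi : nat -> R -> R, forall n, AC (phi n) (dphi n) /\
  AC (dphi n) (fun x => (q x - lam n) * phi n x).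
Proof.
have h n : exists dp, AC (phi n) dp /\ AC dp (fun x => (q x - lam n) * phi n x).
  by have [_ [_ /strong_solP[dp]]] := es.1 n; exists dp.
by exists (fun n => projT1 (cid (h n))) => n; have := projT2 (cid (h n)).
Qed.

Let dphi := projT1 (cid eigenfunctions_C1).
Let hphi n : AC (phi n) (dphi n). Proof. by have [] := projT2 (cid eigenfunctions_C1) n. Qed.
Let hdphi n : AC (dphi n) (fun x => (q x - lam n) * phi n x).
Proof. by have [] := projT2 (cid eigenfunctions_C1) n. Qed.

Lemma L2_phi n : L2 (phi n). Proof. exact: AC_L2 (hphi n). Qed.
Let L2_dphi n : L2 (dphi n). Proof. exact: AC_L2 (hdphi n). Qed.

Lemma L2_q_mul v : L2 v -> L2 (fun x => q x * v x).
Proof. by move=> hv; exact: L2_bounded_mul hv mq qb. Qed.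

(** Symmetry of [A_q]: the operator is moved from the eigenfunction to [e_k], which also vanishes at
    both endpoints. *)
Lemma eigen_sine n k : inner (phi n) (sink k) * lam n =
  freq R k ^+ 2 * inner (phi n) (sink k) + inner (phi n) (fun x => q x * sink k x).
Proof.
have [p0 [p1 hs]] := es.1 n.
have := strong_sol_sin_coef k hs; rewrite p0 p1 mul0r subrr mulr0.
have iq : intg (fun x => phi n x * (q x * sin (freq R k * x))).
  by apply: L2_intg_mul; [exact: L2_phi|apply: L2_q_mul; exact: L2_sin].
have i : intg (fun x => phi n x * sin (freq R k * x)).
  by apply: L2_intg_mul; [exact: L2_phi|exact: L2_sin].
have -> : Int (fun x => (q x - lam n) * phi n x * sin (freq R k * x)) =
   Int (fun x => phi n x * (q x * sin (freq R k * x))) - lam n * Int (fun x => phi n x * sin (freq R k * x)).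
  by rewrite -IntZ// -IntB//; [apply: eq_Int => x _; ring|exact: intgZ].
have -> : inner (phi n) (sink k) = Num.sqrt 2 * Int (fun x => phi n x * sin (freq R k * x)).
  by rewrite -IntZ//; apply: eq_Int => x _; rewrite /sink mulrCA.
have -> : inner (phi n) (fun x => q x * sink k x) = Num.sqrt 2 * Int (fun x => phi n x * (q x * sin (freq R k * x))).
  by rewrite -IntZ//; apply: eq_Int => x _; rewrite /sink; ring.
move=> /eqP; rewrite addrA subr_eq0 => /eqP e.
by rewrite -mulrA [_ * lam n]mulrC -e; ring.
Qed.

(** The quadratic form of [A_q] is diagonal in the eigenbasis; the boundary terms vanish by the
    Dirichlet conditions on [phi m]. *)
Lemma eigen_energy n m : inner (dphi n) (dphi m) + inner (phi n) (fun x => q x * phi m x)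
  = lam n * (n == m)%:R.
Proof.
have [p0 [p1 _]] := es.1 m.
have e := ibp (AC_continuous (hdphi m)) (hdphi n) (hphi m).
rewrite p0 p1 !mulr0 subr0 sub0r in e.
rewrite /inner -/(Int _) e -ho.
have i1 : intg (fun x => phi n x * phi m x) by apply: L2_intg_mul; exact: L2_phi.
have i2 : intg (fun x => phi n x * (q x * phi m x)).
  by apply: L2_intg_mul; [exact: L2_phi|apply: L2_q_mul; exact: L2_phi].
have -> : Int (fun x => (q x - lam n) * phi n x * phi m x) =
   Int (fun x => phi n x * (q x * phi m x)) - lam n * Int (fun x => phi n x * phi m x).
  by rewrite -IntZ// -IntB//; [apply: eq_Int => x _; ring|exact: intgZ].
by rewrite -/(Int _) -/(inner (phi n) (phi m)); rewrite opprB subrK.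
Qed.

Let inner_q_ge0 v : 0 <= inner v (fun x => q x * v x).
Proof. by apply: Int_ge0 => x Ox; rewrite mulrCA -expr2 mulr_ge0 ?q0// sqr_ge0. Qed.

(** On a unit interval [AC_sqr_bound] gives a Poincare inequality with constant 1, and [q >= 0] only
    increases the energy. *)
Lemma eigenvalue_ge1 n : 1 <= lam n.
Proof.
have [p0 _] := es.1 n.
have e := eigen_energy n n; rewrite eqxx mulr1 in e.
have h : inner (phi n) (phi n) <= inner (dphi n) (dphi n).
  rewrite -[leRHS]Int_cst; apply: le_Int; first by apply: L2_intg_mul; exact: L2_phi.
    exact: intg_cst.
  move=> x /Omega_itv x01; rewrite -expr2; exact: AC_sqr_bound (hphi n) p0 (L2_dphi n) x x01.
rewrite ho eqxx in h; have {}h : 1 <= inner (dphi n) (dphi n) by []; have := inner_q_ge0 (phi n); lra.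
Qed.

Let lam_gt0 n : 0 < lam n. Proof. exact: lt_le_trans (eigenvalue_ge1 n). Qed.

Let comb c (r : seq nat) x := \sum_(n <- r) c n * phi n x.
Let dcomb c (r : seq nat) x := \sum_(n <- r) c n * dphi n x.

Let AC_comb c r : AC (comb c r) (dcomb c r).
Proof. by apply: AC_sum => n; apply: ACZ; exact: hphi. Qed.

Let comb0 c r : comb c r 0 = 0.
Proof. by rewrite /comb big1_seq// => n _; have [-> _] := es.1 n; rewrite mulr0. Qed.
Let comb1 c r : comb c r 1 = 0.
Proof. by rewrite /comb big1_seq// => n _; have [_ [-> _]] := es.1 n; rewrite mulr0. Qed.

Let L2_dcomb c r : L2 (dcomb c r).
Proof. by apply: L2_sum => n; apply: L2Z. Qed.

(** The right-hand side is the full energy of the combination, and its potential part is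
    nonnegative. A list of indices covers both partial sums and blocks of a tail. *)
Lemma comb_energy c r : uniq r ->
  inner (dcomb c r) (dcomb c r) <= \sum_(n <- r) lam n * c n ^+ 2.
Proof.
move=> ur.
have Lc : L2 (comb c r) := AC_L2 (AC_comb c r).
suff <- : inner (dcomb c r) (dcomb c r) + inner (comb c r) (fun x => q x * comb c r x)
    = \sum_(n <- r) lam n * c n ^+ 2 by rewrite lerDl inner_q_ge0.
rewrite {1}/dcomb inner_suml//; last by move=> n; exact: L2Z.
rewrite {1}/comb inner_suml//; last by exact: L2_q_mul.
  rewrite -big_split/= big_seq [RHS]big_seq; apply: eq_bigr => n nr.
  rewrite !innerZl//; [|exact: L2_phi|exact: L2_q_mul].
  rewrite innerC {1}/dcomb inner_suml//; last by move=> m; exact: L2Z.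
  have -> : inner (phi n) (fun x => q x * comb c r x) = \sum_(m <- r) c m * inner (phi n) (fun x => q x * phi m x).
    rewrite innerC (_ : (fun x => q x * comb c r x) = fun x => \sum_(m <- r) c m * (q x * phi m x)); last first.
      by apply/funext => x; rewrite /comb mulr_sumr; apply: eq_bigr => m _; rewrite mulrCA.
    rewrite inner_suml; [|by move=> m; apply: L2Z; apply: L2_q_mul; exact: L2_phi|exact: L2_phi].
    by apply: eq_bigr => m _; rewrite innerZl ?(innerC (phi n))//; [apply: L2_q_mul; exact: L2_phi|exact: L2_phi].
  rewrite -mulrDr -big_split/= (bigD1_seq n)//= big1_seq ?addr0.
    rewrite innerZl// -mulrDr eigen_energy eqxx mulr1; ring.
  move=> m /andP[mn _]; rewrite innerZl// innerC -mulrDr eigen_energy eq_sym (negPf mn) !mulr0//.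
by move=> n; apply: L2Z; exact: L2_phi.
Qed.

Lemma sum_lam_le c rho v C N : L2 v -> 0 <= C -> (forall n, `|rho n| * Num.sqrt (lam n) <= C) ->
  (forall n, c n = rho n * inner v (phi n)) ->
  \sum_(0 <= n < N) lam n * c n ^+ 2 <= C ^+ 2 * inner v v.
Proof.
move=> hv C0 hr hc.
apply: le_trans (_ : C ^+ 2 * \sum_(n < N) inner v (phi n) ^+ 2 <= _); last first.
  by rewrite ler_wpM2l ?sqr_ge0// bessel// => n; exact: L2_phi.
rewrite big_mkord mulr_sumr.
apply: ler_sum => n _; rewrite hc exprMn mulrA ler_wpM2r ?sqr_ge0//.
have -> : lam n * rho n ^+ 2 = (`|rho n| * Num.sqrt (lam n)) ^+ 2.
  by rewrite exprMn real_normK ?num_real// sqr_sqrtr ?ltW// mulrC.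
by rewrite lerXn2r ?nnegrE// mulr_ge0// sqrtr_ge0.
Qed.

Section Smoothing.
Variables (v : R -> R) (rho : nat -> R) (C : R).
Hypotheses (hv : L2 v) (C0 : 0 <= C) (hrho : forall n, `|rho n| * Num.sqrt (lam n) <= C).

Let cc n := rho n * inner v (phi n).
Let pN N := comb cc (index_iota 0 N).
Let dpN N := dcomb cc (index_iota 0 N).

Let inner_pN N h : L2 h -> inner (pN N) h = \sum_(n < N) rho n * inner v (phi n) * inner (phi n) h.
Proof.
move=> Lh; rewrite /pN /comb inner_suml//; last by move=> n; apply: L2Z; exact: L2_phi.
by rewrite big_mkord; apply: eq_bigr => n _; rewrite innerZl//; exact: L2_phi.
Qed.

Let dpN_le N : inner (dpN N) (dpN N) <= C ^+ 2 * inner v v.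
Proof.
apply: le_trans (comb_energy _ (iota_uniq _ _)) _.
exact: (@sum_lam_le cc rho v C N hv C0 hrho).
Qed.

(** Partial sums vanish at 0 and 1, so [freq] times their sine coefficients are cosine coefficients
    of the derivative; Bessel and [comb_energy] bound these uniformly in [N]. The limit is given by
    its coefficients [a] only, which allows it to be used for a remainder known as a sequence. *)
Lemma smooth_sine (a : nat -> R) K :
  (forall k, \sum_(n < N) rho n * inner v (phi n) * inner (phi n) (sink k) @[N --> \oo] --> a k) ->
  \sum_(k < K) (freq R k.+1 * a k.+1) ^+ 2 <= C ^+ 2 * inner v v.
Proof.
move=> ha.
have c : \sum_(k < K) (freq R k.+1 * \sum_(n < N) rho n * inner v (phi n) * inner (phi n) (sink k.+1)) ^+ 2
   @[N --> \oo] --> \sum_(k < K) (freq R k.+1 * a k.+1) ^+ 2.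
  apply: (@cvg_big _ _ _ _ _ add_continuous) => k _.
  have h : freq R k.+1 * (\sum_(n < N) rho n * inner v (phi n) * inner (phi n) (sink k.+1)) @[N --> \oo] --> freq R k.+1 * a k.+1.
    by apply: cvgMr; exact: ha.
  exact: (cvgM h h).
apply: (cvgr_to_le c); apply: nearW => N.
apply: le_trans (dpN_le N).
apply: le_trans (bessel K (fun k => L2_cosk R k.+1) (@cosk_orthonormal R) (L2_dcomb _ _)).
apply: ler_sum => k _; rewrite -inner_pN; last exact: L2_sink.
rewrite le_eqVlt; apply/orP; left; apply/eqP; congr (_ ^+ 2).
have := AC_sin_coef k.+1 (AC_comb cc (index_iota 0 N)).
rewrite comb0 comb1 mul0r !subr0 => e.
have -> : inner (pN N) (sink k.+1) = Num.sqrt 2 * Int (fun x => comb cc (index_iota 0 N) x * sin (freq R k.+1 * x)).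
  rewrite -IntZ; first by apply: eq_Int => x _; rewrite /sink mulrCA.
  by apply: L2_intg_mul; [exact: AC_L2 (AC_comb _ _)|exact: L2_sin].
rewrite mulrCA e -IntZ; first by apply: eq_Int => x _; rewrite /cosk mulrCA.
by apply: L2_intg_mul; [exact: L2_dcomb|exact: L2_cos].
Qed.

(** Integration by parts against a cosine has no boundary term, and the derivative of the partial
    sum is bounded in [L^2] uniformly in [N]. *)
Lemma smooth_cos (a : R) k :
  \sum_(n < N) rho n * inner v (phi n) * inner (phi n) (fun x => cos (freq R k * x)) @[N --> \oo] --> a ->
  (freq R k * a) ^+ 2 <= C ^+ 2 * inner v v.
Proof.
move=> ha.
have h : freq R k * (\sum_(n < N) rho n * inner v (phi n) * inner (phi n) (fun x => cos (freq R k * x))) @[N --> \oo] --> freq R k * a.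
  exact: cvgMr.
have c : (freq R k * (\sum_(n < N) rho n * inner v (phi n) * inner (phi n) (fun x => cos (freq R k * x)))) ^+ 2
    @[N --> \oo] --> (freq R k * a) ^+ 2 by exact: (cvgM h h).
apply: (cvgr_to_le c); apply: nearW => N.
rewrite -inner_pN; last exact: L2_cos.
rewrite (AC_cos_coef k (AC_comb cc (index_iota 0 N))) sqrrN.
apply: le_trans (cauchy_schwarz (L2_dcomb _ _) (L2_sin _)) _.
apply: le_trans (ler_piMr (inner_ge0 _) _) (dpN_le N).
rewrite -[leRHS](Int_cst 1); apply: le_Int; [by apply: L2_intg_mul; exact: L2_sin|exact: intg_cst|].
by move=> x _; rewrite -expr2 -(cos2Dsin2 (freq R k * x)) lerDr sqr_ge0.
Qed.

End Smoothing.

(* [sink k] lies in the form domain, so its eigenfunction expansion converges uniformly, by the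
   energy identity; no convergence of the expansion of [v] is needed. *)
Lemma parseval_sine v k : L2 v ->
  \sum_(n < N) inner v (phi n) * inner (phi n) (sink k) @[N --> \oo] --> inner v (sink k).
Proof.
move=> hv.
pose b n := inner (sink k) (phi n).
(* This is [A_q e_k]. Its eigencoefficients [lam n * b n] are square summable by Bessel, and
   [lam n >= 1] turns this into summability of [lam n * b n ^+ 2], the energy of the expansion of
   [e_k]. *)
pose h x := freq R k ^+ 2 * sink k x + q x * sink k x.
have Lq : L2 (fun x => q x * sink k x) by apply: L2_q_mul; exact: L2_sink.
have L1 : L2 (fun x => freq R k ^+ 2 * sink k x) by apply: L2Z; exact: L2_sink.
have Lh : L2 h by exact: L2D.
have hb n : inner h (phi n) = lam n * b n.
  rewrite innerDl//; last exact: L2_phi.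
  rewrite innerZl; [|exact: L2_sink|exact: L2_phi].
  by rewrite /b !(innerC _ (phi n)) -eigen_sine mulrC.
have [t t0 ht] := @bounded_sum_tail R (fun n => inner h (phi n) ^+ 2) (inner h h)
  (fun n => sqr_ge0 _) (fun N => ltac:(rewrite big_mkord; exact: (bessel N L2_phi ho Lh))).
pose p N := comb b (index_iota 0 N).
have Lp N : L2 (p N) := AC_L2 (AC_comb b _).
have diff M N x : (M <= N)%N -> p N x - p M x = comb b (index_iota M N) x.
  by move=> MN; rewrite /p /comb (@big_cat_nat _ _ _ M 0 N)//= [LHS]addrC addKr.
have lb n : lam n * b n ^+ 2 <= inner h (phi n) ^+ 2.
  rewrite hb exprMn ler_wpM2r ?sqr_ge0// expr2 ler_peMl ?eigenvalue_ge1//.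
  exact: ltW.
have unif M N x : (M <= N)%N -> Om x -> `|p N x - p M x| <= Num.sqrt (t M).
  move=> MN Ox; rewrite diff// -sqrtr_sqr ler_wsqrtr//.
  apply: le_trans (AC_sqr_bound (AC_comb b _) (comb0 _ _) (L2_dcomb _ _) (Omega_itv Ox)) _.
  apply: le_trans (comb_energy _ (iota_uniq _ _)) _.
  by apply: le_trans (ht M N MN); apply: ler_sum => n _; exact: lb.
have ts : Num.sqrt (t n) @[n --> \oo] --> 0.
  rewrite -[X in _ --> X](sqrtr0 R); apply: (@cvg_comp _ _ _ t (@Num.sqrt R) _ (nbhs (0 : R))) => //.
  exact: sqrt_continuous.
have [P LP hP] := uniform_limit Lp ts unif.
have pE N g : L2 g -> inner (p N) g = \sum_(n < N) b n * inner (phi n) g.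
  move=> Lg; rewrite /p /comb inner_suml//; last by move=> n; apply: L2Z; exact: L2_phi.
  by rewrite big_mkord; apply: eq_bigr => n _; rewrite innerZl//; exact: L2_phi.
have Pphi m : inner P (phi m) = b m.
  have c := hP _ (L2_phi m).
  apply: (@cvg_unique _ _ (inner (p N) (phi m) @[N --> \oo])) => //=.
  apply: cvg_near_cst; exists m.+1 => // N /= mN.
  rewrite pE; last exact: L2_phi.
  rewrite (bigD1 (Ordinal mN))//= ho eqxx mulr1 big1 ?addr0// => i ni.
  rewrite ho (_ : _ == _ = false) ?mulr0//.
  by apply/negbTE; apply: contraNneq ni => ni; apply/eqP/val_inj.
(* Completeness of the eigenfunctions identifies the uniform limit with [e_k] itself. *)
have Psink : eq_L2 (fun x => P x - sink k x) (fun=> 0).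
  have [_ [_]] := es; apply; first by apply: L2B => //; exact: L2_sink.
  by move=> n; rewrite innerBl; [|done|exact: L2_sink|exact: L2_phi]; rewrite Pphi subrr.
have e : inner P v = inner (sink k) v.
  have Ls := L2_sink R k.
  have := inner_ae (L2B LP Ls) (L2_cst 0) hv Psink.
  have z : inner (fun=> 0) v = 0 by rewrite -[RHS](Int_cst 0); apply: eq_Int => x _; rewrite mul0r.
  by rewrite innerBl// z => /eqP; rewrite subr_eq0 => /eqP.
rewrite innerC -e.
apply: cvg_trans (hP v hv); apply: near_eq_cvg; apply: nearW => N.
rewrite pE//; apply: eq_bigr => n _.
by rewrite mulrC /b (innerC v) (innerC (sink k)).
Qed.

(** For [w = rho(A_q) v] this is the weak form, tested against [e_k], of
    [A_q w = c v + sigma(A_q) v]. The sequence [S] plays the part of the sine coefficients of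
    [sigma(A_q) v], which gains one derivative. *)
Lemma spectral_multiplier_sink v (rho sigma : nat -> R) (c C' : R) w : L2 v -> 0 <= C' ->
  (forall n, lam n * rho n = c + sigma n) ->
  (forall n, `|sigma n| * Num.sqrt (lam n) <= C') ->
  L2_series (fun n x => rho n * inner v (phi n) * phi n x) w ->
  exists2 S : nat -> R,
    (forall k, freq R k ^+ 2 * inner w (sink k) + inner w (fun x => q x * sink k x)
       = c * inner v (sink k) + S k) &
    (forall K, \sum_(k < K) (freq R k.+1 * S k.+1) ^+ 2 <= C' ^+ 2 * inner v v).
Proof.
move=> hv C0 hr hs hw.
have Lt n : L2 (fun x => rho n * inner v (phi n) * phi n x) by apply: L2Z; exact: L2_phi.
have cw h : L2 h -> \sum_(n < N) rho n * inner v (phi n) * inner (phi n) h @[N --> \oo] --> inner w h.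
  move=> Lh; apply: cvg_trans (L2_series_inner Lt Lh hw); apply: near_eq_cvg; apply: nearW => N.
  by apply: eq_bigr => n _; rewrite innerZl//; exact: L2_phi.
pose S k := freq R k ^+ 2 * inner w (sink k) + inner w (fun x => q x * sink k x) - c * inner v (sink k).
exists S => [k|K]; first by rewrite /S [RHS]addrC subrK.
apply: (@smooth_sine v sigma C' hv C0 hs S K) => k.
have Lq : L2 (fun x => q x * sink k x) by apply: L2_q_mul; exact: L2_sink.
have c1 := cw _ (L2_sink R k); have c2 := cw _ Lq; have c3 := @parseval_sine v k hv.
have d1 : freq R k ^+ 2 * (\sum_(n < N) rho n * inner v (phi n) * inner (phi n) (sink k)) @[N --> \oo]
  --> freq R k ^+ 2 * inner w (sink k) by exact: cvgMr.
have d3 : c * (\sum_(n < N) inner v (phi n) * inner (phi n) (sink k)) @[N --> \oo]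
  --> c * inner v (sink k) by exact: cvgMr.
have d : freq R k ^+ 2 * (\sum_(n < N) rho n * inner v (phi n) * inner (phi n) (sink k)) +
    \sum_(n < N) rho n * inner v (phi n) * inner (phi n) (fun x => q x * sink k x) -
    c * (\sum_(n < N) inner v (phi n) * inner (phi n) (sink k)) @[N --> \oo] --> S k.
  exact: cvgB (cvgD d1 c2) d3.
apply: cvg_trans d; apply: near_eq_cvg; apply: nearW => N /=.
rewrite !mulr_sumr -big_split -sumrB/=; apply: eq_bigr => n _.
have e := eigen_sine n k; have e2 := hr n.
have -> : sigma n = lam n * rho n - c by rewrite e2 addrC addKr.
have -> : inner (phi n) (fun x => q x * sink k x) = inner (phi n) (sink k) * lam n - freq R k ^+ 2 * inner (phi n) (sink k).
  by rewrite e addrC addKr.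
ring.
Qed.

End Spectral.

(** * Completeness of the sines *)

Section CosineSystem.
Variable R : realType.
Notation mu := (@lebesgue_measure R).
Notation Om := (@Omega R).
Implicit Types (F f d : R -> R) (k n j : nat).

Let cp x : R := cos (pi * x).

Lemma continuous_cos_mul (c : R) : continuous (fun x : R => cos (c * x)).
Proof.
move=> x; apply: (@continuous_comp _ _ _ (fun u => c * u) cos); last exact: continuous_cos.
by apply: cvgMr; exact: cvg_id.
Qed.

Lemma continuous_L2 F : {within `[0, 1], continuous F} -> L2 F.
Proof.
move=> cF.
have /compact_bounded[M [_ hM]] := continuous_compact cF (@segment_compact R 0 1).
have mF : measurable_fun `[0 : R, 1 : R] F by apply: subspace_continuous_measurable_fun.
apply: (@bounded_L2 _ _ (M + 1)).
  by apply: measurable_funS mF => //; exact: subset_Omega.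
move=> x Ox; apply: (hM (M + 1)); first by rewrite ltrDl.
by exists x => //; exact: subset_Omega.
Qed.

Lemma L2_mul_cos_pow F j : L2 F -> L2 (fun x => F x * cp x ^+ j).
Proof.
move=> LF; rewrite (_ : (fun x => _) = fun x => cp x ^+ j * F x); last first.
  by apply/funext => x; rewrite mulrC.
apply: (@L2_bounded_mul _ F (fun x => cp x ^+ j) 1) => //.
  by apply: measurable_funX; exact: AC_measurable (AC_cos pi).
move=> x _; rewrite normrX exprn_ile1// ler_norml cos_geN1 cos_le1//.
Qed.

(** Induction on the power of [cos (pi x)]: the product-to-sum formula trades one factor for the two
    neighbouring frequencies. *)
Lemma moments_cos F : {within `[0, 1], continuous F} ->
  (forall k, Int (fun x => F x * cos (freq R k * x)) = 0) ->
  forall j k, Int (fun x => F x * cp x ^+ j * cos (freq R k * x)) = 0.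
Proof.
move=> cF h; elim=> [|j IH] k.
  by rewrite -[RHS](h k); apply: eq_Int => x _; rewrite expr0 mulr1.
have LF := continuous_L2 cF.
have Lc : forall i, L2 (fun x => F x * cp x ^+ i).
  by move=> i; exact: L2_mul_cos_pow.
have ii i c : intg (fun x => F x * cp x ^+ i * cos (c * x)).
  by apply: L2_intg_mul; [exact: Lc|exact: L2_cos].
have cpE x : cp x = cos (freq R 1 * x) by rewrite /cp /freq mul1r.
(* Frequency 0 has no lower neighbour; there the extra factor is itself the cosine of frequency
   1. *)
case: k => [|k].
  rewrite -[RHS](IH 1); apply: eq_Int => x _.
  by rewrite exprS -cpE /freq mul0r mul0r cos0; ring.
have -> : 0 = 2^-1 * (Int (fun x => F x * cp x ^+ j * cos (freq R k.+2 * x)) +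
   Int (fun x => F x * cp x ^+ j * cos (freq R k * x))) :> R by rewrite !IH addr0 mulr0.
rewrite -IntD// -IntZ; last exact: intgD.
apply: eq_Int => x _.
have e1 : cos (freq R k.+2 * x) = cos (freq R k.+1 * x) * cp x - sin (freq R k.+1 * x) * sin (pi * x).
  by rewrite /cp -cosD; congr cos; rewrite /freq -[k.+2%:R]natr1; ring.
have e2 : cos (freq R k * x) = cos (freq R k.+1 * x) * cp x + sin (freq R k.+1 * x) * sin (pi * x).
  by rewrite /cp -cosB; congr cos; rewrite /freq -[k.+1%:R]natr1; ring.
by rewrite e1 e2 exprS; field.
Qed.

Lemma poly_cos_moments F : {within `[0, 1], continuous F} ->
  (forall k, Int (fun x => F x * cos (freq R k * x)) = 0) ->
  forall p : {poly R}, Int (fun x => F x * p.[cp x]) = 0.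
Proof.
move=> cF h p.
have mom j := moments_cos cF h j 0.
have ii j : intg (fun x => F x * cp x ^+ j).
  by apply: L2_intg; apply: L2_mul_cos_pow; exact: continuous_L2.
have -> : Int (fun x => F x * p.[cp x]) = Int (fun x => \sum_(i < size p) p`_i * (F x * cp x ^+ i)).
  by apply: eq_Int => x _; rewrite horner_coef mulr_sumr; apply: eq_bigr => i _; rewrite mulrCA.
rewrite (@Int_sum _ _ _ (fun (i : 'I_(size p)) x => p`_i * (F x * cp x ^+ i))); last by move=> i; exact: intgZ.
rewrite big1// => i _; rewrite IntZ// -[X in _ * X](_ : 0 = _) ?mulr0//.
by rewrite -(mom i); apply: eq_Int => x _; rewrite /freq !mul0r cos0 mulr1.
Qed.

(* The polynomial [1 - (y - cos (pi x0))^2 / 4] in [y = cos (pi x)] peaks at [x0]: its powers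
   concentrate there, which contradicts the vanishing moments of [F]. *)
Lemma cos_total_pos F x0 : {within `[0, 1], continuous F} ->
  (forall k, Int (fun x => F x * cos (freq R k * x)) = 0) -> Om x0 -> ~ (0 < F x0).
Proof.
move=> cF h Ox0 Fpos; have := Ox0; rewrite /Omega /= in_itv/= => /andP[x00 x01].
have LF := continuous_L2 cF.
pose c0 := cp x0.
pose w x := 1 - (cp x - c0) ^+ 2 / 4.
have cpb x : -1 <= cp x <= 1 by rewrite /cp cos_geN1 cos_le1.
have w01 x : 0 <= w x <= 1.
  rewrite /w; have /andP[a b] := cpb x; have /andP[a' b'] := cpb x0.
  rewrite -/c0 in a' b'.
  have : 0 <= (cp x - c0) ^+ 2 <= 4 by rewrite sqr_ge0/=; nra.
  by move=> /andP[u v]; apply/andP; split; lra.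
have mom n : Int (fun x => F x * w x ^+ n) = 0.
  have := poly_cos_moments cF h ((1 - (4^-1)%:P * ('X - c0%:P) ^+ 2) ^+ n).
  move=> <-; apply: eq_Int => x _.
  rewrite horner_exp; congr (_ * _ ^+ _); rewrite /w hornerD hornerN hornerM horner_exp hornerXsubC !hornerC; congr (1 - _); exact: mulrC.
have cFx : {for x0, continuous F}.
  have /(continuous_within_itvP _ ltr01)[hh _ _] := cF; apply: hh.
  by rewrite in_itv/= x00 x01.
pose e := F x0 / 2.
have e0 : 0 < e by rewrite /e divr_gt0.
have [r [r0 rF rx rx']] : exists r : R, [/\ 0 < r, forall x, `|x - x0| < r -> e <= F x,
    r <= x0 & r <= 1 - x0].
  have /cvgrPdist_lt/(_ _ e0)[r1 /= r10 hr1] := cFx.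
  exists (Num.min r1 (Num.min x0 (1 - x0))); split.
  - by rewrite !lt_min r10 x00 subr_gt0.
  - move=> x; rewrite !lt_min => /andP[xr _].
    have := hr1 x; rewrite /= distrC => /(_ xr).
    rewrite ltr_distl /e; lra.
  - by rewrite !ge_min lexx orbT.
  - by rewrite !ge_min lexx !orbT.
have cpi (x : R) : 0 <= x <= 1 -> pi * x \in `[0, pi].
  move=> /andP[a b]; rewrite in_itv/= mulr_ge0 ?pi_ge0//=.
  by rewrite -[leRHS]mulr1 ler_wpM2l// pi_ge0.
have cp_decr (x y : R) : 0 <= x -> x <= y -> y <= 1 -> cp y <= cp x.
  move=> a b c; have [->//|xy] := eqVneq x y.
  have hx : 0 <= x <= 1 by rewrite a (le_trans b c).
  have hy : 0 <= y <= 1 by rewrite c (le_trans a b).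
  apply/ltW; rewrite /cp (ltr_cos (cpi x hx) (cpi y hy)).
  by rewrite ltr_pM2l ?pi_gt0// lt_neqAle xy.
have cp_sdecr (x y : R) : 0 <= x -> x < y -> y <= 1 -> cp y < cp x.
  move=> a b c.
  have hx : 0 <= x <= 1 by rewrite a (le_trans (ltW b) c).
  have hy : 0 <= y <= 1 by rewrite c (le_trans a (ltW b)).
  rewrite /cp (ltr_cos (cpi x hx) (cpi y hy)).
  by rewrite ltr_pM2l ?pi_gt0.
(* As [cos (pi x)] is strictly decreasing on [[0, 1]], it stays at distance at least [et] from [c0]
   outside the [r]-neighbourhood of [x0]. *)
have [rho [rho0 rho1 hrho]] : exists rho : R, [/\ 0 <= rho, rho < 1 &
    forall x, Om x -> r <= `|x - x0| -> w x <= rho].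
  have h1 : 0 < cp (x0 - r) - c0 by rewrite subr_gt0; apply: cp_sdecr; lra.
  have h2 : 0 < c0 - cp (x0 + r) by rewrite subr_gt0; apply: cp_sdecr; lra.
  pose et := Num.min (cp (x0 - r) - c0) (c0 - cp (x0 + r)).
  have et0 : 0 < et by rewrite lt_min h1 h2.
  have et1 : et <= cp (x0 - r) - c0 by rewrite ge_min lexx.
  have et2 : et <= c0 - cp (x0 + r) by rewrite ge_min lexx orbT.
  have et4 : 0 < et ^+ 2 by rewrite exprn_gt0.
  exists (Num.max 0 (1 - et ^+ 2 / 4)); split; first by rewrite le_max lexx.
    rewrite gt_max ltr01/=; lra.
  move=> x /Omega_itv /andP[a b] rxx; rewrite le_max; apply/orP; right.
  rewrite /w lerD2l lerN2 ler_pM2r//.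
  have [xx|xx] := leP x x0.
    rewrite ler0_norm ?subr_le0// opprB in rxx.
    rewrite lerXn2r ?nnegrE ?(ltW et0)//.
      by rewrite subr_ge0; apply: cp_decr; lra.
    apply: le_trans et1 _; rewrite lerB//; apply: cp_decr; lra.
  rewrite gtr0_norm ?subr_gt0// in rxx.
  rewrite -[X in _ <= X]sqrrN opprB lerXn2r ?nnegrE ?(ltW et0)//.
    by rewrite subr_ge0; apply: cp_decr; lra.
  apply: le_trans et2 _; rewrite lerB//; apply: cp_decr; lra.
(* A level strictly between [rho] and the peak value 1: the powers of [w] near [x0] dominate
   geometrically those far from it. *)
pose rho' := (1 + rho) / 2.
have rr : rho < rho' by rewrite /rho'; lra.
have rho'0 : 0 < rho' by rewrite /rho'; lra.
have [r' [r'0 r'r hr']] : exists r' : R, [/\ 0 < r', r' < r & forall x, `|x - x0| <= r' -> rho' <= w x].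
  have c1 : (cp x - c0) @[x --> x0] --> cp x0 - c0.
    by apply: cvgB; [exact: continuous_cos_mul|exact: cvg_cst].
  have cw : w x @[x --> x0] --> w x0.
    by apply: cvgB; [exact: cvg_cst|apply: cvgMl; exact: (cvgM c1 c1)].
  have w0 : w x0 = 1 by rewrite /w subrr expr0n/= mul0r subr0.
  have /cvgrPdist_lt/(_ (1 - rho')) := cw.
  have r1 : 0 < 1 - rho' by rewrite /rho'; lra.
  move=> /(_ r1)[r2 /= r20 hr2].
  exists (Num.min r r2 / 2); split.
  - by rewrite divr_gt0// lt_min r0 r20.
  - by rewrite ltr_pdivrMr// gt_min; apply/orP; left; lra.
  - move=> x xr; have := hr2 x; rewrite /= distrC.
    have -> : `|x - x0| < r2.
      apply: le_lt_trans xr _; rewrite ltr_pdivrMr//.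
      by apply: le_lt_trans (_ : r2 < _); [rewrite ge_min lexx orbT|lra].
    by move=> /(_ isT); rewrite w0 ltr_distlC; lra.
have [M hM] : exists M : R, forall x, Om x -> `|F x| <= M.
  have /compact_bounded[M [_ hM]] := continuous_compact cF (@segment_compact R 0 1).
  exists (M + 1) => x Ox; apply: (hM (M + 1)); first by rewrite ltrDl.
  by exists x => //; exact: subset_Omega.
pose J : set R := [set` `[x0 - r', x0 + r']].
have mJ : measurable J by exact: measurable_itv.
have mO : measurable Om by exact: measurable_Omega.
have iJ : intg (fun x => \1_J x).
  apply: L2_intg; apply: (@bounded_L2 _ _ 1) => [|x _]; last first.
    by rewrite indicE; case: (_ \in _); rewrite ?normr1 ?normr0.
  exact: measurable_indic.
have mJv : mu J = (2 * r')%:E.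
  rewrite /J lebesgue_measure_itv/= lte_fin ifT; last by lra.
  by rewrite -EFinB /=; congr EFin; ring.
have IJ : Int (fun x => \1_J x) = 2 * r'.
  rewrite /Int /Rintegral integral_indic// setIidl; last first.
    by move=> x; rewrite /J /Omega /= !in_itv/= => /andP[a b]; apply/andP; split; lra.
  by rewrite [X in fine X]mJv.
(* Three regions: within [r'] of [x0] the integrand is at least [e * rho' ^+ n], up to distance [r]
   it is nonnegative, and beyond it is at least [- M * rho ^+ n]. The total integral is 0. *)
have key n : 2 * r' * e * rho' ^+ n <= M * rho ^+ n.
  have iL : intg (fun x => e * rho' ^+ n * \1_J x - M * rho ^+ n).
    by apply: intgB; [exact: intgZ|exact: intg_cst].
  have mw : measurable_fun Om w.
    apply: measurable_funB => //; apply: measurable_funM => //; apply: measurable_funX.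
    by apply: measurable_funB => //; exact: AC_measurable (AC_cos pi).
  have Lw : L2 (fun x => F x * w x ^+ n).
    rewrite (_ : (fun x => _) = fun x => w x ^+ n * F x); last by apply/funext => x; rewrite mulrC.
    apply: (@L2_bounded_mul _ F (fun x => w x ^+ n) 1) => //; first exact: measurable_funX.
    move=> x _; have /andP[a b] := w01 x.
    by rewrite normrX exprn_ile1// ger0_norm.
  have : Int (fun x => e * rho' ^+ n * \1_J x - M * rho ^+ n) <= Int (fun x => F x * w x ^+ n).
    apply: le_Int => //; first exact: L2_intg.
    move=> x Ox.
    have M0 : 0 <= M by apply: le_trans (hM x Ox).
    have /andP[wx0 wx1] := w01 x.
    have rn : 0 <= M * rho ^+ n by rewrite mulr_ge0// exprn_ge0.
    have [xr|xr] := leP `|x - x0| r'.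
      rewrite indicE mem_set ?mulr1; last first.
        by rewrite /J /= in_itv/=; move: xr; rewrite ler_distl.
      apply: le_trans (_ : e * rho' ^+ n <= _); first by rewrite gerBl.
      rewrite ler_pM ?exprn_ge0 ?(ltW e0) ?(ltW rho'0)//.
        by apply: rF; exact: le_lt_trans r'r.
      by rewrite lerXn2r ?nnegrE ?(ltW rho'0)// hr'.
    rewrite indicE memNset ?mulr0 ?sub0r; last first.
      by rewrite /J /= in_itv/= -ler_distl; apply/negP; rewrite -ltNge.
    have [xr'|xr'] := leP r `|x - x0|.
      rewrite lerNl; apply: le_trans (ler_norm _) _; rewrite normrN normrM.
      rewrite ler_pM// ?hM// normrX ger0_norm// lerXn2r ?nnegrE// hrho//.
    apply: (@le_trans _ _ 0); first by rewrite oppr_le0.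
    by rewrite mulr_ge0 ?exprn_ge0// (le_trans (ltW e0))// rF.
  rewrite mom IntB; [|exact: intgZ|exact: intg_cst].
  rewrite IntZ// IJ Int_cst subr_le0; apply: le_trans.
  by rewrite le_eqVlt; apply/orP; left; apply/eqP; ring.
have c : M * (rho / rho') ^+ n @[n --> \oo] --> 0.
  rewrite -[X in _ --> X](mulr0 M); apply: cvgMr; apply: cvg_expr.
  by rewrite ger0_norm ?ltr_pdivrMr ?mul1r// divr_ge0// ltW.
have : 2 * r' * e <= 0.
  apply: (cvgr_to_ge c); apply: nearW => n.
  rewrite expr_div_n [leRHS]mulrA ler_pdivlMr ?exprn_gt0//; exact: key.
by apply/negP; rewrite -ltNge !mulr_gt0.
Qed.

Lemma cos_total F : {within `[0, 1], continuous F} ->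
  (forall k, Int (fun x => F x * cos (freq R k * x)) = 0) ->
  forall x, Om x -> F x = 0.
Proof.
move=> cF h x Ox; apply/eqP; rewrite eq_le; apply/andP; split; rewrite leNgt; apply/negP.
  exact: cos_total_pos cF h Ox.
rewrite -oppr_gt0; apply: (@cos_total_pos (fun x => - F x)) => //.
  by move=> y; apply: cvgN; exact: cF.
move=> k; rewrite -[RHS](mulr0 (-1)) -(h k) -IntZ.
  by apply: eq_Int => y _; rewrite mulN1r mulNr.
by apply: L2_intg_mul; [exact: continuous_L2|exact: L2_cos].
Qed.

(** The primitive of [d] has vanishing cosine coefficients at all positive frequencies, so after
    subtraction of its mean [cos_total] makes it constant on the open interval. Lebesgue
    differentiation then returns [d = 0] almost everywhere. *)
Lemma sine_total d : L2 d -> (forall k, inner d (sink k.+1) = 0) -> eq_L2 d (fun=> 0).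
Proof.
move=> Ld h; have id := L2_intg Ld.
have hF := AC_prim 0 id; set F := (fun x => _) in hF.
pose m := Int F.
have LF := AC_L2 hF.
have cF : {within `[0, 1], continuous (fun x => F x - m)}.
  by move=> x; apply: cvgB; [exact: (AC_continuous hF)|exact: cvg_cst].
have Fm x : Om x -> F x = m.
  move=> Ox; apply/eqP; rewrite -subr_eq0; apply/eqP.
  apply: (cos_total cF) Ox => k.
  have i1 : intg (fun x => F x * cos (freq R k * x)) by apply: L2_intg_mul => //; exact: L2_cos.
  have i2 : intg (fun x => cos (freq R k * x)) by apply: L2_intg; exact: L2_cos.
  rewrite (eq_Int (g := fun x => F x * cos (freq R k * x) - m * cos (freq R k * x))); last first.
    by move=> y _; rewrite mulrBl.
  rewrite IntB//; last exact: intgZ.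
  rewrite IntZ//; case: k i1 i2 => [|k] i1 i2.
    have e1 : Int (fun x => cos (freq R 0 * x)) = 1 :> R.
      by rewrite -[RHS](Int_cst 1); apply: eq_Int => y _; rewrite /freq !mul0r cos0.
    rewrite e1 mulr1 (eq_Int (g := F)) ?subrr// => y _.
    by rewrite /freq !mul0r cos0 mulr1.
  rewrite [Int (fun x => cos _)]Int_cos ?sin_freq ?gt_eqF ?freq_gt0// mulr0 subr0.
  have f0 : freq R k.+1 != 0 by rewrite gt_eqF ?freq_gt0.
  apply: (mulfI f0); rewrite mulr0 (AC_cos_coef _ hF).
  have -> : Int (fun x => d x * sin (freq R k.+1 * x)) = 0.
    have s2 : Num.sqrt 2 != 0 :> R by rewrite gt_eqF// sqrtr_gt0.
    apply: (mulfI s2); rewrite mulr0 -(h k) -IntZ; last by apply: L2_intg_mul => //; exact: L2_sin.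
    by apply: eq_Int => y _; rewrite /sink mulrCA.
  by rewrite oppr0.
have id' : mu.-integrable `[0, 1] (EFin \o d) by apply/intg_cc.
have := lebesgue_differentiation (integrable_locally (measurable_itv _) id').
apply: filterS; first exact: (ae_filter_ringOfSetsType mu).
move=> x hx Ox.
have := Ox; rewrite /Omega /= in_itv/= => /andP[x0 x1].
have xI (y : R) : 0 <= y <= 1 -> (d \_ `[0, 1]) y = d y.
  by move=> y01; rewrite patchE mem_set//= in_itv.
have i0 : mu.-integrable `[0, 1] (EFin \o (d \_ `[0, 1])).
  apply: eq_integrable id' => //= y; rewrite inE/= in_itv/= => y01; by rewrite xI.
have [|_ e] := @FTC1_lebesgue_pt R (d \_ `[0, 1]) (BLeft 0) x 1 x1 i0 _ hx.
  exact: x0.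
rewrite -xI ?(ltW x0) ?(ltW x1)// -e derive1E.
rewrite (@near_eq_derive _ _ _ _ (cst m)) ?derive_cst//.
near=> y.
have Oy : Om y.
  rewrite /Omega /= in_itv/=; apply/andP; split; near: y.
    exact: lt_nbhsr.
  exact: lt_nbhsl.
rewrite /= -(Fm y Oy) /F add0r; apply: eq_Rintegral => z.
rewrite inE/= in_itv/= => /andP[z0 zy]; apply: xI; rewrite z0/= (le_trans zy)//.
by have /Omega_itv/andP[] := Oy.
Unshelve. all: by end_near. Qed.

End CosineSystem.

(** * Weighted square-summable sequences *)

Section WeightedSequences.
Variable R : realType.
Implicit Types (a b : nat -> R) (s t c : R) (k m n j K N : nat).

(** The weighted [l^2] space of the overview. Entry 0 is ignored, as sine coefficients start at 1,
    and the weight omits the powers of [pi], which affect only the constant. *)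
Definition Wt s a := exists B : R, forall K,
  \sum_(k < K) (powR k.+1%:R s * a k.+1) ^+ 2 <= B.

Lemma WtD s a b : Wt s a -> Wt s b -> Wt s (fun k => a k + b k).
Proof.
move=> [A hA] [B hB]; exists (2 * A + 2 * B) => K.
apply: le_trans (lerD (ler_wpM2l _ (hA K)) (ler_wpM2l _ (hB K))) => //.
rewrite !mulr_sumr -big_split/=; apply: ler_sum => k _.
set p := powR _ _; have := sqr_ge0 (p * a k.+1 - p * b k.+1).
rewrite mulrDr sqrrB sqrrD; lra.
Qed.

Lemma WtZ s c a : Wt s a -> Wt s (fun k => c * a k).
Proof.
move=> [A hA]; exists (c ^+ 2 * A) => K.
apply: le_trans (ler_wpM2l (sqr_ge0 c) (hA K)).
rewrite mulr_sumr; apply: ler_sum => k _.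
by rewrite -exprMn mulrCA.
Qed.

Lemma WtB s a b : Wt s a -> Wt s b -> Wt s (fun k => a k - b k).
Proof.
move=> ha hb; have := WtD ha (WtZ (-1) hb).
by congr (Wt s _); apply/funext => k; rewrite mulN1r.
Qed.

Lemma Wt_le s a b : (forall k, `|a k.+1| <= `|b k.+1|) -> Wt s b -> Wt s a.
Proof.
move=> h [B hB]; exists B => K; apply: le_trans (hB K).
apply: ler_sum => k _; rewrite -[leLHS]real_normK ?num_real// -[leRHS]real_normK ?num_real//.
by rewrite lerXn2r ?nnegrE// !normrM ler_wpM2l.
Qed.

Lemma Wt_eq s a b : (forall k, a k.+1 = b k.+1) -> Wt s b -> Wt s a.
Proof. by move=> h; apply: Wt_le => k; rewrite h. Qed.

Lemma Wt_freq s a B : s <= 1 -> (forall K, \sum_(k < K) (freq R k.+1 * a k.+1) ^+ 2 <= B) -> Wt s a.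
Proof.
move=> s1 h; exists B => K; apply: le_trans (h K); apply: ler_sum => k _.
rewrite -[leLHS]real_normK ?num_real// -[leRHS]real_normK ?num_real//.
have f0 : 0 <= freq R k.+1 by apply/ltW/freq_gt0.
rewrite lerXn2r ?nnegrE// !(normrM _ (a _)) ler_wpM2r// (ger0_norm f0) (ger0_norm (powR_ge0 _ _)).
apply: le_trans (freq_ge_nat R k.+1).
by rewrite -[leRHS]powRr1// ler_powR// ler1n.
Qed.

(** The summand is [k^(-1-eta)]. Comparison with the integral is replaced by a telescoping bound
    whose step is [powR_tangent] at consecutive integers. *)
Lemma sum_powR_sqr_bounded t : t < - (1 / 2) -> exists B : R, forall K,
  \sum_(k < K) powR k.+1%:R t ^+ 2 <= B.
Proof.
move=> t0; pose eta := - 2 * t - 1.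
have eta0 : 0 < eta by rewrite /eta; lra.
exists (1 + eta^-1) => K.
case: K => [|K]; first by rewrite big_ord0 addr_ge0// invr_ge0 ltW.
suff : \sum_(k < K.+1) powR k.+1%:R t ^+ 2 <= 1 + (1 - powR K.+1%:R (- eta)) / eta.
  move=> /le_trans; apply; rewrite lerD2l ler_pdivrMr// mulVf ?gt_eqF//.
elim: K => [|K IH].
  by rewrite big_ord1 !powR1 subrr mul0r addr0 expr1n.
rewrite big_ord_recr/=; apply: le_trans (lerD IH (lexx _)) _.
rewrite -addrA lerD2l -lerBrDl -mulrBl ler_pdivlMr//.
have K0 : 0 < K.+1%:R :> R by rewrite ltr0n.
have K1 : 0 < K.+2%:R :> R by rewrite ltr0n.
have h := powR_tangent (ltW eta0) K1 K0.
have e1 : powR K.+2%:R t ^+ 2 = powR K.+2%:R (- eta) / K.+2%:R :> R.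
  rewrite -powR_mulrn ?powR_ge0// -powRrM -powR_inv1 ?ltW// -powRD.
    by congr powR; rewrite /eta; ring.
  by rewrite (gt_eqF K1) implybT.
rewrite e1 !powRN.
have e2 : 1 + eta * (1 - K.+1%:R / K.+2%:R) = 1 + eta / K.+2%:R :> R.
  have -> : K.+1%:R = K.+2%:R - 1 :> R by rewrite -[K.+2%:R]natr1 addrK.
  by field; rewrite gt_eqF.
rewrite e2 in h.
have h2 : (powR K.+2%:R eta)^-1 * (1 + eta / K.+2%:R) <= (powR K.+1%:R eta)^-1 :> R.
  by rewrite mulrC ler_pdivrMr// ler_pdivlMl.
have -> : 1 - (powR K.+2%:R eta)^-1 - (1 - (powR K.+1%:R eta)^-1) =
   (powR K.+1%:R eta)^-1 - (powR K.+2%:R eta)^-1 :> R by ring.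
rewrite lerBrDl; apply: le_trans h2.
by rewrite le_eqVlt; apply/orP; left; apply/eqP; ring.
Qed.

(** Used for functions that do not vanish at the endpoints; here [s < 1/2] is what makes
    [k^(2 s - 2)] summable. *)
Lemma Wt_inv s a c : s < 1 / 2 -> (forall k, `|freq R k.+1 * a k.+1| <= c) -> Wt s a.
Proof.
move=> s0 h; have [|B hB] := @sum_powR_sqr_bounded (s - 1); first by lra.
exists (c ^+ 2 * B) => K.
apply: le_trans (ler_wpM2l (sqr_ge0 c) (hB K)).
rewrite mulr_sumr; apply: ler_sum => k _.
have k0 : 0 < k.+1%:R :> R by rewrite ltr0n.
have c0 : 0 <= c by apply: le_trans (h 0%N).
rewrite -exprMn -[leLHS]real_normK ?num_real// lerXn2r ?nnegrE ?mulr_ge0 ?powR_ge0//.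
rewrite normrM ger0_norm ?powR_ge0//.
have -> : powR k.+1%:R s = powR k.+1%:R (s - 1) * k.+1%:R :> R.
  rewrite -{3}[k.+1%:R]powRr1 ?ler0n// -powRD; first by rewrite subrK.
  by rewrite (gt_eqF k0) implybT.
rewrite -mulrA [leRHS]mulrC ler_wpM2l ?powR_ge0//.
have f0 : 0 <= freq R k.+1 by apply/ltW/freq_gt0.
by apply: le_trans (h k); rewrite (normrM _ (a _)) ler_wpM2r// (ger0_norm f0) freq_ge_nat.
Qed.

Lemma Hdot_Wt s v : Hdot s v -> Wt s (fun k => inner v (sink k)).
Proof.
move=> [Lv hs].
have p0 : 0 < powR pi (2 * s) :> R by rewrite powR_gt0 ?pi_gt0.
set S := (\sum_(1 <= n <oo) _)%E in hs.
have S0 : (0 <= S)%E.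
  apply: nneseries_ge0 => n _ _; rewrite lee_fin mulr_ge0 ?powR_ge0 ?sqr_ge0//.
exists (fine S / powR pi (2 * s)) => K.
rewrite ler_pdivlMr// mulrC mulr_sumr -lee_fin fineK ?ge0_fin_numE//.
have -> : (\sum_(k < K) powR pi (2 * s) * (powR k.+1%:R s * inner v (sink k.+1)) ^+ 2)%:E =
   (\sum_(1 <= n < K.+1) (powR (n%:R * pi) (2 * s) * (sine_coef v n) ^+ 2)%:E)%E.
  rewrite sumEFin; congr EFin; rewrite big_add1/= big_mkord; apply: eq_bigr => k _.
  rewrite powRM ?pi_ge0// exprMn -[powR k.+1%:R (2 * s)](_ : powR k.+1%:R s ^+ 2 = _); last first.
    by rewrite -powR_mulrn ?powR_ge0// -powRrM mulrC.
  by rewrite mulrA [powR pi _ * _]mulrC.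
apply: nneseries_lim_ge => n _ _; rewrite lee_fin mulr_ge0 ?powR_ge0 ?sqr_ge0//.
Qed.

Lemma Wt_Hdot s v : L2 v -> Wt s (fun k => inner v (sink k)) -> Hdot s v.
Proof.
move=> Lv [B hB]; split => //.
apply: (@le_lt_trans _ _ (powR pi (2 * s) * B)%:E); last exact: ltry.
apply: lime_le.
  apply: is_cvg_nneseries => n _ _; rewrite lee_fin mulr_ge0 ?powR_ge0 ?sqr_ge0//.
apply: nearW => K; case: K => [|K].
  rewrite big_geq// lee_fin mulr_ge0 ?powR_ge0//; have := hB 0%N; rewrite big_ord0//.
rewrite sumEFin lee_fin big_add1/= big_mkord.
apply: le_trans (ler_wpM2l (powR_ge0 _ _) (hB K)).
rewrite mulr_sumr; apply: ler_sum => k _.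
rewrite powRM ?pi_ge0// exprMn [powR k.+1%:R (2 * s)](_ : _ = powR k.+1%:R s ^+ 2); last first.
  by rewrite -powR_mulrn ?powR_ge0// -powRrM mulrC.
rewrite -[sine_coef v k.+1]/(inner v (sink k.+1)) le_eqVlt; apply/orP; left; apply/eqP; ring.
Qed.

End WeightedSequences.

(** * Absolutely convergent sine series and products *)

Section SineSeries.
Variable R : realType.
Notation Om := (@Omega R).
Implicit Types (d g u : R -> R) (j k m n K N : nat).

Lemma sink_orthonormal k m : inner (@sink R k.+1) (sink m.+1) = (k == m)%:R.
Proof.
have -> : inner (@sink R k.+1) (sink m.+1) =
    Int (fun x => cos ((freq R k.+1 - freq R m.+1) * x)) - Int (fun x => cos ((freq R k.+1 + freq R m.+1) * x)).
  rewrite -IntB; try by apply: L2_intg; exact: L2_cos.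
  apply: eq_Int => x _; rewrite /sink mulrBl mulrDl cosB cosD mulrACA sqrt2_sqr; ring.
rewrite [X in _ - X]Int_cos ?subr0; last first.
- by rewrite sinD !sin_freq mul0r mulr0 addr0.
- by rewrite gt_eqF// addr_gt0// freq_gt0.
have [->|km] := eqVneq k m.
  by rewrite subrr -[RHS](Int_cst 1); apply: eq_Int => x _; rewrite mul0r cos0.
rewrite Int_cos//.
  rewrite /freq -mulrBl; apply: mulf_neq0; last by rewrite gt_eqF// pi_gt0.
  by rewrite subr_eq0 eqr_nat eqSS.
by rewrite sinB !sin_freq mul0r mulr0 subr0.
Qed.

Lemma sink_bound k x : `|@sink R k x| <= Num.sqrt 2.
Proof.
rewrite /sink normrM ger0_norm ?sqrtr_ge0// ler_piMr ?sqrtr_ge0//.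
by rewrite ler_norml sin_geN1 sin_le1.
Qed.

(** Absolute summability makes the sine series converge uniformly, and [sine_total] identifies its
    sum with [d]. *)
Lemma sine_series_inner d B : L2 d ->
  (forall N, \sum_(0 <= j < N) `|inner d (sink j.+1)| <= B) ->
  forall g, L2 g ->
  \sum_(j < N) inner d (sink j.+1) * inner (sink j.+1) g @[N --> \oo] --> inner d g.
Proof.
move=> Ld hB.
pose p N x := \sum_(0 <= j < N) inner d (sink j.+1) * @sink R j.+1 x.
have Lp N : L2 (p N) by apply: L2_sum => j; apply: L2Z; exact: L2_sink.
have [t t0 ht] := bounded_sum_tail (fun j => normr_ge0 (inner d (sink j.+1))) hB.
have ts : t n * Num.sqrt 2 @[n --> \oo] --> 0.
  by rewrite -[X in _ --> X](mul0r (Num.sqrt 2 : R)); exact: cvgMl.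
have unif M N x : (M <= N)%N -> Om x -> `|p N x - p M x| <= t M * Num.sqrt 2.
  move=> MN _; rewrite /p (@big_cat_nat _ _ _ M 0 N)//= addrAC subrr add0r.
  apply: le_trans (ler_norm_sum _ _ _) _.
  apply: le_trans (ler_wpM2r (sqrtr_ge0 2) (ht M N MN)).
  rewrite mulr_suml; apply: ler_sum => j _.
  by rewrite normrM ler_wpM2l// sink_bound.
have [P LP hP] := uniform_limit Lp ts unif.
have pE N g : L2 g -> inner (p N) g = \sum_(j < N) inner d (sink j.+1) * inner (sink j.+1) g.
  move=> Lg; rewrite /p inner_suml//; last by move=> j; apply: L2Z; exact: L2_sink.
  by rewrite big_mkord; apply: eq_bigr => j _; rewrite innerZl//; exact: L2_sink.
have Ps m : inner P (sink m.+1) = inner d (sink m.+1).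
  have c := hP _ (L2_sink R m.+1).
  apply: (@cvg_unique _ _ (inner (p N) (sink m.+1) @[N --> \oo])) => //=.
  apply: cvg_near_cst; exists m.+1 => // N /= mN.
  rewrite pE; last exact: L2_sink.
  rewrite (bigD1 (Ordinal mN))//= sink_orthonormal eqxx mulr1 big1 ?addr0// => i ni.
  rewrite sink_orthonormal (_ : _ == _ = false) ?mulr0//.
  by apply/negbTE; apply: contraNneq ni => ni; apply/eqP/val_inj.
have dP : eq_L2 (fun x => d x - P x) (fun=> 0).
  apply: sine_total; first exact: L2B.
  by move=> k; rewrite innerBl ?Ps ?subrr//; exact: L2_sink.
move=> g Lg.
have e : inner d g = inner P g.
  have := inner_ae (L2B Ld LP) (L2_cst 0) Lg dP.
  have z : inner (fun=> 0) g = 0 by rewrite -[RHS](Int_cst 0); apply: eq_Int => x _; rewrite mul0r.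
  by rewrite innerBl// z => /eqP; rewrite subr_eq0 => /eqP.
rewrite e; apply: cvg_trans (hP g Lg); apply: near_eq_cvg; apply: nearW => N.
by rewrite pE.
Qed.

(** The distance [|k - j|] in [nat]: one of the two truncated differences is always 0. *)
Definition absd k j := ((k - j) + (j - k))%N.

Lemma cos_absd k j x : cos (freq R (absd k j) * x) = cos ((freq R k - freq R j) * x).
Proof.
rewrite /absd; case: (leqP j k) => kj.
  have -> : (j - k = 0)%N by lia.
  by rewrite addn0 /freq natrB// mulrBl.
have -> : (k - j = 0)%N by lia.
by rewrite add0n /freq natrB 1?ltnW// -cosN; congr cos; ring.
Qed.

Lemma inner_sink_mul u j k : L2 u ->
  inner (sink j) (fun x => u x * sink k x) =
  Int (fun x => u x * cos (freq R (absd k j) * x)) - Int (fun x => u x * cos (freq R (k + j) * x)).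
Proof.
move=> Lu; rewrite -IntB; try by apply: L2_intg_mul => //; exact: L2_cos.
apply: eq_Int => x _; rewrite cos_absd (_ : freq R (k + j) = freq R k + freq R j); last by rewrite /freq natrD mulrDl.
rewrite mulrBl mulrDl cosB cosD /sink.
have := sqrt2_sqr R; move: (Num.sqrt 2 : R) => s2 e.
transitivity (s2 * s2 * (u x * (sin (freq R j * x) * sin (freq R k * x)))); first by ring.
by rewrite e; ring.
Qed.

(** Each distance occurs at most twice as [k] varies, once on either side of [j]. *)
Lemma sum_absd (y : nat -> R) K j : (forall m, 0 <= y m) ->
  \sum_(k < K) y (absd k j) <= \sum_(m < j.+1) y m + \sum_(m < K) y m.
Proof.
move=> y0; elim: K j => [|K IH] j.
  by rewrite !big_ord0 addr0 sumr_ge0.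
case: j => [|j].
  rewrite (eq_bigr (fun m : 'I_K.+1 => y m)); last first.
    by move=> m _; rewrite /absd subn0 sub0n addn0.
  by rewrite lerDr sumr_ge0.
rewrite big_ord_recl/= [absd _ _](_ : _ = j.+1); last by rewrite /absd.
rewrite (eq_bigr (fun k : 'I_K => y (absd k j))); last first.
  by move=> k _; rewrite /absd /= !subSS.
rewrite big_ord_recr/= [X in _ <= _ + X]big_ord_recr/=.
have := IH j; have := y0 K; lra.
Qed.

Lemma leq_weight k m j : (k <= m + j)%N -> (k <= m.+1 * j.+1)%N.
Proof. by move=> h; rewrite mulSn mulnS; lia. Qed.

(** Distributes the weight at frequency [k] over the two factors of a product, at frequencies
    related to [m] and [j]. *)
Lemma weight_submul (s : R) k j m : 0 <= s -> (k <= m.+1 * j.+1)%N ->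
  powR k%:R s <= powR m.+1%:R s * powR j.+1%:R s :> R.
Proof.
move=> s0 h; rewrite -powRM// ge0_ler_powR ?nnegrE//.
by rewrite -natrM ler_nat.
Qed.

Lemma jensen (mu x : nat -> R) M N : (forall j, 0 <= mu j) -> \sum_(j < N) mu j <= M ->
  (\sum_(j < N) mu j * x j) ^+ 2 <= M * \sum_(j < N) mu j * x j ^+ 2.
Proof.
move=> mu0 hM; set S1 := \sum_(j < N) mu j * x j; set S2 := \sum_(j < N) mu j * x j ^+ 2.
have S20 : 0 <= S2 by apply: sumr_ge0 => j _; rewrite mulr_ge0 ?sqr_ge0.
apply: le_trans (ler_wpM2r S20 hM); set S0 := \sum_(j < N) mu j.
have S00 : 0 <= S0 by apply: sumr_ge0.
have key t : 0 <= S2 - 2 * t * S1 + t ^+ 2 * S0.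
  have -> : S2 - 2 * t * S1 + t ^+ 2 * S0 = \sum_(j < N) mu j * (x j - t) ^+ 2.
    rewrite /S2 /S1 /S0 !mulr_sumr -sumrB -big_split/=; apply: eq_bigr => j _; ring.
  by apply: sumr_ge0 => j _; rewrite mulr_ge0 ?sqr_ge0.
move: S00; rewrite le_eqVlt => /predU1P[S00|S00].
  rewrite -S00 mul0r.
  have z j : (j < N)%N -> mu j = 0.
    move=> jN; apply/eqP; rewrite eq_le mu0 andbT S00 /S0 (bigD1 (Ordinal jN))//= lerDl.
    by apply: sumr_ge0.
  by rewrite /S1 big1 ?expr0n// => j _; rewrite z ?mul0r.
have h := key (S1 / S0).
rewrite mulrC -ler_pdivrMr//.
have e1 : 2 * (S1 / S0) * S1 = 2 * (S1 ^+ 2 / S0) by field; rewrite gt_eqF.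
have e2 : (S1 / S0) ^+ 2 * S0 = S1 ^+ 2 / S0 by field; rewrite gt_eqF.
rewrite e1 e2 in h; lra.
Qed.

(** By [inner_sink_mul] the coefficients are [sum_j d_j (W |k - j| - W (k + j))], with [W] the
    cosine coefficients of [u]: a discrete convolution. After the weight has been split, [j^s d_j]
    is summable because [t - s > 1/2], and [m^s W_m] is square summable because [W_m = O(1/m)] and
    [s < 1/2]. The rest is Young's inequality for [l^1] against [l^2], through [jensen]. *)
Lemma Wt_product (d u : R -> R) (s t c C : R) : 0 < s < 1 / 2 -> s + 1 / 2 < t ->
  L2 d -> measurable_fun Om d -> (forall x, Om x -> `|d x| <= c) -> L2 u ->
  Wt t (fun k => inner d (sink k)) ->
  (forall m, m.+1%:R * `|Int (fun x => u x * cos (freq R m * x))| <= C) ->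
  Wt s (fun k => inner d (fun x => u x * sink k x)).
Proof.
move=> /andP[s0 s1] st Ld md bd Lu [Bt hBt] hC.
have C0 : 0 <= C by apply: le_trans (hC 0%N); rewrite mulr_ge0.
pose dj j := inner d (sink j.+1).
pose W m := Int (fun x => u x * cos (freq R m * x)).
(* [dj j] belongs to frequency [j + 1], and [weight_submul] adds another 1 to it. *)
pose mu j : R := `|dj j| * powR j.+2%:R s.
pose y m : R := C ^+ 2 * powR m.+1%:R (s - 1) ^+ 2.
have mu0 j : 0 <= mu j by rewrite mulr_ge0 ?powR_ge0.
have y0 m : 0 <= y m by rewrite mulr_ge0 ?sqr_ge0.
have [Y hY] : exists Y : R, forall K, \sum_(m < K) y m <= Y.
  have [|B hB] := @sum_powR_sqr_bounded R (s - 1); first by lra.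
  by exists (C ^+ 2 * B) => K; rewrite -mulr_sumr ler_wpM2l ?sqr_ge0.
(* [j^s |d_j|] is the product of [j^t |d_j|] and [j^(s - t)], both square summable since
   [s - t < - 1/2]; products are bounded by sums of squares. *)
have [M hM] : exists M : R, forall N, \sum_(j < N) mu j <= M.
  have [|B hB] := @sum_powR_sqr_bounded R (s - t); first by lra.
  exists (powR 2 s * (Bt + B)) => N.
  apply: le_trans (_ : powR 2 s * (\sum_(k < N) (powR k.+1%:R t * dj k) ^+ 2 + \sum_(k < N) powR k.+1%:R (s - t) ^+ 2) <= _).
    rewrite -big_split/= mulr_sumr; apply: ler_sum => j _; rewrite /mu.
    have h1 : powR j.+2%:R s <= powR 2 s * powR j.+1%:R s :> R.
      apply: (@weight_submul s j.+2 j 1 (ltW s0)); rewrite mulSn mul1n; lia.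
    have j0 : 0 < j.+1%:R :> R by rewrite ltr0n.
    have e : powR j.+1%:R s = powR j.+1%:R t * powR j.+1%:R (s - t) :> R.
      rewrite -powRD; first by congr powR; ring.
      by rewrite (gt_eqF j0) implybT.
    apply: le_trans (ler_wpM2l (normr_ge0 _) h1) _.
    rewrite mulrCA ler_wpM2l ?powR_ge0// e.
    rewrite -[(powR _ t * _) ^+ 2]real_normK ?num_real// normrM (ger0_norm (powR_ge0 _ _)).
    move: (powR _ t) (powR _ (s - t)) `|dj j| (powR_ge0 j.+1%:R t : 0 <= powR j.+1%:R t :> R) (powR_ge0 j.+1%:R (s - t) : 0 <= _ :> R) (normr_ge0 (dj j)) => p q r p0 q0 r0.
    have := sqr_ge0 (p * r - q); have := mulr_ge0 (mulr_ge0 p0 r0) q0.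
    rewrite sqrrB (_ : r * (p * q) = p * r * q); last by ring.
    lra.
  rewrite ler_wpM2l ?powR_ge0// lerD//.
have xW m : (powR m.+1%:R s * W m) ^+ 2 <= y m.
  have m0 : 0 < m.+1%:R :> R by rewrite ltr0n.
  rewrite /y -exprMn -[leLHS]real_normK ?num_real// lerXn2r ?nnegrE ?mulr_ge0 ?powR_ge0//.
  rewrite normrM (ger0_norm (powR_ge0 _ _)).
  have -> : powR m.+1%:R s = powR m.+1%:R (s - 1) * m.+1%:R :> R.
    rewrite -{3}[m.+1%:R]powRr1 ?ler0n// -powRD; first by rewrite subrK.
    by rewrite (gt_eqF m0) implybT.
  by rewrite -mulrA mulrC ler_wpM2r ?powR_ge0// hC.
have Lus k : L2 (fun x => u x * sink k x).
  have := @L2_bounded_mul _ u (@sink R k) (Num.sqrt 2) Lu (L2_measurable (L2_sink R k)) (fun x _ => sink_bound k x).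
  by congr L2; apply/funext => x; rewrite mulrC.
have Md : forall N, \sum_(0 <= j < N) `|inner d (sink j.+1)| <= M.
  move=> N; apply: le_trans (hM N); rewrite big_mkord; apply: ler_sum => j _.
  have e1 : powR 1 s = 1 :> R by rewrite powR1.
  rewrite /mu ler_peMr//; rewrite -[leLHS]e1; rewrite ge0_ler_powR ?nnegrE ?(ltW s0)// ler1n//.
pose A N k := \sum_(j < N) dj j * (W (absd k j.+1) - W (k + j.+1)%N).
have cA k : A N k @[N --> \oo] --> inner d (fun x => u x * sink k x).
  apply: cvg_trans (sine_series_inner Ld Md (Lus k)); apply: near_eq_cvg; apply: nearW => N.
  by apply: eq_bigr => j _; rewrite inner_sink_mul.
exists (M * (M * (6 * Y))) => K.
have c1 : \sum_(k < K) (powR k.+1%:R s * A N k.+1) ^+ 2 @[N --> \oo] -->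
   \sum_(k < K) (powR k.+1%:R s * inner d (fun x => u x * sink k.+1 x)) ^+ 2.
  apply: (@cvg_big _ _ _ _ _ add_continuous) => k _.
  have h : powR k.+1%:R s * A N k.+1 @[N --> \oo] --> powR k.+1%:R s * inner d (fun x => u x * sink k.+1 x).
    by apply: cvgMr; exact: cA.
  exact: (cvgM h h).
apply: (cvgr_to_le c1); apply: nearW => N.
pose xx k j : R := powR (absd k j).+1%:R s * `|W (absd k.+1 j.+1)| + powR (k.+1 + j.+1).+1%:R s * `|W (k.+1 + j.+1)%N|.
have M0 : 0 <= M by apply: le_trans (hM 0%N); rewrite big_ord0.
have step k : (powR k.+1%:R s * A N k.+1) ^+ 2 <= M * \sum_(j < N) mu j * (xx k j) ^+ 2.
  apply: le_trans (jensen _ mu0 (hM N)).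
  rewrite -[leLHS]real_normK ?num_real// lerXn2r ?nnegrE//.
    by apply: sumr_ge0 => j _; rewrite mulr_ge0// addr_ge0// mulr_ge0 ?powR_ge0.
  rewrite normrM (ger0_norm (powR_ge0 _ _)).
  apply: le_trans (ler_wpM2l (powR_ge0 _ _) (ler_norm_sum _ _ _)) _.
  rewrite mulr_sumr; apply: ler_sum => j _.
  rewrite normrM mulrCA /mu /xx -!mulrA ler_wpM2l//.
  apply: le_trans (ler_wpM2l (powR_ge0 _ _) (ler_normB _ _)) _.
  rewrite !mulrDr; apply: lerD; rewrite mulrA; apply: ler_wpM2r => //.
    by rewrite mulrC; apply: weight_submul; [exact: ltW|apply: leq_weight; rewrite /absd; lia].
  by rewrite mulrC; apply: weight_submul; [exact: ltW|apply: leq_weight; lia].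
(* As [s < 1], [y] decreases, so the frequency [k + j + 2] is absorbed into [y k]. *)
have xx2 k j : xx k j ^+ 2 <= 2 * y (absd k j) + 2 * y k.
  have h1 := xW (absd k j); have h2 := xW (k.+1 + j.+1)%N.
  have h3 : y (k.+1 + j.+1)%N <= y k.
    rewrite /y ler_wpM2l ?sqr_ge0// lerXn2r ?nnegrE ?powR_ge0//.
    rewrite (_ : s - 1 = - (1 - s)); last by ring.
    rewrite !powRN lef_pV2 ?posrE ?powR_gt0 ?ltr0n//.
    by rewrite ge0_ler_powR ?nnegrE ?ler_nat//; [lra|lia].
  have aE : absd k.+1 j.+1 = absd k j by rewrite /absd !subSS.
  rewrite /xx aE.
  rewrite -[in X in X <= y (absd k j)]real_normK ?num_real// normrM (ger0_norm (powR_ge0 _ _)) in h1.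
  rewrite -[in X in X <= y (k.+1 + j.+1)%N]real_normK ?num_real// normrM (ger0_norm (powR_ge0 _ _)) in h2.
  have := le_trans h2 h3.
  set X1 := powR _ _ * _ in h1 *; set X2 := powR _ _ * _ in h2 *.
  move=> h4; have := sqr_ge0 (X1 - X2); rewrite sqrrB sqrrD; lra.
apply: le_trans (_ : \sum_(k < K) M * \sum_(j < N) mu j * (2 * y (absd k j) + 2 * y k) <= _).
  apply: ler_sum => k _; apply: le_trans (step k) _.
  by rewrite ler_wpM2l//; apply: ler_sum => j _; rewrite ler_wpM2l.
rewrite -mulr_sumr ler_wpM2l// exchange_big/=.
(* The distances contribute [2 (Y + Y)] by [sum_absd], and the terms [y k] contribute [2 Y]. *)
apply: le_trans (_ : \sum_(j < N) mu j * (6 * Y) <= _).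
  apply: ler_sum => j _; rewrite -mulr_sumr ler_wpM2l//.
  have -> : \sum_(k < K) (2 * y (absd k j) + 2 * y k) = 2 * (\sum_(k < K) y (absd k j)) + 2 * (\sum_(k < K) y k).
    by rewrite !mulr_sumr -big_split.
  rewrite (_ : 6 * Y = 2 * (Y + Y) + 2 * Y); last by ring.
  apply: lerD; apply: ler_wpM2l => //.
  exact: le_trans (sum_absd K j y0) (lerD (hY _) (hY _)).
rewrite -mulr_suml ler_wpM2r//.
have Y0 : 0 <= Y by apply: le_trans (hY 0%N); rewrite big_ord0.
lra.
Qed.

End SineSeries.

(** * The solution of (Q) *)

Section CosineBounds.
Variable R : realType.
Implicit Types (v w : R -> R).

Definition cos_decay v := exists C : R,
  forall m, m.+1%:R * `|Int (fun x => v x * cos (freq R m * x))| <= C.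

Lemma cos_decay_freq v (C : R) :
  (forall m, `|freq R m * Int (fun x => v x * cos (freq R m * x))| <= C) -> cos_decay v.
Proof.
move=> h; have C0 : 0 <= C by apply: le_trans (h 0%N).
exists (`|Int (fun x => v x * cos (freq R 0 * x))| + 2 * C) => -[|m].
  by rewrite mul1r lerDl mulr_ge0.
set I := `|Int _|; apply: le_trans (_ : 2 * (freq R m.+1 * I) <= _).
  rewrite mulrA ler_wpM2r ?normr_ge0//.
  have := freq_ge_nat R m.+1; have : 1 <= m.+1%:R :> R by rewrite ler1n.
  rewrite -[m.+2%:R]natr1; lra.
apply: le_trans (_ : 2 * C <= _); last by rewrite lerDr.
have f0 : 0 <= freq R m.+1 by apply/ltW/freq_gt0.
by rewrite ler_wpM2l// -[freq _ _](ger0_norm f0) -normrM.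
Qed.

Lemma cos_decayD v w : L2 v -> L2 w -> cos_decay v -> cos_decay w ->
  cos_decay (fun x => v x + w x).
Proof.
move=> Lv Lw [C hC] [D hD]; exists (C + D) => m.
apply: le_trans (lerD (hC m) (hD m)); rewrite -mulrDr ler_wpM2l//.
have -> : Int (fun x => (v x + w x) * cos (freq R m * x)) =
  Int (fun x => v x * cos (freq R m * x)) + Int (fun x => w x * cos (freq R m * x)).
  by rewrite -IntD; [apply: eq_Int => x _; rewrite mulrDl|apply: L2_intg_mul => //; exact: L2_cos..].
exact: ler_normD.
Qed.

Lemma cos_decayB v w : L2 v -> L2 w -> cos_decay v -> cos_decay w ->
  cos_decay (fun x => v x - w x).
Proof.
move=> Lv Lw [C hC] [D hD]; exists (C + D) => m.
apply: le_trans (lerD (hC m) (hD m)); rewrite -mulrDr ler_wpM2l//.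
have -> : Int (fun x => (v x - w x) * cos (freq R m * x)) =
  Int (fun x => v x * cos (freq R m * x)) - Int (fun x => w x * cos (freq R m * x)).
  by rewrite -IntB; [apply: eq_Int => x _; rewrite mulrBl|apply: L2_intg_mul => //; exact: L2_cos..].
exact: ler_normB.
Qed.

Lemma AC_cos_decay p dp : AC p dp -> cos_decay p.
Proof.
move=> hp; apply: (@cos_decay_freq _ (Int (fun x => `|dp x|))) => m.
have i := AC_intg hp.
rewrite (AC_cos_coef m hp) normrN.
have ii := AC_intg_mul i (AC_sin (freq R m)).
apply: le_trans (le_abs_Int ii) _; apply: le_Int; [exact: intg_abs|exact: intg_abs|].
by move=> x _; rewrite normrM ler_piMr// ler_norml sin_geN1 sin_le1.
Qed.

(** The boundary terms need not vanish, so integration by parts yields only [O(1/k)]; [Wt_inv]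
    accepts this below [1/2]. *)
Lemma AC_Wt (s : R) p dp : s < 1 / 2 -> AC p dp -> Wt s (fun k => inner p (sink k)).
Proof.
move=> s1 hp; have i := AC_intg hp.
apply: (@Wt_inv _ _ _ (Num.sqrt 2 * (Int (fun x => `|dp x|) + (`|p 1| + `|p 0|)))) => // k.
have e : inner p (sink k.+1) = Num.sqrt 2 * Int (fun x => p x * sin (freq R k.+1 * x)).
  rewrite -IntZ; first by apply: eq_Int => x _; rewrite /sink mulrCA.
  by apply: L2_intg_mul; [exact: AC_L2 hp|exact: L2_sin].
rewrite e mulrCA (AC_sin_coef _ hp) normrM (ger0_norm (sqrtr_ge0 _)) ler_wpM2l ?sqrtr_ge0//.
apply: le_trans (ler_normB _ _) _; apply: lerD.
  have ii := AC_intg_mul i (AC_cos (freq R k.+1)).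
  apply: le_trans (le_abs_Int ii) _; apply: le_Int; [exact: intg_abs|exact: intg_abs|].
  by move=> x _; rewrite normrM ler_piMr// ler_norml cos_geN1 cos_le1.
apply: le_trans (ler_normB _ _) _; rewrite lerD2r normrM ler_piMr//.
by rewrite ler_norml cos_geN1 cos_le1.
Qed.

End CosineBounds.

(** * The equation tested against sines, for one potential *)

Section Solution.
Variables (R : realType) (alpha c0 s T : R) (q phiq u0 f u : R -> R).
Variables (lam : nat -> R) (phi : nat -> R -> R).
Hypotheses (al : 0 < alpha < 1) (s01 : s < 1 / 2) (T0 : 0 < T).
Hypotheses (adm : admissible c0 q) (es : eigensystem q lam phi).
Hypotheses (Lu0 : L2 u0) (Lf : L2 f) (hphiq : strong_sol q phiq).
Hypothesis (hu : sol_at alpha lam phi phiq u0 f T u).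

Let lam1 n : 1 <= lam n. Proof. exact: eigenvalue_ge1 adm es n. Qed.
Let lam0 n : 0 < lam n. Proof. exact: lt_le_trans (lam1 n). Qed.

Let cM : R := (1 - alpha) / Gamma (1 - alpha + 1).
(** The [c_T] of the overview, since [cM] is [1 / Gamma (1 - alpha)]. *)
Definition leading_coef := cM / powR T alpha.
Let rho n := mittag_leffler alpha 1 (- lam n * powR T alpha).
Let sigma n := lam n * rho n - leading_coef.

Let Ta0 : 0 < powR T alpha. Proof. by rewrite powR_gt0. Qed.

(** The asymptotics at [x = lam n * T^alpha] bound [sigma] by a multiple of [lam n ^(-1/2)]. The
    bound on [rho] follows, because [sqrt (lam n) * rho n <= lam n * rho n] when [lam n >= 1]. *)
Lemma resolvent_symbol_bounds : exists C1 C2 : R, [/\ 0 <= C1, 0 <= C2,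
  forall n, `|rho n| * Num.sqrt (lam n) <= C1 & forall n, `|sigma n| * Num.sqrt (lam n) <= C2].
Proof.
have [C C0 hC] := mittag_leffler_asymptotics al; rewrite -/cM in hC.
have cM0 : 0 < cM := mittag_leffler_const_gt0 al.
pose D := C / Num.sqrt (powR T alpha).
have D0 : 0 <= D by rewrite divr_ge0 ?sqrtr_ge0.
have hs n : `|sigma n| * Num.sqrt (lam n) <= D / powR T alpha.
  have x0 : 0 < lam n * powR T alpha by rewrite mulr_gt0.
  have := hC _ x0.
  have -> : lam n * powR T alpha * mittag_leffler alpha 1 (- (lam n * powR T alpha)) - cM =
     sigma n * powR T alpha.
    by rewrite /sigma /rho /leading_coef mulNr mulrBl divfK ?gt_eqF// mulrAC.
  rewrite normrM (gtr0_norm Ta0) sqrtrM ?(ltW (lam0 n))// => h.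
  have sl : 0 < Num.sqrt (lam n) by rewrite sqrtr_gt0.
  rewrite ler_pdivlMr// mulrAC -ler_pdivlMr//.
  by rewrite /D; apply: le_trans h _; rewrite invfM mulrA mulrAC.
exists (leading_coef + D / powR T alpha), (D / powR T alpha); split => //.
- by rewrite addr_ge0// divr_ge0// ltW.
- by rewrite divr_ge0// ltW.
move=> n.
have r0 : 0 <= rho n.
  have x0 : 0 < lam n * powR T alpha by rewrite mulr_gt0.
  by have /andP[] := mittag_leffler_itv al x0; rewrite -mulNr.
rewrite ger0_norm//.
have sl : 1 <= Num.sqrt (lam n) by rewrite -[X in X <= _]sqrtr1 ler_wsqrtr.
have sl2 : Num.sqrt (lam n) * Num.sqrt (lam n) = lam n by rewrite -expr2 sqr_sqrtr ?ltW.
have h1 : rho n * Num.sqrt (lam n) <= lam n * rho n.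
  rewrite mulrC ler_wpM2r// -[leRHS]sl2 ler_peMr// (le_trans _ sl)//.
apply: le_trans h1 _.
have -> : lam n * rho n = leading_coef + sigma n by rewrite /sigma addrC subrK.
rewrite lerD2l; apply: le_trans (ler_norm _) _; apply: le_trans (hs n).
by rewrite ler_peMr.
Qed.

(** The identity is [A_q U] tested against [e_k], for the explicit representative
    [U = w1 + (phiq - w2) + (g - w3)] of [u]. The boundary terms come from [phiq], and [f] from [g].
    The multiplier applied to [phiq] and [g] also produces [leading_coef] times these functions;
    both join [S], one being absolutely continuous and the other smoothed by [A_q^(-1)]. *)
Lemma solution_structure : exists U : R -> R, [/\ L2 U, eq_L2 u U, cos_decay U &
  exists2 S : nat -> R, Wt s S & forall k,
   freq R k ^+ 2 * inner U (sink k) + inner U (fun x => q x * sink k x) =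
   Num.sqrt 2 * (freq R k * (phiq 0 - phiq 1 * cos (freq R k))) + inner f (sink k)
   + leading_coef * inner u0 (sink k) + S k].
Proof.
have [w1 [w2 [g [w3 [hw1 [hw2 [hg [hw3 ueq]]]]]]]] := hu.
have [C1 [C2 [C10 C20 hr hs]]] := resolvent_symbol_bounds.
have [dp hp _] := strong_solP hphiq.
have Lp := AC_L2 hp.
have Lw1 : L2 w1 by case: hw1. have Lw2 : L2 w2 by case: hw2.
have Lw3 : L2 w3 by case: hw3. have Lg : L2 g by case: hg.
have Lphi := L2_phi es.
have sE n : lam n * rho n = leading_coef + sigma n by rewrite /sigma addrC subrK.
have s1 : s <= 1 by apply/ltW/(lt_trans s01); lra.
have [S1 eS1 bS1] := spectral_multiplier_sink adm es Lu0 C20 sE hs hw1.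
have [S2 eS2 bS2] := spectral_multiplier_sink adm es Lp C20 sE hs hw2.
have [S3 eS3 bS3] := spectral_multiplier_sink adm es Lg C20 sE hs hw3.
(* [A_q^(-1)] is itself handled as a multiplier, with leading coefficient 1 and remainder symbol
   0. *)
have gE n : lam n * (lam n)^-1 = 1 + 0 by rewrite divff ?addr0// gt_eqF.
have g0 n : `|(0 : R)| * Num.sqrt (lam n) <= 0 by rewrite normr0 mul0r.
have [S4 eS4 bS4] := spectral_multiplier_sink adm es Lf (lexx 0) gE g0 hg.
have gr n : `|(lam n)^-1| * Num.sqrt (lam n) <= 1.
  have sl : 1 <= Num.sqrt (lam n) by rewrite -[X in X <= _]sqrtr1 ler_wsqrtr.
  have sl2 : Num.sqrt (lam n) * Num.sqrt (lam n) = lam n by rewrite -expr2 sqr_sqrtr ?ltW.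
  rewrite ger0_norm ?invr_ge0 ?(ltW (lam0 n))// mulrC ler_pdivrMr// mul1r -[leRHS]sl2 ler_peMr//.
have weak (r : nat -> R) v w : L2_series (fun n x => r n * inner v (phi n) * phi n x) w ->
   forall h, L2 h -> \sum_(n < N) r n * inner v (phi n) * inner (phi n) h @[N --> \oo] --> inner w h.
  move=> hw h Lh.
  have Lt n : L2 (fun x => r n * inner v (phi n) * phi n x) by apply: L2Z.
  apply: cvg_trans (L2_series_inner Lt Lh hw); apply: near_eq_cvg; apply: nearW => N.
  by apply: eq_bigr => n _; rewrite innerZl.
have cd (r : nat -> R) v w (C : R) : L2 v -> 0 <= C -> (forall n, `|r n| * Num.sqrt (lam n) <= C) ->
   L2_series (fun n x => r n * inner v (phi n) * phi n x) w -> cos_decay w.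
  move=> Lv C0 hrC hw; apply: (@cos_decay_freq _ _ (Num.sqrt (C ^+ 2 * inner v v))) => m.
  rewrite -sqrtr_sqr ler_wsqrtr//.
  exact: (smooth_cos adm es Lv C0 hrC (weak r v w hw _ (L2_cos (freq R m)))).
have Wg : Wt s (fun k => inner g (sink k)).
  apply: (@Wt_freq _ _ _ (1 ^+ 2 * inner f f)) => // K.
  apply: (smooth_sine adm es Lf ler01 gr (a := fun k => inner g (sink k))) => k.
  exact: weak hg _ (L2_sink R k).
pose U x := w1 x + (phiq x - w2 x) + (g x - w3 x).
have LA := L2B Lp Lw2; have LB := L2B Lg Lw3; have LC := L2D Lw1 LA.
have LU : L2 U := L2D LC LB.
have cd1 := cd _ _ _ _ Lu0 C10 hr hw1. have cd2 := cd _ _ _ _ Lp C10 hr hw2.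
have cd3 := cd _ _ _ _ Lg C10 hr hw3. have cdg := cd _ _ _ _ Lf ler01 gr hg.
exists U; split => //.
  apply: cos_decayD => //; last exact: cos_decayB.
  by apply: cos_decayD => //; apply: cos_decayB => //; exact: AC_cos_decay hp.
exists (fun k => S1 k - S2 k - S3 k + S4 k - leading_coef * inner phiq (sink k) - leading_coef * inner g (sink k)).
  apply: WtB; last exact: WtZ.
  apply: WtB; last by apply: WtZ; exact: AC_Wt s01 hp.
  apply: WtD; last exact: Wt_freq s1 bS4.
  apply: WtB; last exact: Wt_freq s1 bS3.
  by apply: WtB; [exact: Wt_freq s1 bS1|exact: Wt_freq s1 bS2].
move=> k.
have Lq : L2 (fun x => q x * sink k x) by apply: (L2_q_mul adm); exact: L2_sink.
have Ls := L2_sink R k.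
have UE h : L2 h -> inner U h = inner w1 h + (inner phiq h - inner w2 h) + (inner g h - inner w3 h).
  by move=> Lh; rewrite /U innerDl// innerDl// !innerBl.
rewrite !UE//.
have ep : freq R k ^+ 2 * inner phiq (sink k) + inner phiq (fun x => q x * sink k x) =
   Num.sqrt 2 * (freq R k * (phiq 0 - phiq 1 * cos (freq R k))).
  rewrite -(strong_sol_sin_coef k hphiq) mulrDr; congr (_ + _).
    rewrite mulrCA; congr (_ * _); rewrite -IntZ; last by apply: L2_intg_mul => //; exact: L2_sin.
    by apply: eq_Int => x _; rewrite /sink mulrCA.
  rewrite -IntZ; first by apply: eq_Int => x _; rewrite /sink; ring.
  have := L2_intg_mul Lp (L2_q_mul adm (L2_sin (freq R k))).
  by apply: eq_intg => x _; ring.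
have := eS1 k; have := eS2 k; have := eS3 k; have := eS4 k; rewrite mul1r.
rewrite -ep; move: (inner w1 _) (inner w2 _) (inner w3 _) => *.
lra.
Qed.

End Solution.

Theorem mainTheorem8 (R : realType) (alpha c0 a0 a1 s' s T Tt : R)
    (u0 f q qt phiq phiqt u ut : R -> R)
    (lam lamt : nat -> R) (phi phit : nat -> R -> R) :
  0 < alpha < 1 -> 0 < c0 -> 0 < a0 -> 0 < a1 ->
  0 < s' < 1 / 2 -> s' + 1 / 2 < s < 1 ->
  L2 u0 -> ~ Hdot s' u0 -> Hdot s f ->
  admissible c0 q -> Hdot s q -> admissible c0 qt -> Hdot s qt ->
  0 < T -> 0 < Tt ->
  eigensystem q lam phi -> eigensystem qt lamt phit ->
  phi_q_sol q a0 a1 phiq -> phi_q_sol qt a0 a1 phiqt ->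
  sol_at alpha lam phi phiq u0 f T u ->
  sol_at alpha lamt phit phiqt u0 f Tt ut ->
  eq_L2 u ut ->
  T = Tt.
Proof.
move=> al _ _ _ s'01 ss Lu0 nH [Lf _] adm hq admt hqt T0 Tt0 es est [p0 [p1 hp]] [pt0 [pt1 hpt]] hu hut uut.
have /andP[s'0 s'1] := s'01; have /andP[ss1 _] := ss.
have [U [LU uU dU [S WS eS]]] := solution_structure al s'1 T0 adm es Lu0 Lf hp hu.
have [V [LV uV _ [S' WS' eS']]] := solution_structure al s'1 Tt0 admt est Lu0 Lf hpt hut.
rewrite p0 p1 in eS; rewrite pt0 pt1 in eS'.
set cT := leading_coef alpha T in eS; set cTt := leading_coef alpha Tt in eS'.
have UV : eq_L2 U V.
  exact: (ae_eq_trans (ae_eq_trans (ae_eq_sym uU) uut) uV).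
have [Lq _] := hq; have [Lqt _] := hqt.
pose d x := q x - qt x.
have Ld : L2 d := L2B Lq Lqt.
have bd x : Omega x -> `|d x| <= c0.
  move=> Ox; have [_ /(_ x Ox)/andP[q0 q1]] := adm; have [_ /(_ x Ox)/andP[qt0 qt1]] := admt.
  by rewrite ler_norml /d; apply/andP; split; lra.
have Wd : Wt s (fun k => inner d (sink k)).
  apply: Wt_eq (WtB (Hdot_Wt hq) (Hdot_Wt hqt)) => k.
  by rewrite innerBl//; exact: L2_sink.
(* The regularity [s] of [q - qt] takes the role of [t] in the product estimate, and [s'] that of
   the weight. *)
have WdU := Wt_product s'01 ss1 Ld (L2_measurable Ld) bd LU Wd.
have [C hC] := dU; have {WdU hC} WdU := WdU C hC.
have key k : (cT - cTt) * inner u0 (sink k) = inner d (fun x => U x * sink k x) - S k + S' k.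
  have Ls := L2_sink R k.
  have Lqs := L2_q_mul adm Ls; have Lqts := L2_q_mul admt Ls.
  have e1 := eS k; have e2 := eS' k.
  (* As [U] and [V] agree almost everywhere, the second identity may be written for [U]; the
     difference then loses the terms in [freq R k ^+ 2], the boundary terms and [f]. *)
  rewrite -(inner_ae LU LV Ls UV) -(inner_ae LU LV Lqts UV) in e2.
  have -> : inner d (fun x => U x * sink k x) =
      inner U (fun x => q x * sink k x) - inner U (fun x => qt x * sink k x).
    rewrite !(innerC U) -innerBl//; apply: eq_Int => x _; rewrite /d; ring.
  rewrite mulrBl; move: (inner U (fun x => q x * sink k x)) (inner U (fun x => qt x * sink k x)) e1 e2 => A B e1 e2.
  have := e1; rewrite -[freq R k ^+ 2 * _](addrK B) e2 => e3.
  lra.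
(* Equal leading coefficients give equal powers [T^alpha] and [Tt^alpha], and raising to [1 / alpha]
   recovers the times. *)
have [cc|cc] := eqVneq cT cTt.
  have /andP[al0 al1] := al.
  have cM0 := mittag_leffler_const_gt0 al.
  have PT : 0 < powR T alpha by rewrite powR_gt0.
  have PTt : 0 < powR Tt alpha by rewrite powR_gt0.
  have ee : powR T alpha = powR Tt alpha.
    have := cc; rewrite /cT /cTt /leading_coef => /(mulfI (lt0r_neq0 cM0)).
    exact: invr_inj.
  have := congr1 (fun z => powR z alpha^-1) ee.
  by rewrite -!powRrM !divff ?gt_eqF// !powRr1 ?ltW.
exfalso; apply: nH; apply: Wt_Hdot => //.
apply: (@Wt_eq _ _ _ (fun k => (cT - cTt)^-1 * (inner d (fun x => U x * sink k x) - S k + S' k))).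
  by move=> k; rewrite -key mulrA mulVf ?mul1r// subr_eq0.
by apply: WtZ; apply: WtD => //; exact: WtB.
Qed.
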